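(* Let $(R,\mathfrak m,k)$ be a local ring that has a dualizing complex and that contains an $R$-regular sequence $\boldsymbol f$ with $\mathfrak m^3\subseteq(\boldsymbol f)$. If $\operatorname{Ext}^i_R(D^R,R)=0$ for all integers $i$ with $1\le i\le\dim R+1$, then $R$ is Gorenstein.
   Context: A local ring $(R,\mathfrak m,k)$ is a commutative noetherian ring $R$ with unique maximal ideal $\mathfrak m$ and residue field $k=R/\mathfrak m$. Complexes $M$ of $R$-modules are graded homologically ($\partial_i\colon M_i\to M_{i-1}$); $M$ has finite homology if $H_i(M)$ is a finitely generated $R$-module for all $i$ and is zero for almost all $i$. For complexes $M,N$ with $H(M)$ bounded below, $\operatorname{Ext}^i_R(M,N)=H_{-i}(\operatorname{Hom}_R(F,N))$, where $F\to M$ is a quasi-isomorphism from a bounded below complex of projective modules. A complex $D$ of $R$-modules is dualizing if it has finite homology and there is an integer $d$ such that $\operatorname{Ext}^d_R(k,D)\cong k$ and $\operatorname{Ext}^i_R(k,D)=0$ for $i\ne d$. $D^R$ denotes a dualizing complex of $R$ shifted so that $H_i(D^R)=0$ for $i<0$ and $H_0(D^R)\neq 0$ (it is unique up to quasi-isomorphism). *)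

(* Defs.v *)
From HB Require Import structures.
From mathcomp Require Import all_boot all_order all_algebra.
From mathcomp Require Import boolp classical_sets functions.

Set Implicit Arguments.
Unset Strict Implicit.
Unset Printing Implicit Defensive.

Import Order.TTheory GRing.Theory Num.Theory.
Local Open Scope ring_scope.
Local Open Scope quotient_scope.

Section Modules.
Variable R : comNzRingType.
Implicit Types U V M : lmodType R.

Definition zero_module M : Prop := forall x : M, x = 0.

Definition module_iso U V : Prop := exists f : {linear U -> V}, bijective f.

Definition in_span M (s : seq M) (x : M) : Prop :=
  exists c : 'I_(size s) -> R, x = \sum_(i < size s) c i *: s`_i.

Definition fin_gen M : Prop := exists s : seq M, forall x : M, in_span s x.

Definition projective (P : lmodType R) : Prop :=
  forall (A B : lmodType R) (g : {linear A -> B}) (f : {linear P -> B}),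
    (forall b, exists a, g a = b) ->
    exists h : {linear P -> A}, forall x, g (h x) = f x.

Definition injective_module (I : lmodType R) : Prop :=
  forall (A B : lmodType R) (g : {linear A -> B}) (f : {linear A -> I}),
    injective g ->
    exists h : {linear B -> I}, forall x, h (g x) = f x.

End Modules.

Section SubModule.
Variables (R : comNzRingType) (V : lmodType R) (S : submodClosed V).

Record submodule : Type := SubModule { submodule_val : V; _ : submodule_val \in S }.

HB.instance Definition _ := [isSub for submodule_val].
HB.instance Definition _ := [Choice of submodule by <:].
HB.instance Definition _ := [SubChoice_isSubLmodule of submodule by <:].

End SubModule.

Section QuotientModule.
Variables (R : comNzRingType) (V : lmodType R) (S : submodClosed V).

(* [submodClosed] does not inherit from [zmodClosed], which [Quotient.quot]
   requires. *)
Definition additive_pred : {pred V} := fun x => x \in S.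

Lemma additive_pred_closed : zmod_closed additive_pred.
Proof. exact: GRing.submod_closedB (submodClosedP S). Qed.
HB.instance Definition _ :=
  GRing.isZmodClosed.Build V additive_pred additive_pred_closed.

Definition quotient_module : Type := Quotient.quot additive_pred.

HB.instance Definition _ := GRing.Zmodule.on quotient_module.
HB.instance Definition _ := EqQuotient.on quotient_module.

Definition quotient_scale (a : R) (x : quotient_module) : quotient_module :=
  \pi_quotient_module (a *: repr x).

Lemma quotient_piE (x y : V) :
  (\pi_quotient_module x == \pi_quotient_module y) = (x - y \in S).
Proof. by rewrite -[RHS]/(x - y \in additive_pred) Quotient.idealrBE. Qed.

Lemma quotient_scale_pi a (x : V) :
  quotient_scale a (\pi_quotient_module x) = \pi_quotient_module (a *: x).
Proof.
rewrite /quotient_scale; apply/eqP; rewrite quotient_piE -scalerBr.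
by apply: rpredZ; rewrite -quotient_piE reprK.
Qed.

Lemma quotient_piD (x y : V) :
  \pi_quotient_module (x + y) = \pi_quotient_module x + \pi_quotient_module y.
Proof. exact (@Quotient.pi_add V (additive_pred : zmodClosed V) x y). Qed.

Lemma quotient_scaleA a b x :
  quotient_scale a (quotient_scale b x) = quotient_scale (a * b) x.
Proof.
elim/quotW: x => x; rewrite (quotient_scale_pi b) (quotient_scale_pi a).
by rewrite quotient_scale_pi scalerA.
Qed.

Lemma quotient_scale1 : left_id 1 quotient_scale.
Proof. by elim/quotW => x; rewrite quotient_scale_pi scale1r. Qed.

Lemma quotient_scaleDr : right_distributive quotient_scale +%R.
Proof.
move=> a; elim/quotW => x; elim/quotW => y.
by rewrite -quotient_piD !quotient_scale_pi scalerDr quotient_piD.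
Qed.

Lemma quotient_scaleDl x : {morph quotient_scale^~ x : a b / a + b}.
Proof.
move=> a b; elim/quotW: x => x.
by rewrite !quotient_scale_pi scalerDl quotient_piD.
Qed.

HB.instance Definition _ :=
  GRing.Zmodule_isLmodule.Build R quotient_module
    quotient_scaleA quotient_scale1 quotient_scaleDr quotient_scaleDl.

End QuotientModule.

Section KernelImage.
Variables (R : comNzRingType) (U V : lmodType R) (f : {linear U -> V}).

Definition kernel : {pred U} := [pred x | f x == 0].

Lemma kernel_closed : submod_closed kernel.
Proof.
split=> [|a x y]; rewrite !inE ?raddf0 ?eqxx // => /eqP fx /eqP fy.
by rewrite linearP fx fy scaler0 addr0.
Qed.
HB.instance Definition _ := GRing.isSubmodClosed.Build R U kernel kernel_closed.

Definition image_pred : {pred V} := [pred y | `[< exists x, f x = y >]].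

Lemma image_closed : submod_closed image_pred.
Proof.
split=> [|a x y]; rewrite !inE; first by exists 0; rewrite raddf0.
by move=> [u <-] [v <-]; exists (a *: u + v); rewrite linearP.
Qed.
HB.instance Definition _ :=
  GRing.isSubmodClosed.Build R V image_pred image_closed.

End KernelImage.

Section ProductModule.
Variables (R : comNzRingType) (I : Type) (V : I -> lmodType R).

Definition product_module : Type := forall i, V i.

HB.instance Definition _ := gen_eqMixin product_module.
HB.instance Definition _ := gen_choiceMixin product_module.

Implicit Types f g : product_module.

Definition product_zero : product_module := fun=> 0.
Definition product_opp f : product_module := fun i => - f i.
Definition product_add f g : product_module := fun i => f i + g i.
Definition product_scale (a : R) f : product_module := fun i => a *: f i.

Lemma product_addA : associative product_add.
Proof. by move=> f g h; apply: functional_extensionality_dep => i; apply: addrA. Qed.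
Lemma product_addC : commutative product_add.
Proof. by move=> f g; apply: functional_extensionality_dep => i; apply: addrC. Qed.
Lemma product_add0 : left_id product_zero product_add.
Proof. by move=> f; apply: functional_extensionality_dep => i; apply: add0r. Qed.
Lemma product_addN : left_inverse product_zero product_opp product_add.
Proof. by move=> f; apply: functional_extensionality_dep => i; apply: addNr. Qed.

HB.instance Definition _ := GRing.isZmodule.Build product_module
  product_addA product_addC product_add0 product_addN.

Lemma product_scaleA a b f :
  product_scale a (product_scale b f) = product_scale (a * b) f.
Proof. by apply: functional_extensionality_dep => i; apply: scalerA. Qed.
Lemma product_scale1 : left_id 1 product_scale.
Proof. by move=> f; apply: functional_extensionality_dep => i; apply: scale1r. Qed.
Lemma product_scaleDr : right_distributive product_scale +%R.
Proof. by move=> a f g; apply: functional_extensionality_dep => i; apply: scalerDr. Qed.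
Lemma product_scaleDl f : {morph product_scale^~ f : a b / a + b}.
Proof. by move=> a b; apply: functional_extensionality_dep => i; apply: scalerDl. Qed.

HB.instance Definition _ := GRing.Zmodule_isLmodule.Build R product_module
  product_scaleA product_scale1 product_scaleDr product_scaleDl.

End ProductModule.

(* Homologically graded complexes.  A differential is given between any two
   degrees and vanishes unless it lowers the degree by one: this avoids casts
   along equalities between degrees. *)
Record complex (R : comNzRingType) := Complex {
  cobj :> int -> lmodType R;
  diff : forall i j, {linear cobj i -> cobj j};
  diff_shape : forall i j (x : cobj i), j != i - 1 -> diff i j x = 0;
  diff_diff : forall i j k (x : cobj i), diff j k (diff i j x) = 0
}.
Arguments diff {R} X i j : rename.

Record chain_map (R : comNzRingType) (X Y : complex R) := ChainMap {
  cmap :> forall i, {linear X i -> Y i};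
  cmap_diff : forall i j (x : X i), diff Y i j (cmap i x) = cmap j (diff X i j x)
}.

Section Homology.
Variable R : comNzRingType.
Implicit Types X Y : complex R.

Definition cycles X (n : int) : lmodType R := submodule (kernel (diff X n (n - 1))).

Definition boundaries X (n : int) : {pred cycles X n} :=
  [pred z | val z \in image_pred (diff X (n + 1) n)].

Arguments boundaries : clear implicits.

Lemma boundaries_closed X n : submod_closed (boundaries X n).
Proof.
pose B := image_pred (diff X (n + 1) n).
split=> [|a x y Bx By]; first by change (0 \in B); apply: rpred0.
by change (a *: val x + val y \in B); apply: rpredD => //; apply: rpredZ.
Qed.
HB.instance Definition _ X n :=
  GRing.isSubmodClosed.Build R (cycles X n) (boundaries X n) (boundaries_closed X n).

Definition homology X (n : int) : lmodType R := quotient_module (boundaries X n).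

Lemma cmap_cycle X Y (q : chain_map X Y) n (z : cycles X n) :
  q n (val z) \in kernel (diff Y n (n - 1)).
Proof.
by have := valP z; rewrite !inE cmap_diff => /eqP ->; rewrite raddf0.
Qed.

Definition homology_map X Y (q : chain_map X Y) (n : int)
    (h : homology X n) : homology Y n :=
  \pi_(homology Y n) (Sub (q n (val (repr h))) (cmap_cycle q (repr h)) : cycles Y n).

Lemma homology_map_pi X Y (q : chain_map X Y) n (z : cycles X n) :
  homology_map q (\pi_(homology X n) z) =
  \pi_(homology Y n) (Sub (q n (val z)) (cmap_cycle q z) : cycles Y n).
Proof.
rewrite /homology_map; apply/eqP; set u := repr _.
have : u - z \in boundaries X n.
  by rewrite -quotient_piE reprK.
rewrite quotient_piE.
rewrite !inE => -[y yE]; exists (q _ y).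
rewrite cmap_diff yE -[val (u - z)]/(val u - val z) raddfB.
by [].
Qed.

Definition quasi_iso X Y (q : chain_map X Y) : Prop :=
  forall n, bijective (@homology_map X Y q n).

Definition finite_homology X : Prop :=
  (forall n, fin_gen (homology X n)) /\
  exists b : nat, forall n : int, (b < `|n|)%N -> zero_module (homology X n).

End Homology.

Section Stalk.
Variables (R : comNzRingType) (M : lmodType R).

Definition stalk_obj (i : int) : lmodType R :=
  if i == 0 then M else 'rV[R]_0.

Definition stalk : complex R :=
  @Complex R stalk_obj (fun i j => \0) (fun _ _ _ _ => erefl)
    (fun _ _ _ _ => erefl).

End Stalk.

Section Hom.
Variables (R : comNzRingType) (X Y : complex R).

Definition hom_ambient : lmodType R :=
  product_module (fun i : int => product_module (fun j : int => X i -> Y j)).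

(* An element of [Hom(X,Y)_n], that is, a family of linear maps
   [X_i -> Y_(i+n)], is encoded as a family of maps between any two degrees
   that vanishes outside the degrees [i] and [i+n]. *)
Definition hom_pred (n : int) : {pred hom_ambient} :=
  [pred f | `[< (forall i j, linear (f i j)) /\
                (forall i j x, j != i + n -> f i j x = 0) >]].

Lemma hom_pred_closed n : submod_closed (hom_pred n).
Proof.
split=> [|a f g]; rewrite !inE.
  split=> // i j b x y.
  by rewrite -[LHS]/0 -[X in _ = X]/(b *: 0 + 0) scaler0 addr0.
move=> [fl fs] [gl gs]; split=> i j; last first.
  move=> x ij; rewrite -[LHS]/(a *: f i j x + g i j x).
  by rewrite fs // gs // scaler0 addr0.
move=> b x y.
rewrite -[LHS]/(a *: f i j (b *: x + y) + g i j (b *: x + y)).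
rewrite -[RHS]/(b *: (a *: f i j x + g i j x) + (a *: f i j y + g i j y)).
rewrite fl gl !scalerDr !scalerA mulrC -!addrA; congr (_ + _).
by rewrite addrCA.
Qed.
HB.instance Definition _ n :=
  GRing.isSubmodClosed.Build R hom_ambient (hom_pred n) (hom_pred_closed n).

Definition hom_obj (n : int) : lmodType R := submodule (hom_pred n).

Lemma hom_linear n (f : hom_obj n) i j : linear (val f i j).
Proof. by case: f => f /= /asboolP[]. Qed.

Lemma hom_shape n (f : hom_obj n) i j x : j != i + n -> val f i j x = 0.
Proof. by case: f => f /= /asboolP[_]; apply. Qed.

Definition sign (n : int) : R := (-1) ^+ `|n|%N.

Lemma signB1 n : sign (n - 1) = - sign n.
Proof.
rewrite /sign; case: n => [[|n]|n].
- by rewrite sub0r abszN expr1 expr0.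
- by rewrite -addn1 PoszD addrK /= addn1 exprS mulN1r opprK.
- by rewrite NegzE -opprD abszN -PoszD addn1 !abszN /= !exprS !mulN1r.
Qed.

(* [d f = d_Y f - (-1)^n f d_X] for [f] of degree [n]. *)
Definition hom_diff_fun (n m : int) (f : hom_ambient) : hom_ambient :=
  fun i j x =>
    if m == n - 1 then
      diff Y (j + 1) j (f i (j + 1) x) -
      sign n *: f (i - 1) j (diff X i (i - 1) x)
    else 0.

Arguments hom_diff_fun : clear implicits.

Lemma hom_diff_subproof n m (f : hom_obj n) :
  hom_diff_fun n m (val f) \in hom_pred m.
Proof.
apply/asboolP; rewrite /hom_diff_fun; case: eqVneq => [->|_]; last first.
  by split=> // i j b x y; rewrite scaler0 addr0.
split=> i j.
  move=> b x y; rewrite hom_linear !linearP /= hom_linear.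
  rewrite scalerDr scalerBr opprD !scalerA [b * _]mulrC -!addrA.
  by congr (_ + _); rewrite addrCA.
move=> x ij; rewrite hom_shape; last first.
  by apply: contra ij => /eqP E; rewrite addrA -E addrK.
rewrite hom_shape ?raddf0 ?scaler0 ?addr0 //.
by apply: contra ij => /eqP ->; rewrite addrAC addrA.
Qed.

Definition hom_diff n m (f : hom_obj n) : hom_obj m :=
  Sub (hom_diff_fun n m (val f)) (hom_diff_subproof m f).

Lemma hom_diff_linear n m : linear (@hom_diff n m).
Proof.
move=> a f g; apply: val_inj.
apply: functional_extensionality_dep => i.
apply: functional_extensionality_dep => j; apply: funext => x.
change (hom_diff_fun n m (a *: val f + val g) i j x =
  a *: hom_diff_fun n m (val f) i j x + hom_diff_fun n m (val g) i j x).
rewrite /hom_diff_fun; case: eqVneq => _; last by rewrite scaler0 addr0.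
change (diff Y (j + 1) j (a *: val f i (j + 1) x + val g i (j + 1) x) -
    sign n *: (a *: val f (i - 1) j (diff X i (i - 1) x) +
               val g (i - 1) j (diff X i (i - 1) x)) =
  a *: (diff Y (j + 1) j (val f i (j + 1) x) -
        sign n *: val f (i - 1) j (diff X i (i - 1) x)) +
  (diff Y (j + 1) j (val g i (j + 1) x) -
   sign n *: val g (i - 1) j (diff X i (i - 1) x))).
rewrite linearP scalerDr scalerBr opprD !scalerA [a * sign n]mulrC -!addrA.
by congr (_ + _); rewrite addrCA.
Qed.
HB.instance Definition _ n m :=
  GRing.isLinear.Build R (hom_obj n) (hom_obj m) _ (@hom_diff n m)
    (@hom_diff_linear n m).

Lemma hom_diff_shape n m (f : hom_obj n) : m != n - 1 -> hom_diff m f = 0.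
Proof.
move=> nm; apply: val_inj.
apply: functional_extensionality_dep => i.
apply: functional_extensionality_dep => j; apply: funext => x.
by rewrite /= /hom_diff_fun (negPf nm).
Qed.

Lemma hom_diff_diff n m p (f : hom_obj n) : hom_diff p (hom_diff m f) = 0.
Proof.
have [->|pm] := eqVneq p (m - 1); last exact: hom_diff_shape.
have [->|mn] := eqVneq m (n - 1); last first.
  by rewrite (hom_diff_shape f mn) raddf0.
apply: val_inj.
apply: functional_extensionality_dep => i.
apply: functional_extensionality_dep => j; apply: funext => x.
change (hom_diff_fun (n - 1) (n - 1 - 1) (hom_diff_fun n (n - 1) (val f)) i j x
  = 0).
rewrite /hom_diff_fun !eqxx signB1.
have f0 k l : val f k l 0 = 0.
  by have := @hom_linear n f k l (-1) 0 0; rewrite !scaleN1r oppr0 addr0 addNr.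
rewrite !diff_diff f0 scaler0 subr0 scaleNr opprK raddfB /= diff_diff sub0r.
by rewrite [X in - X]linearZ_LR addNr.
Qed.

Definition hom_complex : complex R :=
  @Complex R hom_obj (fun n m => @hom_diff n m) hom_diff_shape hom_diff_diff.

End Hom.

Section Ext.
Variable R : comNzRingType.

Record proj_resolution (M : complex R) := ProjResolution {
  res_complex :> complex R;
  res_map : chain_map res_complex M;
  res_projective : forall i, projective (res_complex i);
  res_bounded_below :
    exists b : int, forall i, i < b -> zero_module (res_complex i);
  res_quasi_iso : quasi_iso res_map
}.

Definition Ext (M N : complex R) (F : proj_resolution M) (i : int) : lmodType R :=
  homology (hom_complex F N) (- i).

(* Up to isomorphism [Ext N F i] does not depend on the resolution [F] of [M],
   so any resolution may be used. *)
Definition Ext_iso (M N : complex R) (i : int) (E : lmodType R) : Prop :=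
  exists F : proj_resolution M, module_iso (Ext N F i) E.

Definition Ext_zero (M N : complex R) (i : int) : Prop :=
  exists F : proj_resolution M, zero_module (Ext N F i).

End Ext.

Section Rings.
Variable R : comNzRingType.

Notation ideal := (submodClosed R^o).

Definition noetherian : Prop :=
  forall I : ideal, exists s : seq R^o, forall x : R^o, x \in I <-> in_span s x.

Definition maximal_ideal (m : ideal) : Prop :=
  1 \notin m /\
  forall I : ideal, {subset m <= I} -> 1 \notin I -> {subset I <= m}.

Definition local_ring (m : ideal) : Prop :=
  [/\ noetherian, maximal_ideal m &
      forall m' : ideal, maximal_ideal m' -> m' =i m].

Definition residue_field (m : ideal) : lmodType R := quotient_module m.

Definition ideal_mul (I J : set R) : set R :=
  [set x | exists n (a b : 'I_n -> R),
     [/\ forall i, I (a i), forall i, J (b i) & x = \sum_(i < n) a i * b i]].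

Definition ideal_exp (I : set R) (n : nat) : set R :=
  iter n (ideal_mul I) setT.

(* [in_span f] is the ideal generated by [f]. *)
Definition regular_sequence (f : seq R^o) : Prop :=
  ~ in_span f 1 /\
  forall i, (i < size f)%N ->
    forall x : R^o, in_span (take i f) (f`_i * x) -> in_span (take i f) x.

Definition prime_chain (n : nat) : Prop :=
  exists p : nat -> prime_idealr R, forall i, (i < n)%N ->
    {subset p i <= p i.+1} /\ exists2 x, x \in p i.+1 & x \notin p i.

Definition krull_dim (d : nat) : Prop :=
  prime_chain d /\ forall n, prime_chain n -> (n <= d)%N.

Definition dualizing (m : ideal) (D : complex R) : Prop :=
  finite_homology D /\
  exists d : int,
    Ext_iso (stalk (residue_field m)) D d (residue_field m) /\
    forall i, i != d -> Ext_zero (stalk (residue_field m)) D i.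

(* A dualizing complex that is [normalized] in this sense is a [D^R]. *)
Definition normalized (D : complex R) : Prop :=
  (forall i : int, i < 0 -> zero_module (homology D i)) /\
  ~ zero_module (homology D 0).

Definition finite_injective_dimension (M : lmodType R) : Prop :=
  exists (n : nat) (I : complex R) (q : chain_map (stalk M) I),
    [/\ forall i, injective_module (I i),
        forall i : int, (0 < i) || (i < - n%:Z) -> zero_module (I i) &
        quasi_iso q].

(* Only meant for noetherian local rings. *)
Definition gorenstein : Prop := finite_injective_dimension R^o.

End Rings.

(* Main.v *)
Require Import Defs.
From HB Require Import structures.
From mathcomp Require Import all_boot all_order all_algebra.
From mathcomp Require Import boolp classical_sets functions.
From mathcomp Require Import ring zify.

Set Implicit Arguments.
Unset Strict Implicit.
Unset Printing Implicit Defensive.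

Import Order.TTheory GRing.Theory Num.Theory.
Local Open Scope ring_scope.
Local Open Scope quotient_scope.

(** Write [k] for the residue field, [c] for the length of [f], and [S] for
    [R / (f)], where the cube of the maximal ideal is zero.

    Complexes are treated as modules with a grading ([gmod]), and [Ext^(-n)(X, Y) = 0]
    is the statement [null X Y n] that every cocycle of degree [n] from a complex
    of projectives [X] to [Y] is null-homotopic.  Its two tools are the lifting of
    cocycles along quasi-isomorphisms, which follows from [null_of_exact], and the
    long exact sequence of a mapping cone.

    The dualizing complex is a module.  Since [S] has finite length, [Ext(S, D)]
    lives in one degree, as [Ext(k, D)] does ([devissage]).  Removing the elements
    of [f] one at a time, Nakayama's lemma shows that [D] has homology in one degree
    only, on a finitely generated module [w] on which [f] is regular ([koszul],
    [omega_facts]).  The quotient [E = w / f w] is a faithful [S]-module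
    ([ext_faithful]), and its socle [Hom(k, E)], which is isomorphic to
    [Ext^c(k, w)], is at most one-dimensional ([thin_iter], [socle_thin]).

    The heart of the proof is that [E] is cyclic ([one_generator]).  Vanishing of
    [Ext^i(w, R)] for [1 <= i <= c + 1] gives [Ext^1(w, S) = 0] ([null_iter]), so
    every map from the relations of [w] to [S] extends to the free module.  As [E]
    is faithful with simple socle, its endomorphisms are multiplications
    ([endo_scale]).  If [E] needed two generators, suitable maps from the relations
    to the socle of [S] would produce, for each element of [E] killed by the square
    of the maximal ideal, endomorphisms that force it into the socle; since the cube
    of the maximal ideal is zero, [E] would then be killed by the square, and one of
    the generators would be a multiple of the other.

    Hence [w] is cyclic.  Its annihilator [K] is contained in [(f)], and [f] is
    regular modulo [K], so [K = f K] and [K = 0] ([ideal_zero]): [w] is isomorphic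
    to [R].  Therefore [Ext^i(k, R) = 0] for [i > c], and a noetherian induction gives
    the same for [R / J] in place of [k], for every ideal [J] ([ext_vanish_all]).
    By Baer's criterion and dimension shifting along embeddings in injective
    modules, [R] has a coresolution of length [c] by injective modules
    ([idim_of_null], [coresolves_fid]).

    The hypothesis covers the degrees up to [dim R + 1], and [c <= dim R], because
    a regular sequence of length [c] gives a chain of primes of length [c]
    ([regular_chain]). *)

(** * Submodules, spans and linear maps *)

Section Linear.
Variables (R : comNzRingType) (U V : lmodType R).

(** An alias that carries its proof of linearity, on which the structure of
    linear map is declared; a bare function would have no canonical structure. *)
Definition linear_fun (f : U -> V) (lf : linear f) : U -> V := f.

HB.instance Definition _ (f : U -> V) (lf : linear f) :=
  GRing.isLinear.Build R U V _ (linear_fun lf) lf.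

Definition mklin (f : U -> V) (lf : linear f) : {linear U -> V} := linear_fun lf.

Lemma mklinE f (lf : linear f) x : mklin lf x = f x.
Proof. by []. Qed.

End Linear.

Lemma lift_seq (T U : eqType) (f : T -> U) (Q : T -> Prop) (t : seq U) :
  (forall x, x \in t -> exists2 u, Q u & f u = x) ->
  exists us, (forall u, u \in us -> Q u) /\ [seq f u | u <- us] = t.
Proof.
elim: t => [|x t IH] tP; first by exists [::].
have [us [usQ <-]] := IH (fun y yt => tP y (mem_behead (s := x :: t) yt)).
have [u Qu <-] := tP x (mem_head _ _); exists (u :: us); split=> // v.
by rewrite inE => /orP[/eqP->|/usQ].
Qed.

Section Submodules.
Variable R : comNzRingType.
Implicit Types V W : lmodType R.

Lemma scale_at_lin V (v : V) : linear (fun a : R^o => (a : R) *: v).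
Proof. by move=> a x y; rewrite scalerDl scalerA. Qed.
Definition scale_at V (v : V) : {linear R^o -> V} := mklin (scale_at_lin v).

Lemma scale_atE V (v : V) a : scale_at v a = a *: v. Proof. by []. Qed.

(** Submodules as mere propositions: the ideals and submodules below are given by
    formulas, and coincide as soon as they are equivalent. *)
Definition submodP V (S : V -> Prop) : Prop :=
  S 0 /\ forall a x y, S x -> S y -> S (a *: x + y).

Definition prop_pred V (S : V -> Prop) (sS : submodP S) : {pred V} :=
  fun x => `[< S x >].

Lemma prop_pred_closed V (S : V -> Prop) (sS : submodP S) :
  submod_closed (prop_pred sS).
Proof.
case: (sS) => S0 Sl; split=> [|a x y]; first exact/asboolP.
by move=> /asboolP Sx /asboolP Sy; apply/asboolP/Sl.
Qed.
HB.instance Definition _ V (S : V -> Prop) (sS : submodP S) :=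
  GRing.isSubmodClosed.Build R V (prop_pred sS) (prop_pred_closed sS).

Definition psub V (S : V -> Prop) (sS : submodP S) : submodClosed V :=
  prop_pred sS.

Lemma psubE V (S : V -> Prop) (sS : submodP S) x : x \in psub sS <-> S x.
Proof. by split=> [/asboolP|Sx]; last exact/asboolP. Qed.

Lemma submodP_mem V (S : submodClosed V) : submodP (fun x => x \in S).
Proof.
split=> [|a x y Sx Sy]; first exact: rpred0.
by apply: rpredD => //; apply: rpredZ.
Qed.

Section Closure.
Variables (V : lmodType R) (S : V -> Prop) (sS : submodP S).
Lemma submodP0 : S 0. Proof. by case: sS. Qed.
Lemma submodPD x y : S x -> S y -> S (x + y).
Proof. by case: sS => _ Sl Sx Sy; have := Sl 1 _ _ Sx Sy; rewrite scale1r. Qed.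
Lemma submodPZ a x : S x -> S (a *: x).
Proof. by case: sS => S0 Sl Sx; have := Sl a _ _ Sx S0; rewrite addr0. Qed.
Lemma submodPN x : S x -> S (- x).
Proof. by rewrite -scaleN1r; apply: submodPZ. Qed.
Lemma submodPB x y : S x -> S y -> S (x - y).
Proof. by move=> Sx Sy; apply: submodPD => //; apply: submodPN. Qed.
Lemma submodP_sum I (r : seq I) (P : pred I) (F : I -> V) :
  (forall i, P i -> S (F i)) -> S (\sum_(i <- r | P i) F i).
Proof.
by move=> SF; elim/big_ind: _ => // [|x y]; [apply: submodP0|apply: submodPD].
Qed.
End Closure.

Lemma in_span_nil V (x : V) : in_span [::] x <-> x = 0.
Proof.
split=> [[c ->]|->]; first by rewrite big_ord0.
by exists (fun _ => 0); rewrite big_ord0.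
Qed.

Lemma in_span_cons V (a : V) s x :
  in_span (a :: s) x <-> exists r y, in_span s y /\ x = r *: a + y.
Proof.
split=> [[c ->]|[r [y [[c ->] ->]]]].
  rewrite big_ord_recl /=; exists (c ord0).
  exists (\sum_(i < size s) c (lift ord0 i) *: s`_i); split=> //.
  by exists (fun i => c (lift ord0 i)).
exists (fun i : 'I_(size s).+1 => if unlift ord0 i is Some j then c j else r).
rewrite big_ord_recl /= unlift_none; congr (_ + _).
by apply: eq_bigr => i _; rewrite liftK.
Qed.

Lemma in_span_sub V (s : seq V) : submodP (in_span s).
Proof.
split=> [|a x y [c ->] [d ->]].
  by exists (fun _ => 0); rewrite big1 // => i _; rewrite scale0r.
exists (fun i => a * c i + d i).
rewrite scaler_sumr -big_split /=; apply: eq_bigr => i _.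
by rewrite scalerDl scalerA.
Qed.

Lemma in_span_gen V (s : seq V) x : x \in s -> in_span s x.
Proof.
elim: s => // a s IH; rewrite inE => /orP[/eqP->|xs]; apply/in_span_cons.
  exists 1, 0; rewrite scale1r addr0; split=> //; exact: (submodP0 (in_span_sub s)).
by exists 0, x; rewrite scale0r add0r; split=> //; apply: IH.
Qed.

Lemma in_span_min V (s : seq V) (S : V -> Prop) : submodP S ->
  (forall x, x \in s -> S x) -> forall x, in_span s x -> S x.
Proof.
move=> sS; elim: s => [|a s IH] Ss x.
  by move=> /in_span_nil->; apply: submodP0.
move=> /in_span_cons[r [y [sy ->]]]; apply: submodPD => //.
  by apply: submodPZ => //; apply: Ss; rewrite mem_head.
by apply: IH => // z zs; apply: Ss; rewrite inE zs orbT.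
Qed.

Lemma in_span_cat V (s t : seq V) x :
  in_span (s ++ t) x <-> exists y z, [/\ in_span s y, in_span t z & x = y + z].
Proof.
elim: s x => [|a s IH] x /=.
  split=> [tx|[y [z [/in_span_nil-> tz ->]]]]; last by rewrite add0r.
  by exists 0, x; rewrite add0r; split=> //; apply/in_span_nil.
split=> [/in_span_cons[r [w [/IH[y [z [sy tz ->]]] ->]]]|[y [z [+ tz ->]]]].
  exists (r *: a + y), z; split=> //; last by rewrite addrA.
  by apply/in_span_cons; exists r, y.
move=> /in_span_cons[r [w [sw ->]]]; apply/in_span_cons; exists r, (w + z).
by rewrite addrA; split=> //; apply/IH; exists w, z.
Qed.

Lemma in_span_map V W (f : {linear V -> W}) s x :
  in_span s x -> in_span [seq f y | y <- s] (f x).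
Proof.
elim: s x => [|a s IH] x.
  by move=> /in_span_nil->; apply/in_span_nil; rewrite raddf0.
move=> /in_span_cons[r [y [sy ->]]]; apply/in_span_cons.
by exists r, (f y); rewrite linearP; split=> //; apply: IH.
Qed.

Lemma in_span_map_inv V W (f : {linear V -> W}) s y :
  in_span [seq f y | y <- s] y -> exists2 x, in_span s x & f x = y.
Proof.
elim: s y => [|a s IH] y.
  by move=> /in_span_nil->; exists 0; rewrite ?raddf0 //; apply/in_span_nil.
move=> /in_span_cons[r [z [/IH[x sx <-] ->]]]; exists (r *: a + x).
  by apply/in_span_cons; exists r, x.
by rewrite linearP.
Qed.

Lemma submodP_preim V W (f : {linear V -> W}) (S : W -> Prop) :
  submodP S -> submodP (fun x => S (f x)).
Proof.
move=> sS; split=> [|a x y Sx Sy]; first by rewrite raddf0; apply: submodP0.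
by rewrite linearP; apply: submodPD => //; apply: submodPZ.
Qed.

Lemma submodP_im V W (f : {linear V -> W}) (S : V -> Prop) :
  submodP S -> submodP (fun y => exists2 x, S x & f x = y).
Proof.
move=> sS; split=> [|a _ _ [x Sx <-] [y Sy <-]].
  by exists 0; rewrite ?raddf0 //; apply: submodP0.
exists (a *: x + y); last by rewrite linearP.
by apply: submodPD => //; apply: submodPZ.
Qed.

Lemma submodPI V (S T : V -> Prop) :
  submodP S -> submodP T -> submodP (fun x => S x /\ T x).
Proof.
move=> [S0 Sl] [T0 Tl]; split=> // a x y [Sx Tx] [Sy Ty].
by split; [apply: Sl|apply: Tl].
Qed.

End Submodules.

(** * Noetherian rings *)

Section Noetherian.
Variables (R : comNzRingType) (noethR : noetherian R).
Implicit Types V : lmodType R.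

(** Induction on the generators: the coefficients along the first generator [a]
    of the elements of [S] form an ideal, which is finitely generated, and what
    remains of [S] lies in the span of the other generators. *)
Lemma fg_submodule V (s : seq V) (S : V -> Prop) : submodP S ->
  (forall x, S x -> in_span s x) -> exists t, forall x, S x <-> in_span t x.
Proof.
elim: s S => [|a s IH] S sS Ss.
  exists [::] => x; split=> [/Ss|/in_span_nil->] //; exact: submodP0.
pose I (r : R^o) := exists2 y, in_span s y & S ((r : R) *: a + y).
have sI : submodP I.
  split=> [|b r r' [y sy Sy] [y' sy' Sy']].
    exists 0; first exact: (submodP0 (in_span_sub s)).
    by rewrite scale0r addr0; apply: submodP0.
  exists (b *: y + y'); first by case: (in_span_sub s) => _; apply.
  suff -> : (b *: r + r') *: a + (b *: y + y') =
            b *: (r *: a + y) + (r' *: a + y') by case: sS => _; apply.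
  by rewrite scalerDl scalerDr !scalerA -!addrA; congr (_ + _); rewrite addrCA.
have [tI tIP] := noethR (psub sI).
have {}tIP r : I r <-> in_span tI r by rewrite -(tIP r) psubE.
have [t tP] := IH (fun x => S x /\ in_span s x)
  (submodPI sS (in_span_sub s)) (fun x => @proj2 _ _).
(* [u] consists of lifts to [S] of generators of the ideal [I]. *)
have [u [uS uP]] : exists u, (forall x, x \in u -> S x) /\
    forall r, in_span tI r -> exists2 x, in_span u x &
      exists2 y, in_span s y & x = r *: a + y.
  have : forall r, r \in tI -> I r by move=> r rt; apply/tIP/in_span_gen.
  elim: tI {tIP} => [|r tI IHt] It.
    exists [::]; split=> // r /in_span_nil->; exists 0; first exact/in_span_nil.
    by exists 0; rewrite ?scale0r ?addr0 //; apply: (submodP0 (in_span_sub s)).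
  have [u [uS uP]] := IHt (fun r' rt => It r' (mem_behead (s := r :: tI) rt)).
  have [y sy Sy] := It r (mem_head _ _).
  exists (r *: a + y :: u); split=> [x|r'].
    by rewrite inE => /orP[/eqP->|/uS].
  move=> /in_span_cons[b [r'' [/uP[x ux [y' sy' xE]] ->]]].
  exists (b *: (r *: a + y) + (r'' *: a + y')).
    by apply/in_span_cons; exists b, x; rewrite -xE.
  exists (b *: y + y'); first by case: (in_span_sub s) => _; apply.
  by rewrite scalerDl scalerDr !scalerA -!addrA; congr (_ + _); rewrite addrCA.
exists (u ++ t) => x; rewrite in_span_cat; split.
  move=> Sx; have /in_span_cons[r [y [sy xE]]] := Ss x Sx.
  have /tIP/uP[x' ux' [y' sy' x'E]] : I r by exists y; rewrite -?xE.
  exists x', (x - x'); rewrite [x' + _]addrC subrK; split=> //; apply/tP; split.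
    by apply: submodPB => //; apply: in_span_min uS _ ux'.
  rewrite xE x'E opprD addrACA subrr add0r.
  exact: (submodPB (in_span_sub s)).
move=> [y [z [uy /tP[Sz _] ->]]]; apply: submodPD => //.
exact: in_span_min uS _ uy.
Qed.

(** Noetherian induction.  A counterexample yields a strictly increasing sequence
    of ideals, whose union is generated by finitely many elements and hence is
    reached after finitely many steps. *)
Lemma ideal_ind (P : (R^o -> Prop) -> Prop) :
  (forall I, submodP I ->
     (forall J, submodP J -> (forall x, I x -> J x) ->
        (exists2 x, J x & ~ I x) -> P J) -> P I) ->
  forall I, submodP I -> P I.
Proof.
move=> step I0 sI0; apply: contrapT => nPI0.
pose T := {I : R^o -> Prop | submodP I /\ ~ P I}.
have next (I : T) : exists J : T, (forall x, sval I x -> sval J x) /\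
    exists2 x, sval J x & ~ sval I x.
  case: I => I [sI nPI] /=; apply: contrapT => nJ; apply: nPI.
  apply: step => // J sJ IJ [x Jx nIx]; apply: contrapT => nPJ; apply: nJ.
  by exists (exist _ J (conj sJ nPJ)); split=> //; exists x.
have [g gP] := choice next.
pose c n := sval (iter n g (exist _ I0 (conj sI0 nPI0) : T)).
have cs n : submodP (c n) by rewrite /c; case: (iter _ _ _) => ? [].
have cS n x : c n x -> c n.+1 x by apply: (gP _).1.
have cM m n x : (m <= n)%N -> c m x -> c n x.
  by move=> /subnK <-; elim: (n - m)%N => // k IH /IH; rewrite addSn; apply: cS.
have sU : submodP (fun x => exists n, c n x).
  split=> [|a x y [i xi] [j yj]]; first by exists 0; apply: (submodP0 (cs 0)).
  exists (maxn i j); apply: (submodPD (cs _)).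
    by apply: (submodPZ (cs _)); apply: cM xi; rewrite leq_maxl.
  by apply: cM yj; rewrite leq_maxr.
have [s sP] := noethR (psub sU).
have [N NP] : exists N, forall x, x \in s -> c N x.
  have : forall x, x \in s -> exists n, c n x.
    by move=> x xs; apply/(psubE sU)/sP/in_span_gen.
  elim: s {sP} => [|a s IH] sc; first by exists 0.
  have [N NP] := IH (fun x xs => sc x (mem_behead (s := a :: s) xs)).
  have [n na] := sc a (mem_head _ _).
  exists (maxn n N) => x; rewrite inE => /orP[/eqP->|/NP].
    by apply: cM na; rewrite leq_maxl.
  by apply: cM; rewrite leq_maxr.
have [_ [x xN nx]] := gP (iter N g (exist _ I0 (conj sI0 nPI0) : T)).
apply: nx; apply: (in_span_min (cs N) NP); apply/sP/(psubE sU).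
by exists N.+1.
Qed.

End Noetherian.

(** * Local rings *)

Section Local.
Variables (R : comNzRingType) (m : submodClosed R^o).
Hypothesis locR : local_ring m.

Definition cube_in (J : R^o -> Prop) : Prop :=
  forall x1 x2 x3 : R, x1 \in m -> x2 \in m -> x3 \in m -> J (x1 * x2 * x3).

Lemma local_noeth : noetherian R. Proof. by case: locR. Qed.

Lemma one_notin : (1 : R) \notin m. Proof. by case: locR => _ []. Qed.

Lemma ideal_sub_max (I : R^o -> Prop) : submodP I -> ~ I 1 ->
  forall x, I x -> x \in m.
Proof.
move: I; case: locR => nR [_ _] uniq I sI.
move: I sI; apply: (ideal_ind nR) => I sI IH I1 x Ix.
have [[J [sJ IJ JI J1]]|nJ] := pselect (exists J, [/\ submodP J,
    forall x, I x -> J x, (exists2 x, J x & ~ I x) & ~ J 1]).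
  exact: (IH J sJ IJ JI J1 x (IJ x Ix)).
have /uniq <- : maximal_ideal (psub sI).
  split=> [|J IJ J1 y Jy]; first by apply/negP => /psubE.
  apply: contrapT => /negP nIy; apply: nJ; exists (fun x => x \in J).
  split=> //; first exact: submodP_mem.
  - by move=> z Iz; apply: IJ; apply/psubE.
  - by exists y => // Iy; move/negP: nIy; apply; apply/psubE.
  - exact/negP.
exact/psubE.
Qed.

Lemma unitP (x : R) : x \notin m -> exists y : R, y * x = 1.
Proof.
move=> xm; apply: contrapT => nx; move/negP: xm; apply.
pose I (z : R^o) := exists y : R, z = y * x.
apply: (@ideal_sub_max I); last by exists 1; rewrite mul1r.
  split=> [|a _ _ [y ->] [z ->]]; first by exists 0; rewrite mul0r.
  by exists (a * y + z); rewrite mulrDl -mulrA.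
by move=> [y yE]; apply: nx; exists y.
Qed.

Lemma mem_mulm (a x : R) : x \in m -> a * x \in m.
Proof. exact: (@rpredZ _ _ m). Qed.

Lemma unit_1B (x : R) : x \in m -> exists y : R, y * (1 - x) = 1.
Proof.
move=> xm; apply: unitP; apply/negP => x1.
by move/negP: one_notin; apply; rewrite -(subrK x 1); apply: rpredD.
Qed.

(** The elements of [m V], when [s] generates [V]. *)
Definition max_mul (V : lmodType R) (s : seq V) (y : V) : Prop :=
  exists c : 'I_(size s) -> R, (forall i, c i \in m) /\ y = \sum_(i < size s) c i *: s`_i.

Lemma max_mul_sub (V : lmodType R) (s : seq V) : submodP (max_mul s).
Proof.
split=> [|a _ _ [c [cm ->]] [d [dm ->]]].
  exists (fun=> 0); split=> [i|]; first exact: rpred0.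
  by rewrite big1 // => i _; rewrite scale0r.
exists (fun i => a * c i + d i); split=> [i|].
  by apply: rpredD => //; apply: mem_mulm.
rewrite scaler_sumr -big_split /=; apply: eq_bigr => i _.
by rewrite scalerDl scalerA.
Qed.

Lemma max_mul_scale (V : lmodType R) (s : seq V) (x : R) y : x \in m -> in_span s y ->
  max_mul s (x *: y).
Proof.
move=> xm [c ->]; exists (fun i => x * c i); split=> [i|].
  by rewrite mulrC; apply: mem_mulm.
by rewrite scaler_sumr; apply: eq_bigr => i _; rewrite scalerA.
Qed.

(** Nakayama's lemma: if [s] generates [V] and [V = B + m V], then [V = B].  The
    first generator is eliminated because [1 - c] is a unit for [c] in [m]. *)
Lemma nakayama (V : lmodType R) (B : V -> Prop) (s : seq V) : submodP B ->
  (forall x, x \in s -> exists b y, [/\ B b, max_mul s y & x = b + y]) ->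
  forall x, in_span s x -> B x.
Proof.
move=> sB; elim: s => [|a s IH] Hs x.
  by move=> /in_span_nil->; apply: submodP0.
have [b [y [Bb [c [cm ->]] aE]]] := Hs a (mem_head _ _).
have [u uE] := unit_1B (cm ord0).
rewrite big_ord_recl /= in aE.
set z := \sum_(i < _) _ in aE.
have {}aE : a = u *: b + u *: z.
  rewrite -[LHS]scale1r -uE -scalerA scalerBl scale1r {1}aE -scalerDr.
  by congr (_ *: _); rewrite [c _ *: _ + z]addrC addrA addrK.
have Bs : forall x, in_span s x -> B x.
  apply: IH => x' x's; have [|b' [y' [Bb' [c' [c'm ->]] x'E]]] := Hs x'.
    by rewrite inE x's orbT.
  exists (b' + c' ord0 *: (u *: b)), (c' ord0 *: (u *: z) +
     \sum_(i < size s) c' (lift ord0 i) *: s`_i).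
  split; first by apply: submodPD => //; do 2 apply: submodPZ => //.
    exists (fun i => c' ord0 * u * c (lift ord0 i) + c' (lift ord0 i)).
    split=> [i|]; first by apply: rpredD => //; apply: mem_mulm.
    rewrite /z !scaler_sumr -big_split /=; apply: eq_bigr => i _.
    by rewrite scalerDl !scalerA.
  by rewrite x'E big_ord_recl /= {1}aE scalerDr -!addrA.
move=> /in_span_cons[r [y' [sy' ->]]]; apply: submodPD => //; last exact: Bs.
apply: submodPZ => //; rewrite aE; apply: submodPD => //; apply: submodPZ => //.
apply: Bs; exists (fun i => c (lift ord0 i)); exact: erefl.
Qed.

End Local.

(** * Complexes as modules with a grading *)
Lemma dependent_choice (T : Type) (Q : nat -> T -> Prop)
    (S : nat -> T -> T -> Prop) x0 : Q 0 x0 ->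
  (forall n x, Q n x -> exists y, Q n.+1 y /\ S n x y) ->
  exists f : nat -> T, forall n, Q n (f n) /\ S n (f n) (f n.+1).
Proof.
move=> Q0 step.
have H (p : {p : nat * T | Q p.1 p.2}) :
    exists y, Q (sval p).1.+1 y /\ S (sval p).1 (sval p).2 y.
  by case: p => -[n x] /= Qx; apply: step.
have [g gP] := choice H.
pose nx p : {p : nat * T | Q p.1 p.2} := exist _ ((sval p).1.+1, g p) (gP p).1.
pose s n := iter n nx (exist _ (0%N, x0) Q0).
have s1 n : (sval (s n)).1 = n by elim: n => //= n ->.
exists (fun n => (sval (s n)).2) => n; split.
  by have := svalP (s n); rewrite s1.
by have := (gP (s n)).2; rewrite s1.
Qed.

Section Gmod.
Variable R : comNzRingType.

(** A complex, encoded as the product of its terms with the projections onto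
    them.  Maps of degree [n] are then plain linear maps, and no cast along an
    equality between degrees is ever needed. *)
Record gmod := Gmod {
  gcar :> lmodType R;
  pr : int -> {linear gcar -> gcar};
  dd : {linear gcar -> gcar};
  pr_pr : forall i j x, pr i (pr j x) = if i == j then pr j x else 0;
  pr_ext : forall x y, (forall i, pr i x = pr i y) -> x = y;
  pr_asm : forall u : int -> gcar, exists x, forall i, pr i x = pr i (u i);
  dd_pr : forall i x, dd (pr i x) = pr (i - 1) (dd x);
  dd_dd : forall x, dd (dd x) = 0
}.
Arguments pr {g} i : rename.
Arguments dd {g} : rename.

Implicit Types X Y Z : gmod.

(** The sign of a map of degree [n] that is moved past a differential. *)
Definition sg (n : int) : R := (-1) ^+ `|n|%N.

Lemma sgB1 n : sg (n - 1) = - sg n. Proof. exact: signB1. Qed.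
Lemma sgD1 n : sg (n + 1) = - sg n.
Proof. by rewrite -[n in RHS](addrK 1) sgB1 opprK. Qed.
Lemma sg_sg n (V : lmodType R) (v : V) : sg n *: (sg n *: v) = v.
Proof. by rewrite scalerA /sg -expr2 sqrr_sign scale1r. Qed.
Lemma sg0 : sg 0 = 1. Proof. by []. Qed.

Lemma prK X i (x : X) : pr i (pr i x) = pr i x.
Proof. by rewrite pr_pr eqxx. Qed.

Lemma pr_neq X i j (x : X) : i != j -> pr i (pr j x) = 0.
Proof. by rewrite pr_pr => /negPf->. Qed.

Lemma pr_dd X i (x : X) : pr i (dd x) = dd (pr (i + 1) x).
Proof. by rewrite dd_pr addrK. Qed.

Section Homs.
Variables X Y : gmod.
Implicit Types T S : X -> Y.

Definition homdeg (n : int) T : Prop :=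
  linear T /\ forall i x, pr (i + n) (T x) = T (pr i x).

Definition cyc (n : int) T : Prop :=
  homdeg n T /\ forall x, dd (T x) = sg n *: T (dd x).

(** With these signs, [cyc n] and [bnd n] are the cycles and the boundaries of
    degree [n] of the complex of maps from [X] to [Y]. *)
Definition bnd (n : int) T : Prop :=
  exists2 S, homdeg (n + 1) S & forall x, T x = dd (S x) + sg n *: S (dd x).

(** Vanishing of [Ext^(-n)(X, Y)] when [X] is semifree. *)
Definition null (n : int) : Prop := forall T, cyc n T -> bnd n T.

Lemma homdeg_lin n T : homdeg n T -> exists T' : {linear X -> Y}, T = T'.
Proof. by case=> lT _; exists (mklin lT). Qed.

Lemma cyc_lin n T : cyc n T -> exists T' : {linear X -> Y}, T = T'.
Proof. by case=> /homdeg_lin. Qed.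

Lemma homdeg_sub n : submodP (homdeg n).
Proof.
split=> [|a T S [lT dT] [lS dS]]; split.
- by move=> b x y; rewrite /= scaler0 addr0.
- by move=> i x; rewrite raddf0.
- move=> b x y; rewrite -[LHS]/(a *: T _ + S _) lT lS.
  rewrite -[RHS]/(b *: (a *: T x + S x) + (a *: T y + S y)).
  by rewrite !scalerDr !scalerA mulrC -!addrA; congr (_ + _); rewrite addrCA.
- move=> i x; rewrite -[(a *: T + S) x]/(a *: T x + S x).
  by rewrite linearP dT dS.
Qed.

Lemma cyc_sub n : submodP (cyc n).
Proof.
split=> [|a T S [hT dT] [hS dS]]; split.
- exact: submodP0 (homdeg_sub n).
- by move=> x; rewrite raddf0 scaler0.
- by case: (homdeg_sub n) => _; apply.
- move=> x; rewrite -[(a *: T + S) x]/(a *: T x + S x).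
  rewrite -[(a *: T + S) (dd x)]/(a *: T (dd x) + S (dd x)) linearP dT dS.
  by rewrite scalerDr !scalerA mulrC.
Qed.

Lemma bnd_sub n : submodP (bnd n).
Proof.
split=> [|a T T' [S hS TE] [S' hS' T'E]].
  exists (fun=> 0); first exact: submodP0 (homdeg_sub _).
  by move=> x; rewrite raddf0 scaler0 addr0.
exists (a *: S + S'); first by case: (homdeg_sub (n + 1)) => _; apply.
move=> x; rewrite -[LHS]/(a *: T x + T' x) TE T'E.
rewrite -[(a *: S + S') x]/(a *: S x + S' x).
rewrite -[(a *: S + S') (dd x)]/(a *: S (dd x) + S' (dd x)) linearP.
by rewrite !scalerDr !scalerA mulrC addrACA.
Qed.

Lemma bnd_cyc n T : bnd n T -> cyc n T.
Proof.
move=> [S hS TE]; have [S' SE] := homdeg_lin hS; subst S.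
split; last first.
  move=> x; rewrite !TE !raddfD /= linearZ_LR !dd_dd !raddf0 add0r.
  by rewrite ?scaler0 addr0.
split=> [a x y|i x].
  rewrite !TE !linearP !scalerDr !scalerA /= mulrC -!addrA; congr (_ + _).
  by rewrite addrCA.
rewrite !TE raddfD /= linearZ_LR /= pr_dd -(addrA i) (proj2 hS) [dd (pr i x)]dd_pr.
by rewrite -(proj2 hS (i - 1)) [n + 1]addrC [i - 1 + _]addrA addrNK.
Qed.
End Homs.

Definition chmap X Y (a : X -> Y) : Prop :=
  (forall i x, pr i (a x) = a (pr i x)) /\ forall x, dd (a x) = a (dd x).

Lemma chmap_cyc X Y (a : {linear X -> Y}) : chmap a <-> cyc 0 a.
Proof.
split=> [[ap ad]|[[_ ap] ad]]; split.
- by split=> [|i x]; [exact: linearP|rewrite addr0].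
- by move=> x; rewrite sg0 scale1r.
- by move=> i x; rewrite -ap addr0.
- by move=> x; rewrite ad sg0 scale1r.
Qed.

Section Compose.
Variables X Y Z : gmod.

Lemma cyc_comp n (T : Y -> Z) (a : {linear X -> Y}) :
  chmap a -> cyc n T -> cyc n (T \o a).
Proof.
move=> [ap ad] [[lT dT] cT]; split; last by move=> x /=; rewrite cT ad.
by split=> [b x y|i x] /=; [rewrite linearP lT|rewrite dT ap].
Qed.

Lemma bnd_comp n (T : Y -> Z) (a : {linear X -> Y}) :
  chmap a -> bnd n T -> bnd n (T \o a).
Proof.
move=> [ap ad] [S [lS dS] TE]; exists (S \o a); last first.
  by move=> x /=; rewrite TE ad.
by split=> [b x y|i x] /=; [rewrite linearP lS|rewrite dS ap].
Qed.

Lemma comp_cyc n (a : {linear Y -> Z}) (T : X -> Y) :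
  chmap a -> cyc n T -> cyc n (a \o T).
Proof.
move=> [ap ad] [[lT dT] cT]; split; last first.
  by move=> x /=; rewrite ad cT linearZ_LR.
by split=> [b x y|i x] /=; [rewrite lT linearP|rewrite ap dT].
Qed.

Lemma comp_bnd n (a : {linear Y -> Z}) (T : X -> Y) :
  chmap a -> bnd n T -> bnd n (a \o T).
Proof.
move=> [ap ad] [S [lS dS] TE]; exists (a \o S); last first.
  by move=> x /=; rewrite TE linearD linearZ_LR ad.
by split=> [b x y|i x] /=; [rewrite lS linearP|rewrite ap dS].
Qed.

Lemma cyc_comp_bnd n (T : Y -> Z) (a : X -> Y) :
  cyc n T -> bnd 0 a -> bnd n (T \o a).
Proof.
move=> cT [S hS aE]; have [T' ?] := cyc_lin cT; subst T.
case: cT => -[_ dT] cT; case: hS => lS dS.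
exists (fun x => sg n *: T' (S x)).
  split=> [b x y|i x].
    by rewrite lS linearP scalerDr !scalerA mulrC.
  by rewrite linearZ_LR /= -dS -dT add0r [n + 1]addrC addrA.
move=> x /=; rewrite aE linearD linearZ_LR sg0 scale1r linearZ_LR cT sg_sg.
by rewrite sg_sg.
Qed.
End Compose.

(** ** Null-homotopies out of bounded below complexes of projectives *)

(** Projectivity of the term of degree [i], stated with the projection [pr i]
    because the term itself is not a type. *)
Definition proj_degree X (i : int) : Prop :=
  forall (A B : lmodType R) (g : {linear A -> B}) (f : {linear X -> B}),
    (forall x, exists a, g a = f (pr i x)) ->
    exists h : {linear X -> A},
      (forall x, h (pr i x) = h x) /\ forall x, g (h x) = f (pr i x).

Definition semifree X : Prop :=
  (exists b, forall i, i < b -> forall x : X, pr i x = 0) /\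
  forall i, proj_degree X i.

Definition exact X : Prop := forall x : X, dd x = 0 -> exists y, x = dd y.

Definition qiso X Y (q : X -> Y) : Prop :=
  (forall x, dd x = 0 -> (exists y, q x = dd y) -> exists x', x = dd x') /\
  forall y, dd y = 0 -> exists x z, dd x = 0 /\ y - q x = dd z.

(** A homogeneous map is determined by arbitrary choices in each degree. *)
Lemma assemble X Y n (u : int -> {linear X -> Y}) :
  (forall i x, pr (i + n) (u i (pr i x)) = u i (pr i x)) ->
  exists H : {linear X -> Y}, homdeg n H /\ forall i x, H (pr i x) = u i (pr i x).
Proof.
move=> uP.
have : forall x, exists y : Y, forall j, pr j y = pr j (u (j - n) (pr (j - n) x)).
  by move=> x; exact: (pr_asm (fun j => u (j - n) (pr (j - n) x))).
move=> /choice[H HP].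
have lH : linear H.
  move=> a x y; apply: pr_ext => j.
  by rewrite linearP !HP !linearP.
exists (mklin lH); have HE i x : mklin lH (pr i x) = u i (pr i x).
  rewrite mklinE; apply: pr_ext => j; rewrite HP.
  have [jE|ne] := eqVneq (j - n) i; first by rewrite jE prK.
  rewrite pr_neq // !raddf0 -uP pr_neq //.
  by apply: contra ne => /eqP->; rewrite addrK.
split=> //; split=> [|i x]; first exact: linearP.
by rewrite HE mklinE HP addrK uP.
Qed.

(** Maps from a bounded below complex of projectives to an exact complex are
    null-homotopic.  The homotopy is built one degree at a time, from the bottom:
    [ok t H] says that [H] is a homotopy below degree [b + t] and vanishes from
    there on.  All uses of projectivity go through this lemma. *)
Lemma null_of_exact X Y n : semifree X -> exact Y -> null X Y n.
Proof.
move=> [[b Xb] pX] eY T cT; have [T' ?] := cyc_lin cT; subst T; rename T' into T.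
have [[_ dT] dcT] := cT.
pose ok (t : nat) (H : {linear X -> Y}) := [/\ homdeg (n + 1) H,
  forall i x, b + t%:Z <= i -> H (pr i x) = 0 &
  forall i x, i < b + t%:Z ->
    T (pr i x) = dd (H (pr i x)) + sg n *: H (dd (pr i x))].
have step t H : ok t H -> exists H', ok t.+1 H' /\
    forall i x, i < b + t%:Z -> H' (pr i x) = H (pr i x).
  move=> [hH H0 HE]; set i0 := b + t%:Z in H0 HE *.
  have lpsi : linear (fun x => T (pr i0 x) - sg n *: H (dd (pr i0 x))).
    by move=> a x y; rewrite !linearP /= !(scalerDr, scalerN, scalerA) addrACA.
  have [x|h [h1 h2]] := pX i0 _ _ (@dd Y) (mklin lpsi).
    rewrite mklinE /= prK.
    have [|z ->] := eY (T (pr i0 x) - sg n *: H (dd (pr i0 x))); last by exists z.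
    rewrite linearB /= dcT linearZ_LR /= -scalerBr dd_pr HE ?ltrBlDr ?ltrDl //.
    by rewrite -dd_pr !dd_dd raddf0 scaler0 addr0 subrr scaler0.
  have h0 i x : i != i0 -> h (pr i x) = 0.
    by move=> ne; rewrite -h1 pr_neq ?raddf0 // eq_sym.
  have lH' : linear (fun x => H x + pr (i0 + (n + 1)) (h x)).
    by move=> a x y; rewrite !linearP /= scalerDr addrACA.
  have H'E i x : i != i0 -> mklin lH' (pr i x) = H (pr i x).
    by move=> ne; rewrite mklinE h0 // raddf0 addr0.
  exists (mklin lH'); split; last first.
    by move=> i x ii0; rewrite H'E // lt_eqF.
  split=> [||i x].
  - split=> [|i x]; first exact: linearP.
    rewrite !mklinE linearD /= (proj2 hH); congr (_ + _).
    have [->|ne] := eqVneq i i0; first by rewrite h1 prK.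
    rewrite h0 // raddf0 pr_neq //.
    by apply: contra ne => /eqP/addIr->.
  - move=> i x ti; rewrite H'E; last by rewrite gt_eqF //; lia.
    by apply: H0; rewrite /i0; lia.
  - move=> ti; rewrite [dd (pr i x)]dd_pr (H'E (i - 1)) -?dd_pr; last by rewrite /i0; lia.
    have [ii0|ne] := eqVneq i i0; last first.
      by rewrite H'E // HE //; move: ne ti; rewrite /i0; lia.
    subst i; rewrite mklinE h1 H0 // add0r.
    have -> : dd (pr (i0 + (n + 1)) (h x)) = T (pr i0 x) - sg n *: H (dd (pr i0 x)).
      have -> : dd (pr (i0 + (n + 1)) (h x)) = pr (i0 + n) (dd (h x)).
        by rewrite pr_dd; congr (dd (pr _ _)); lia.
      rewrite h2 mklinE prK linearB linearZ_LR /= dT prK; congr (_ - _ *: _).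
      have -> : i0 + n = i0 - 1 + (n + 1) by lia.
      by rewrite dd_pr -(proj2 hH) prK.
    by rewrite subrK.
have ok0 : ok 0%N (\0).
  split=> [|//|i x].
    by split=> [|i x]; [exact: linearP|exact: raddf0].
  by rewrite addr0 => ib; rewrite Xb // !raddf0 /= ?scaler0 ?addr0.
have [f fP] := dependent_choice ok0 step.
pose ix (i : int) := `|i - b|.+1.
have fE i t x : i < b + t%:Z -> f t (pr i x) = f (ix i) (pr i x).
  have [ib _|bi] := ltP i b; first by rewrite Xb // !raddf0.
  move=> ti; have {ti} : (ix i <= t)%N by rewrite /ix; lia.
  elim: t => [|t IH]; first by rewrite leqn0 => /eqP->.
  rewrite leq_eqVlt => /orP[/eqP<- //|]; rewrite ltnS => it.
  have ti : i < b + t%:Z by move: it bi; rewrite /ix; lia.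
  by rewrite (fP t).2 // IH.
have [|H [hH HE]] := @assemble X Y (n + 1) (fun i => f (ix i)).
  by move=> i x; have [[[_ ->] _ _] _] := fP (ix i); rewrite prK.
exists H => // x; apply: pr_ext => j.
pose i := j - n; have jE : j = i + n by rewrite /i subrK.
rewrite {1}jE dT raddfD /= linearZ_LR /= pr_dd.
have -> : pr (j + 1) (H x) = H (pr i x).
  by rewrite -(proj2 hH) jE; congr (pr _ _); lia.
have -> : pr j (H (dd x)) = H (dd (pr i x)).
  by rewrite dd_pr -(proj2 hH) jE; congr (pr _ _); lia.
rewrite dd_pr !HE -dd_pr.
have ii : i < b + (ix i)%:Z by rewrite /ix; lia.
have [[_ _ ->//] _] := fP (ix i).
by rewrite dd_pr fE // /ix; lia.
Qed.
End Gmod.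

Arguments pr {R g} i.
Arguments dd {R g}.

(** * Mapping cones *)
Section Cone.
Variable R : comNzRingType.
Implicit Types X Y Z : gmod R.

Lemma pair_lin (U V : lmodType R) r (u u' : U) (v v' : V) :
  r *: (u, v) + (u', v') = (r *: u + u', r *: v + v').
Proof. by []. Qed.

Section Def.
Variables (X Y : gmod R) (a : {linear X -> Y}) (ha : chmap a).

Lemma cone_pr_lin i : linear (fun p : Y * X => (pr i p.1, pr (i - 1) p.2)).
Proof. by move=> b [y x] [y' x'] /=; rewrite !linearP. Qed.

Lemma cone_dd_lin : linear (fun p : Y * X => (dd p.1 + a p.2, - dd p.2)).
Proof.
move=> b [y x] [y' x'].
rewrite -[RHS]/(b *: (dd y + a x) + (dd y' + a x'), b *: - dd x - dd x') /=.
by rewrite !linearP /= scalerDr addrACA.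
Qed.

Definition cone_prl i : {linear (Y * X)%type -> (Y * X)%type} := mklin (cone_pr_lin i).
Definition cone_ddl : {linear (Y * X)%type -> (Y * X)%type} := mklin cone_dd_lin.

Lemma cone_pr_pr i j p :
  cone_prl i (cone_prl j p) = if i == j then cone_prl j p else 0.
Proof.
rewrite !mklinE /= !pr_pr (inj_eq (addIr _)); case: eqP => // _.
Qed.

Lemma cone_pr_ext p q : (forall i, cone_prl i p = cone_prl i q) -> p = q.
Proof.
move=> pq; rewrite [p]surjective_pairing [q]surjective_pairing.
congr (_, _); apply: pr_ext => i.
  by have [] := pq i.
by have [_] := pq (i + 1); rewrite addrK.
Qed.

Lemma cone_pr_asm (u : int -> (Y * X)%type) :
  exists x, forall i, cone_prl i x = cone_prl i (u i).
Proof.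
have [y yP] := pr_asm (fun i => (u i).1).
have [x xP] := pr_asm (fun i => (u (i + 1)).2).
by exists (y, x) => i; rewrite !mklinE /= yP xP subrK.
Qed.

Lemma cone_dd_pr i p : cone_ddl (cone_prl i p) = cone_prl (i - 1) (cone_ddl p).
Proof.
rewrite !mklinE /= linearD /= -!dd_pr linearN /= -dd_pr; congr (_ + _, _).
by case: ha => ->.
Qed.

Lemma cone_dd_dd p : cone_ddl (cone_ddl p) = 0.
Proof.
rewrite -[RHS]/((0 : Y), (0 : X)) !mklinE /=; congr (_, _).
  by rewrite raddfD raddfN /= dd_dd (proj2 ha) add0r subrr.
by rewrite raddfN /= dd_dd !oppr0.
Qed.

Definition cone : gmod R :=
  @Gmod R (Y * X)%type cone_prl cone_ddl cone_pr_pr cone_pr_ext cone_pr_asm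
    cone_dd_pr cone_dd_dd.

Lemma cone_dd (y : Y) (x : X) : @dd R cone (y, x) = (dd y + a x, - dd x).
Proof. by []. Qed.

Lemma cone_pr i (y : Y) (x : X) : @pr R cone i (y, x) = (pr i y, pr (i - 1) x).
Proof. by []. Qed.

Lemma cone_exact : qiso a -> exact cone.
Proof.
move=> [qi qs] [y x]; rewrite cone_dd => -[dyx /eqP]; rewrite oppr_eq0 => /eqP dx.
have [|x' xE] := qi x dx.
  by exists (- y); rewrite linearN /=; apply/eqP; rewrite -addr_eq0 addrC; apply/eqP.
have [|x'' [z [dx'' yE]]] := qs (y + a x').
  by rewrite linearD /= (proj2 ha) -xE.
exists (z, x'' - x'); rewrite cone_dd.
rewrite -yE; congr (_, _).
  by rewrite [a (_ - _)]raddfB addrA subrK addrK.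
by rewrite raddfB /= dx'' sub0r opprK.
Qed.

Lemma cone_semifree : semifree X -> semifree Y -> semifree cone.
Proof.
move=> [[b Xb] pX] [[c Yc] pY]; split.
  exists (Order.min (b + 1) c) => i; rewrite lt_min => /andP[ib ic] [y x].
  by rewrite cone_pr Yc // Xb //; lia.
move=> i A B g f fP.
have lf1 : linear (fun y : Y => f (y, 0)).
  by move=> r y y'; rewrite -linearP pair_lin scaler0 addr0.
have lf2 : linear (fun x : X => f (0, x)).
  by move=> r x x'; rewrite -linearP pair_lin scaler0 addr0.
have [y|h1 [h1p h1E]] := pY i A B g (mklin lf1).
  by have := fP (y, 0); rewrite cone_pr raddf0.
have [x|h2 [h2p h2E]] := pX (i - 1) A B g (mklin lf2).
  by have := fP (0, x); rewrite cone_pr raddf0.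
have lh : linear (fun p : Y * X => h1 p.1 + h2 p.2).
  by move=> r p q; rewrite !linearP /= scalerDr addrACA.
exists (mklin lh); split=> -[y x]; rewrite cone_pr !mklinE /=.
  by rewrite h1p h2p.
rewrite linearD h1E h2E !mklinE -[f (pr i y, 0)]scale1r -linearP pair_lin.
by rewrite scale1r scaler0 addr0 add0r.
Qed.

End Def.

(** ** Lifting along quasi-isomorphisms, up to homotopy *)

Section Lift.
Variables (X Y Z : gmod R) (q : {linear Y -> Z}) (hq : chmap q).
Hypotheses (sX : semifree X) (qq : qiso q).

(** A cocycle into the cone of [q], of degree [n + 1], amounts to a cocycle [T]
    into [Y] together with a null-homotopy [U] of [q \o T].  The cone of the
    quasi-isomorphism [q] is exact, so this cocycle is a boundary.  Injectivity
    and surjectivity of [q] on classes, in [lift_bnd] and [lift_cyc], are the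
    cases of arbitrary [T] and of [T = 0]. *)
Lemma lift_pair n (T : X -> Y) (U : X -> Z) : cyc n T -> homdeg (n + 1) U ->
    (forall x, q (T x) = dd (U x) + sg R n *: U (dd x)) ->
  exists S : X -> Y, [/\ homdeg (n + 1) S,
    forall x, T x = dd (S x) + sg R n *: S (dd x) &
    bnd (n + 1) (fun x => U x - q (S x))].
Proof.
move=> cT hU TU.
have [T' ?] := cyc_lin cT; subst T; rename T' into T.
have [U' ?] := homdeg_lin hU; subst U; rename U' into U.
pose V x : cone hq := (U x, - T x).
have cV : cyc (n + 1) V.
  split; first split.
  - by move=> r x y; rewrite /V !linearP /=; congr (_, _); rewrite scalerN.
  - move=> i x; rewrite cone_pr (proj2 hU) linearN /=; congr (_, - _).
    by rewrite addrA addrK cT.1.2.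
  - move=> x; rewrite cone_dd sgD1.
    rewrite -[RHS]/(- sg R n *: U (dd x), - sg R n *: - T (dd x)); congr (_, _).
      by rewrite raddfN /= TU opprD addrA subrr add0r scaleNr.
    by rewrite raddfN /= opprK cT.2 scaleNr scalerN opprK.
have [W hW VE] := null_of_exact sX (cone_exact qq) cV.
have [W' ?] := homdeg_lin hW; subst W; rename W' into W.
have VE1 x : U x = dd (W x).1 + q (W x).2 + sg R (n + 1) *: (W (dd x)).1.
  by have /(congr1 fst) := VE x.
have VE2 x : - T x = - dd (W x).2 + sg R (n + 1) *: (W (dd x)).2.
  by have /(congr1 snd) := VE x.
exists (fun x => (W x).2); split.
- split=> [r x y|i x]; first by rewrite linearP.
  by rewrite -(proj2 hW i x) /= !addrA addrK.
- by move=> x; apply: oppr_inj; rewrite VE2 sgD1 scaleNr opprD.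
- exists (fun x => (W x).1).
    split=> [r x y|i x]; first by rewrite linearP.
    by have /(congr1 fst) := proj2 hW i x.
  by move=> x; rewrite VE1 addrAC addrK.
Qed.

Lemma lift_bnd n (T : X -> Y) : cyc n T -> bnd n (q \o T) -> bnd n T.
Proof.
move=> cT [U hU TU]; have [S [hS TE _]] := lift_pair cT hU TU.
by exists S.
Qed.

Lemma lift_cyc n (U : X -> Z) : cyc n U ->
  exists T : {linear X -> Y}, cyc n T /\ bnd n (fun x => U x - q (T x)).
Proof.
move=> cU.
have [|||S [hS SE SU]] := @lift_pair (n - 1) (fun _ => 0) U.
- exact: submodP0 (cyc_sub _ _ _).
- by rewrite subrK; case: cU.
- by move=> x; rewrite raddf0 cU.2 sgB1 scaleNr subrr.
rewrite subrK in hS SU.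
have [T ?] := homdeg_lin hS; subst S; exists T; split=> //.
split=> // x; apply/eqP; rewrite -subr_eq0 -scaleNr -sgB1.
by rewrite -SE.
Qed.

End Lift.
End Cone.

(** * Resolutions of modules *)
Section Resolution.
Variable R : comNzRingType.
Implicit Types (X Y Z K F : gmod R) (M N : lmodType R).

Section Stg.
Variable M : lmodType R.

Lemma stg_pr_lin (i : int) : linear (fun x : M => if i == 0 then x else 0).
Proof. by move=> r x y; case: eqP => // _; rewrite scaler0 addr0. Qed.

Definition stg_pr i : {linear M -> M} := mklin (stg_pr_lin i).

Lemma stg_pr_pr i j x : stg_pr i (stg_pr j x) = if i == j then stg_pr j x else 0.
Proof.
rewrite !mklinE; have [->|ne] := eqVneq i j; first by case: eqP.
by case: eqP => // i0; rewrite ifN // -i0 eq_sym.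
Qed.

Lemma stg_pr_ext x y : (forall i, stg_pr i x = stg_pr i y) -> x = y.
Proof. by move/(_ 0). Qed.

Lemma stg_pr_asm (u : int -> M) : exists x, forall i, stg_pr i x = stg_pr i (u i).
Proof. by exists (u 0) => i; rewrite !mklinE; case: eqP => [->|]. Qed.

Definition stg : gmod R :=
  @Gmod R M stg_pr (\0) stg_pr_pr stg_pr_ext stg_pr_asm
    (fun i x => esym (raddf0 (stg_pr (i - 1)))) (fun x => erefl).

Lemma stg_prE i (x : stg) : pr i x = if i == 0 then x else 0.
Proof. by []. Qed.
Lemma stg_ddE (x : stg) : dd x = 0. Proof. by []. Qed.
End Stg.

Lemma stg_chmap M N (f : {linear M -> N}) : @chmap R (stg M) (stg N) f.
Proof. by split=> [i x|x]; rewrite ?stg_prE ?raddf0 //; case: eqP; rewrite ?raddf0. Qed.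

Definition resolves K M (e : {linear K -> M}) : Prop :=
  [/\ semifree K, @chmap R K (stg M) e & @qiso R K (stg M) e].

(** [b] lifts [f] to the resolutions, up to homotopy.  Asking only for a homotopy
    lets the lifting lemmas of the previous part apply as they stand. *)
Definition covers K K' M M' (e : {linear K -> M}) (e' : {linear K' -> M'})
    (f : {linear M -> M'}) (b : {linear K -> K'}) : Prop :=
  chmap b /\ @bnd R K (stg M') 0 (fun x => e' (b x) - f (e x)).

Section Covers.
Variables (K K' : gmod R) (M M' : lmodType R).
Variables (e : {linear K -> M}) (e' : {linear K' -> M'}).
Hypotheses (re : resolves e) (re' : resolves e').

Lemma covers_ex (f : {linear M -> M'}) : exists b, covers e e' f b.
Proof.
have [sK he _] := re; have [_ he' qe'] := re'.
have [|b [cb bE]] := lift_cyc he' sK qe' (n := 0) (U := f \o e).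
  apply/(cyc_comp (X := K) (Y := stg M) he)/chmap_cyc/stg_chmap.
exists b; split; first exact/chmap_cyc.
have := submodPN (bnd_sub _ _ 0) bE.
congr bnd; apply: funext => x /=; exact: opprB.
Qed.

Lemma covers_uniq (f : {linear M -> M'}) b b' :
  covers e e' f b -> covers e e' f b' -> bnd 0 (fun x => b x - b' x).
Proof.
have [sK he _] := re; have [_ he' qe'] := re'.
move=> [hb bE] [hb' bE']; apply: (lift_bnd he' sK qe').
  exact: (submodPB (cyc_sub _ _ 0) (proj1 (chmap_cyc _) hb) (proj1 (chmap_cyc _) hb')).
have := submodPB (bnd_sub _ _ 0) bE bE'.
congr bnd; apply: funext => x /=.
by rewrite -[LHS]/(e' (b x) - f (e x) - (e' (b' x) - f (e x))) opprB addrA subrK raddfB.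
Qed.
End Covers.

Lemma covers_comp K K' K'' M M' M'' (e : {linear K -> M}) (e' : {linear K' -> M'})
    (e'' : {linear K'' -> M''}) f f' b b' : @chmap R K (stg M) e ->
  covers e e' f b -> covers e' e'' f' b' -> covers e e'' (f' \o f) (b' \o b).
Proof.
move=> he [hb bE] [hb' bE']; split.
  by split=> [i x|x] /=; [rewrite hb'.1 hb.1|rewrite hb'.2 hb.2].
have := submodPD (bnd_sub _ _ 0) (bnd_comp hb bE') (comp_bnd (stg_chmap f') bE).
congr bnd; apply: funext => x /=.
by rewrite -[LHS]/(_ - _ + f' (e' (b x) - f (e x))) raddfB addrA subrK.
Qed.

Lemma covers_id K M (e : {linear K -> M}) : covers e e idfun idfun.
Proof.
split; first by split.
have := submodP0 (bnd_sub K (stg M) 0); congr bnd.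
by apply: funext => x /=; rewrite subrr.
Qed.

Lemma cyc_homotopic X Y Z n (T : Y -> Z) (a b : X -> Y) : cyc n T ->
  bnd 0 (fun x => a x - b x) -> bnd n (fun x => T (a x) - T (b x)).
Proof.
move=> cT ab; have [T' ?] := cyc_lin cT; subst T.
have := cyc_comp_bnd cT ab; congr bnd; apply: funext => x /=; exact: raddfB.
Qed.

(** Comparison of resolutions.  Only a retraction is asked of [M] and [M'], and
    with [f] and [g] the identity this says that [Ext] is computed by any
    resolution. *)
Lemma null_iso K K' M M' (e : {linear K -> M}) (e' : {linear K' -> M'})
    (f : {linear M -> M'}) (g : {linear M' -> M}) Y n :
  resolves e -> resolves e' -> (forall y, f (g y) = y) ->
  null K Y n -> null K' Y n.
Proof.
move=> re re' fg nK T cT.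
have [b cb] := covers_ex re re' f; have [c cc] := covers_ex re' re g.
have [_ he' _] := re'.
have cbc : covers e' e' idfun (b \o c).
  have := covers_comp he' cc cb; rewrite /covers => -[? h]; split=> //.
  by move: h; congr bnd; apply: funext => x /=; rewrite fg.
have h1 := cyc_homotopic cT (covers_uniq re' re' (covers_id e') cbc).
have h2 := bnd_comp cc.1 (nK _ (cyc_comp cb.1 cT)).
have := submodPD (bnd_sub _ _ n) h1 h2; congr bnd; apply: funext => x /=.
exact: subrK.
Qed.

(** ** The long exact sequence of a mapping cone *)

Section LES.
Variables (F K Z : gmod R) (a : {linear F -> K}) (ha : chmap a).
Notation C := (cone ha).

Lemma cone_inl_lin : linear (fun k : K => (k, 0) : C).
Proof. by move=> r x y; rewrite pair_lin scaler0 addr0. Qed.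
Definition cone_inl : {linear K -> C} := mklin cone_inl_lin.

Lemma cone_inl_chmap : chmap cone_inl.
Proof.
split=> [i x|x]; rewrite !mklinE ?cone_pr ?cone_dd !raddf0 ?oppr0 ?addr0 //.
Qed.

(** The graded module underlying the cone is [K * F].  The lemmas of this section
    are the long exact sequence of [F -> K -> cone] in terms of cocycles: a class
    on [F] gives one on the cone with a shift of degree; a class on [K] extends
    to the cone if its pullback to [F] vanishes; the classes from [F] that vanish
    on the cone come from [K]; and the classes of the cone that vanish on [K]
    come from [F]. *)
Lemma cone_top_cyc n (t : F -> Z) :
  cyc (n + 1) t <-> cyc n (fun p : C => t p.2).
Proof.
split=> -[[lt dt] ct].
  split; first split.
  - by move=> r [k f] [k' f']; rewrite pair_lin /= lt.
  - by move=> i [k f]; rewrite cone_pr /= -dt addrCA -addrA; congr (pr _ _); lia.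
  - move=> [k f]; rewrite cone_dd /= ct sgD1.
    by rewrite -[t (- _)]/((linear_fun lt) (- _)) raddfN scaleNr scalerN.
split; first split.
- by move=> r f f'; have := lt r (0, f) (0, f'); rewrite pair_lin.
- move=> i f; have := dt (i + 1) (0, f); rewrite cone_pr /= addrK => <-.
  by congr (pr _ _); lia.
- move=> f; have := ct (0, f); rewrite cone_dd /= => ->; rewrite sgD1 scaleNr.
  have lt' : linear t by move=> r f1 f2; have := lt r (0, f1) (0, f2); rewrite pair_lin.
  by rewrite -[t (- _)]/((linear_fun lt') (- _)) raddfN scalerN.
Qed.

Lemma cone_extend n (T : K -> Z) : cyc n T -> bnd n (T \o a) ->
  exists2 U : C -> Z, cyc n U & forall k, U (k, 0) = T k.
Proof.
move=> cT [S hS SE]; have [T' ?] := cyc_lin cT; subst T; rename T' into T.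
have [S' ?] := homdeg_lin hS; subst S; rename S' into S.
exists (fun p => T p.1 + sg R n *: S p.2) => [|k]; last by rewrite raddf0 scaler0 addr0.
split; first split.
- move=> r [k f] [k' f']; rewrite pair_lin /= !linearP /=.
  by rewrite !(scalerDr, scalerA) addrACA [r * _]mulrC.
- move=> i [k f]; rewrite cone_pr /= linearD linearZ_LR /= cT.1.2; congr (_ + _ *: _).
  by rewrite -hS.2; congr (pr _ _); lia.
- move=> [k f]; rewrite cone_dd /= !linearD linearZ_LR linearN /= cT.2.
  have /= -> := SE f; rewrite !scalerDr !scalerN sg_sg -!addrA; congr (_ + _).
  by rewrite addrN addr0.
Qed.

Lemma null_cone_mid n : null F Z n -> null C Z n -> null K Z n.
Proof.
move=> nF nC T cT; have [U cU UE] := cone_extend cT (nF _ (cyc_comp ha cT)).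
have := bnd_comp cone_inl_chmap (nC U cU).
by congr bnd; apply: funext => k /=; rewrite UE.
Qed.

Lemma cone_top_bnd n (t : F -> Z) : cyc (n + 1) t ->
  bnd n (fun p : C => t p.2) <->
  exists2 u : K -> Z, cyc (n + 1) u & bnd (n + 1) (fun f => t f - u (a f)).
Proof.
move=> ct; have [t' ?] := cyc_lin ct; subst t; rename t' into t; split.
  move=> [S hS SE]; have [S' ?] := homdeg_lin hS; subst S; rename S' into S.
  exists (fun k => sg R n *: S (k, 0)).
    apply: (submodPZ (cyc_sub K Z (n + 1))); split; first split.
    - by move=> r k k'; rewrite -linearP pair_lin scaler0 addr0.
    - by move=> i k; rewrite hS.2 cone_pr raddf0.
    - move=> k; have := SE (k, 0); rewrite cone_dd /= !raddf0 ?oppr0 ?addr0.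
      move/esym/eqP; rewrite addr_eq0 sgD1 scaleNr => /eqP->//.
  exists (fun f => S (0, f)).
    split=> [r f f'|i f]; first by rewrite -linearP pair_lin scaler0 addr0.
    have := hS.2 (i + 1) (0, f); rewrite cone_pr addrK raddf0 => <-.
    by congr (pr _ _); lia.
  move=> f; have := SE (0, f); rewrite cone_dd /= raddf0 add0r => ->.
  have -> : (a f, - dd f) = 1 *: (a f, 0) - (0, dd f) :> C.
    by rewrite -[- (0, _)]/(- (0:K), - dd f) pair_lin scale1r scaler0 oppr0 addr0 add0r.
  rewrite scale1r linearB scalerBr sgD1 scaleNr.
  by rewrite addrA addrAC addrK.
move=> [u cu [S hS SE]]; have [u' ?] := cyc_lin cu; subst u; rename u' into u.
have [S' ?] := homdeg_lin hS; subst S; rename S' into S.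
exists (fun p => sg R n *: u p.1 + S p.2).
  split=> [r [k f] [k' f']|i [k f]].
    rewrite pair_lin /= !linearP /= !(scalerDr, scalerA) addrACA.
    by rewrite [r * _]mulrC.
  rewrite cone_pr /= linearD linearZ_LR /= cu.1.2; congr (_ + _).
  by rewrite -hS.2; congr (pr _ _); lia.
move=> [k f]; rewrite cone_dd /= [dd (_ + _)]linearD [dd (_ *: _)]linearZ_LR.
rewrite [u (_ + _)]linearD [S (- _)]linearN /= cu.2 sgD1.
rewrite !scalerDr scaleNr !scalerN !sg_sg.
move/eqP: (SE f); rewrite subr_eq sgD1 scaleNr => /eqP->.
by rewrite [- _ + dd _]addrC -!addrA addKr [_ + u _]addrC.
Qed.

Lemma cone_split n (U : C -> Z) : cyc n U -> bnd n (fun k => U (k, 0)) ->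
  exists2 t : F -> Z, cyc (n + 1) t & bnd n (fun p => U p - t p.2).
Proof.
move=> cU [S hS SE]; have [S' ?] := homdeg_lin hS; subst S; rename S' into S.
have [U' ?] := cyc_lin cU; subst U; rename U' into U.
pose t f := U (0, f) - sg R n *: S (a f).
have bt : bnd n (fun p => U p - t p.2).
  exists (fun p => S p.1).
    split=> [r p q|i [k f]]; first by rewrite linearP.
    by rewrite cone_pr /= hS.2.
  move=> [k f]; rewrite cone_dd /= /t opprB addrA.
  have -> : (k, f) = 1 *: (k, 0) + (0, f) :> C.
    by rewrite pair_lin scale1r scaler0 addr0 add0r.
  rewrite scale1r linearD SE linearD scalerDr addrA addrAC.
  by rewrite addrK addrC addrA.
exists t => //; apply/cone_top_cyc.
have := submodPB (cyc_sub _ _ n) cU (bnd_cyc bt); congr cyc.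
by apply: funext => p; rewrite -[LHS]/(U p - (U p - t p.2)) opprB addrC subrK.
Qed.

Lemma null_cone_inj n (U : C -> Z) : null F Z (n + 1) -> cyc n U ->
  bnd n (fun k => U (k, 0)) -> bnd n U.
Proof.
move=> nF cU bU; have [t ct bt] := cone_split cU bU.
have [t' ?] := cyc_lin ct; subst t.
have /cone_top_bnd-/(_ ct) bt' : exists2 u : K -> Z, cyc (n + 1) u &
    bnd (n + 1) (fun f => t' f - u (a f)).
  exists (fun _ => 0); first exact: submodP0 (cyc_sub _ _ _).
  by have := nF _ ct; congr bnd; apply: funext => f; rewrite subr0.
have := submodPD (bnd_sub _ _ n) bt bt'; congr bnd; apply: funext => p.
exact: subrK.
Qed.
End LES.
End Resolution.

(** * Quotient modules and short exact sequences *)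

Section Quotient.
Variables (R : comNzRingType).

Section Pi.
Variables (V W : lmodType R) (S : submodClosed V).

Lemma qpi_lin : linear (fun x : V => \pi_(quotient_module S) x).
Proof. by move=> a x y; rewrite quotient_piD -quotient_scale_pi. Qed.

Definition qpi : {linear V -> quotient_module S} := mklin qpi_lin.

Lemma qpi_surj y : exists x, qpi x = y.
Proof. by exists (repr y); rewrite mklinE reprK. Qed.

Lemma qpi_eq x y : qpi x = qpi y <-> x - y \in S.
Proof.
by rewrite !mklinE -quotient_piE; split=> [->//|/eqP].
Qed.

Lemma qpi_eq0 x : qpi x = 0 <-> x \in S.
Proof. by rewrite -[0](raddf0 qpi) qpi_eq subr0. Qed.

Lemma quotient_lift (f : {linear V -> W}) : (forall x, x \in S -> f x = 0) ->
  exists g : {linear quotient_module S -> W}, forall x, g (qpi x) = f x.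
Proof.
move=> f0; pose g (y : quotient_module S) := f (repr y).
have gE x : g (qpi x) = f x.
  apply/eqP; rewrite -subr_eq0 -raddfB; apply/eqP/f0/qpi_eq.
  by rewrite !mklinE reprK.
have lg : linear g.
  move=> a y y'; have [x <-] := qpi_surj y; have [x' <-] := qpi_surj y'.
  by rewrite -linearP !gE linearP.
by exists (mklin lg).
Qed.
End Pi.

Definition short_exact (M' M M'' : lmodType R) (f : {linear M' -> M})
    (g : {linear M -> M''}) : Prop :=
  [/\ forall x, f x = 0 -> x = 0, forall x, g (f x) = 0,
      forall y, g y = 0 -> exists x, y = f x & forall z, exists y, g y = z].

Section ConeResolves.
Variables (M' M M'' : lmodType R) (f : {linear M' -> M}) (g : {linear M -> M''}).
Hypothesis fg : short_exact f g.
Variables (F K : gmod R) (e' : {linear F -> M'}) (e : {linear K -> M}).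
Hypotheses (re' : resolves e') (re : resolves e).
Variables (a : {linear F -> K}) (ca : covers e' e f a).
Variable (ha : chmap a).

(** The cone of a lift of an injective map resolves the cokernel.  The
    augmentation is [g \o e] on [K], corrected on [F] by the homotopy [h] that
    makes the square of [a] and [f] commute. *)
Lemma cone_resolves : exists e'' : {linear cone ha -> M''},
  resolves e'' /\ forall k, e'' (k, 0) = g (e k).
Proof.
have [f0 gf gy gz] := fg; have [sF [pF dF] [iF jF]] := re'.
have [sK [pK dK] [iK jK]] := re; have [_ [h hh hE]] := ca.
have [h' ?] := homdeg_lin hh; subst h; rename h' into h.
have {}hE x : e (a x) = f (e' x) + h (dd x).
  by apply/eqP; rewrite addrC -subr_eq hE stg_ddE add0r sg0 scale1r.
have dK0 k : e (dd k) = 0 by rewrite -dK stg_ddE.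
have dF0 k : e' (dd k) = 0 by rewrite -dF stg_ddE.
have le : linear (fun p : cone ha => g (e p.1 + h p.2)).
  move=> r [k x] [k' x']; rewrite pair_lin -linearP [e (_ + _)]linearP.
  by rewrite [h (_ + _)]linearP /= scalerDr addrACA.
exists (mklin le); split=> [|k]; last by rewrite mklinE /= raddf0 addr0.
split; first exact: cone_semifree.
  split=> [i [k x]|[k x]]; rewrite ?cone_pr ?cone_dd !(mklinE le) /=.
    have -> : g (e (pr i k) + h (pr (i - 1) x)) = g (@pr R (stg M) i (e k + h x)).
      have -> : @pr R (stg M) i (e k + h x) = pr i (e k : stg M) + pr i (h x).
        exact: raddfD.
      congr (g (_ + _)); first exact/esym/pK.
      by rewrite -hh.2 add0r subrK.
    exact: (stg_chmap g).1.
  have -> : e (dd k + a x) = f (e' x) + h (dd x) by rewrite raddfD /= dK0 add0r hE.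
  have -> : h (- dd x) = - h (dd x) by exact: raddfN.
  by rewrite addrK gf.
split=> [[k x]|z _].
  rewrite cone_dd => -[dk /eqP]; rewrite oppr_eq0 => /eqP dx [y].
  rewrite mklinE /= => /gy[m' mE].
  have [|x' xE] := iF x dx.
    exists 0; rewrite stg_ddE; apply: f0; have := hE x; rewrite dx raddf0 addr0 => <-.
    move/eqP: dk; rewrite addrC addr_eq0 => /eqP->.
    by rewrite raddfN /= dK0 oppr0.
  have [u [v [du /eqP]]] := jF (m' + e' x') (stg_ddE _).
  rewrite stg_ddE subr_eq0 => /eqP uE.
  have [||k' kE] := iK (k + a x' - a u).
  - by rewrite raddfB raddfD /= !ca.1.2 du raddf0 subr0 -xE.
  - exists 0; rewrite stg_ddE.
    have -> : e (k + a x' - a u) = e k + e (a x') - e (a u).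
      by rewrite raddfB raddfD.
    by rewrite !hE du raddf0 addr0 -xE -uE addrCA mE raddfD [f m' + _]addrC subrr.
  exists (k', u - x'); rewrite (cone_dd ha) -kE; congr (_, _).
    by rewrite [a (u - x')]raddfB addrA subrK addrK.
  by rewrite raddfB /= du sub0r opprK.
have [y <-] := gz z; have [k [w [dk kE]]] := jK y (stg_ddE _).
exists (k, 0), 0; split; first by rewrite (cone_dd ha) dk !raddf0 ?oppr0 ?addr0.
move/eqP: kE; rewrite stg_ddE subr_eq0 => /eqP->.
by rewrite mklinE /= raddf0 addr0 subrr.
Qed.
End ConeResolves.

(** ** Quotients by [x V] and the colon submodule *)

Lemma scale_lin (V : lmodType R) (x : R) : linear (fun v : V => x *: v).
Proof. by move=> a u v; rewrite scalerDr !scalerA mulrC. Qed.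
Definition scl (V : lmodType R) (x : R) : {linear V -> V} := mklin (@scale_lin V x).
Lemma sclE (V : lmodType R) x (v : V) : scl V x v = x *: v. Proof. by []. Qed.

Section Colon.
Variables (V : lmodType R) (x : R).
Implicit Types B : V -> Prop.

(** The submodules [(B : x)] and [x V + B]. *)
Definition colon B : V -> Prop := fun v => B (x *: v).
Definition adj B : V -> Prop := fun v => exists u b, B b /\ v = x *: u + b.

Lemma colon_sub B : submodP B -> submodP (colon B).
Proof. exact: (submodP_preim (scl V x)). Qed.

Lemma adj_sub B : submodP B -> submodP (adj B).
Proof.
move=> sB; split=> [|a _ _ [u [b [Bb ->]]] [u' [b' [Bb' ->]]]].
  by exists 0, 0; rewrite scaler0 addr0; split=> //; exact: submodP0 sB.
exists (a *: u + u'), (a *: b + b'); split; first exact: (proj2 sB a b b').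
by rewrite !scalerDr !scalerA mulrC addrACA.
Qed.

Lemma adj_mem B v : B v -> adj B v.
Proof. by move=> Bv; exists 0, v; rewrite scaler0 add0r. Qed.
Lemma adj_gen B v : submodP B -> adj B (x *: v).
Proof. by move=> sB; exists v, 0; rewrite addr0; split=> //; exact: submodP0 sB. Qed.

Definition quo B (sB : submodP B) : lmodType R := quotient_module (psub sB).
Definition qp B (sB : submodP B) : {linear V -> quo sB} := qpi (psub sB).

Lemma qp_eq0 B (sB : submodP B) v : qp sB v = 0 <-> B v.
Proof. by rewrite -(psubE sB); apply: qpi_eq0. Qed.

Lemma qp_eq B (sB : submodP B) v w : qp sB v = qp sB w <-> B (v - w).
Proof.
rewrite -(psubE sB); exact: qpi_eq.
Qed.

Lemma qp_surj B (sB : submodP B) y : exists v, qp sB v = y.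
Proof. exact: qpi_surj. Qed.

Lemma quo_lift B (sB : submodP B) (W : lmodType R) (f : {linear V -> W}) :
  (forall v, B v -> f v = 0) ->
  exists g : {linear quo sB -> W}, forall v, g (qp sB v) = f v.
Proof. by move=> f0; apply: quotient_lift => v /psubE/f0. Qed.

Lemma quo_proj B B' (sB : submodP B) (sB' : submodP B') :
  (forall v, B v -> B' v) ->
  exists g : {linear quo sB -> quo sB'}, forall v, g (qp sB v) = qp sB' v.
Proof. by move=> BB'; apply: quo_lift => v /BB'/qp_eq0. Qed.

(** The sequence [0 -> V / (B : x) -> V / B -> V / (x V + B) -> 0], whose first
    map is multiplication by [x]; every induction on ideals below uses it. *)
Lemma colon_exact B (sB : submodP B) (sc : submodP (colon B)) (sa : submodP (adj B)) :
  exists (f : {linear quo sc -> quo sB}) (g : {linear quo sB -> quo sa}),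
  [/\ short_exact f g, (forall v, f (qp _ v) = qp sB (x *: v)) &
      forall v, g (qp sB v) = qp _ v].
Proof.
have [|f fE] := @quo_lift _ sc _ (qp sB \o scl V x).
  by move=> v Bv; apply/qp_eq0.
have [|g gE] := @quo_proj B _ sB sa; first exact: adj_mem.
exists f, g; split=> //; split=> [y|y|y|z].
- by have [v <-] := qp_surj y; rewrite fE => /qp_eq0 Bv; apply/qp_eq0.
- have [v <-] := qp_surj y; rewrite fE /= gE; apply/qp_eq0; exact: adj_gen.
- have [v <-] := qp_surj y; rewrite gE => /qp_eq0[u [b [Bb ->]]].
  exists (qp _ u); rewrite fE; apply/qp_eq; by rewrite addrC addKr.
- by have [v <-] := qp_surj z; exists (qp sB v).
Qed.

Lemma regular_exact B (sB : submodP B) (sa : submodP (adj B)) :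
  (forall v, B (x *: v) -> B v) ->
  exists g : {linear quo sB -> quo sa},
  short_exact (scl _ x) g /\ forall v, g (qp sB v) = qp _ v.
Proof.
move=> regx; have [f [g [[_ gf gy gz] fE gE]]] := colon_exact sB (colon_sub sB) sa.
exists g; split=> //; split=> // y.
- have [v <-] := qp_surj y; rewrite sclE -linearZ_LR => /qp_eq0/regx Bv.
  exact/qp_eq0.
- by have [v <-] := qp_surj y; rewrite sclE -linearZ_LR -fE gf.
- move=> /gy[z ->]; have [v <-] := qp_surj z.
  by exists (qp sB v); rewrite fE sclE linearZ_LR.
Qed.
End Colon.

Lemma adj_self (x : R) (J : R^o -> Prop) : submodP J -> adj x J (x : R^o).
Proof. by move=> sJ; have := adj_gen x (1 : R^o) sJ; rewrite -[_ *: _]/(x * 1) mulr1. Qed.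

(** ** Regular sequences on [V / B] *)

Section Regular.
Variable V : lmodType R.
Implicit Types B : V -> Prop.

(** [adjs f B] is the submodule [f V + B], and [mreg f B] says that [f] is a
    regular sequence on [V / B]; the quotient need not be different from [0]. *)
Definition adjs (f : seq R) B : V -> Prop := foldl (fun B x => adj x B) B f.

Fixpoint mreg (f : seq R) B : Prop :=
  if f is x :: f' then (forall v, B (x *: v) -> B v) /\ mreg f' (adj x B) else True.

Lemma adjs_sub f B : submodP B -> submodP (adjs f B).
Proof. by elim: f B => //= x f IH B /(adj_sub x)/IH. Qed.

Lemma adjs_mem f B v : B v -> adjs f B v.
Proof. by elim: f B => //= x f IH B /(adj_mem x)/IH. Qed.

End Regular.

(** If [t] maps onto [W / B], the quotients of [V] and [W] are the same.  The next
    lemmas transport regularity along this isomorphism without naming it. *)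
Lemma adj_transport (V W : lmodType R) (t : {linear V -> W}) x (B : W -> Prop) : submodP B ->
  (forall w, exists v, B (w - t v)) ->
  adj x (fun v => B (t v)) = (fun v => adj x B (t v)).
Proof.
move=> sB ts; apply: funext => v; apply/propext; split=> [[u [b [Bb ->]]]|].
  by exists (t u), (t b); rewrite linearD linearZ_LR.
move=> [w [b [Bb tv]]]; have [u Bu] := ts w.
exists u, (v - x *: u); rewrite [x *: u + _]addrC subrK; split=> //.
rewrite linearB linearZ_LR /= tv addrAC -scalerBr.
by apply: (submodPD sB) => //; apply: (submodPZ sB).
Qed.

Lemma mreg_transport (V W : lmodType R) (t : {linear V -> W}) f (B : W -> Prop) : submodP B ->
  (forall w, exists v, B (w - t v)) ->
  mreg f B -> mreg f (fun v => B (t v)).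
Proof.
elim: f B => //= x f IH B sB ts [xB /IH IHx]; split.
  by move=> v; rewrite linearZ_LR; apply: xB.
rewrite adj_transport //; apply: IHx => [|w]; first exact: adj_sub.
by have [v Bv] := ts w; exists v; apply: adj_mem.
Qed.

Lemma adjs_transport (V W : lmodType R) (t : {linear V -> W}) f (B : W -> Prop) : submodP B ->
  (forall w, exists v, B (w - t v)) ->
  adjs f (fun v => B (t v)) = (fun v => adjs f B (t v)).
Proof.
elim: f B => //= x f IH B sB ts; rewrite adj_transport // IH //.
  exact: adj_sub.
by move=> w; have [v Bv] := ts w; exists v; apply: adj_mem.
Qed.

Lemma covers_scl (K : gmod R) (M : lmodType R) (e : {linear K -> M}) x :
  covers e e (scl M x) (scl K x).
Proof.
split; first by split=> [i k|k]; rewrite !sclE linearZ_LR.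
have := submodP0 (bnd_sub K (stg M) 0); congr bnd.
by apply: funext => k /=; rewrite !sclE linearZ_LR subrr.
Qed.
End Quotient.

(** * Products of modules as complexes *)

Section GradedProduct.
Variables (R : comNzRingType) (T : eqType) (V : T -> lmodType R) (deg : T -> int).

(** The factor [V t] is placed in degree [deg t].  The indices are the degrees
    themselves for total complexes, and natural numbers for resolutions. *)
Definition gprod : lmodType R := product_module V.
Implicit Types x y : gprod.

Lemma gprodE a x y t : (a *: x + y) t = a *: x t + y t.
Proof. by []. Qed.

Lemma gpr_lin i : linear (fun x : gprod => (fun t => if i == deg t then x t else 0) : gprod).
Proof.
move=> a x y; apply: functional_extensionality_dep => t; rewrite !gprodE.
by case: eqP; rewrite // scaler0 addr0.
Qed.
Definition gpr i : {linear gprod -> gprod} := mklin (gpr_lin i).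

Lemma gprE i x t : gpr i x t = if i == deg t then x t else 0.
Proof. by []. Qed.

Lemma gpr_pr i j x : gpr i (gpr j x) = if i == j then gpr j x else 0.
Proof.
apply: functional_extensionality_dep => t; rewrite !gprE.
case: (eqVneq i j) => [->|ne]; first by rewrite gprE; case: eqP.
by case: eqP => // it; case: eqP => // jt; move: ne; rewrite it jt eqxx.
Qed.

Lemma gpr_ext x y : (forall i, gpr i x = gpr i y) -> x = y.
Proof.
move=> xy; apply: functional_extensionality_dep => t.
by have := congr1 (fun u : gprod => u t) (xy (deg t)); rewrite !gprE eqxx.
Qed.

Lemma gpr_asm (u : int -> gprod) : exists x, forall i, gpr i x = gpr i (u i).
Proof.
exists (fun t => u (deg t) t) => i; apply: functional_extensionality_dep => t.
by rewrite !gprE; case: eqP => [->|].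
Qed.

Definition graded_product (d : {linear gprod -> gprod})
    (d_pr : forall i x, d (gpr i x) = gpr (i - 1) (d x)) (d_d : forall x, d (d x) = 0) :=
  Gmod gpr_pr gpr_ext gpr_asm d_pr d_d.

Definition single t (v : V t) : gprod := dfwith (fun s => 0 : V s) v.

Lemma single_eq t (v : V t) : single v t = v.
Proof. exact: dfwith_in. Qed.
Lemma single_neq t (v : V t) s : t != s -> single v s = 0.
Proof. by move=> ne; apply: dfwith_out. Qed.

Lemma single_lin t : linear (@single t).
Proof.
move=> a u v; apply: functional_extensionality_dep => s; rewrite gprodE.
have [<-|ne] := eqVneq t s; first by rewrite !single_eq.
by rewrite !single_neq // scaler0 addr0.
Qed.

Lemma gpr_single t x : injective deg -> gpr (deg t) x = single (x t).
Proof.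
move=> di; apply: functional_extensionality_dep => s; rewrite gprE (inj_eq di).
by case: eqVneq => [<-|ne]; rewrite ?single_eq ?single_neq.
Qed.
End GradedProduct.

(** * Free resolutions over noetherian rings *)

Section Free.
Variables (R : comNzRingType) (noethR : noetherian R).

Section Combinations.
Variables (V : lmodType R) (n : nat).
Implicit Types y : 'I_n -> V.

Lemma comb_lin y : linear (fun v : 'rV[R]_n => \sum_i v 0 i *: y i).
Proof.
move=> a u v; rewrite scaler_sumr -big_split /=; apply: eq_bigr => i _.
by rewrite !mxE scalerDl scalerA.
Qed.
Definition comb y : {linear 'rV[R]_n -> V} := mklin (comb_lin y).

Lemma combE y v : comb y v = \sum_i v 0 i *: y i. Proof. by []. Qed.

Lemma comb_delta y i : comb y (delta_mx 0 i) = y i.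
Proof.
rewrite combE (bigD1 i) //= big1 ?addr0 => [|j ji]; rewrite mxE eqxx ?eqxx /=.
  by rewrite scale1r.
by rewrite (negPf ji) scale0r.
Qed.
End Combinations.

Lemma comb_span (V : lmodType R) (s : seq V) y :
  in_span s y <-> exists v, comb (fun i : 'I_(size s) => s`_i) v = y.
Proof.
split=> [[c ->]|[v <-]]; last by exists (fun i => v 0 i).
by exists (\row_i c i); rewrite combE; apply: eq_bigr => i _; rewrite mxE.
Qed.

Lemma row_span n (x : 'rV[R]_n) :
  in_span [seq (delta_mx 0 i : 'rV[R]_n) | i <- enum 'I_n] x.
Proof.
rewrite [x]row_sum_delta; apply: (submodP_sum (in_span_sub _)) => i _.
apply: (submodPZ (in_span_sub _)); apply: in_span_gen; apply/mapP.
by exists i; rewrite ?mem_enum.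
Qed.

(** The state of the iteration: the last map between free modules. *)
Record free_map := FreeMap { fm_src; fm_tgt;
  fm_fun : {linear 'rV[R]_fm_src -> 'rV[R]_fm_tgt} }.

Lemma kernel_cover (M : lmodType R) n (f : {linear 'rV[R]_n -> M}) :
  exists (p : nat) (g : {linear 'rV[R]_p -> 'rV[R]_n}),
    forall x, f x = 0 <-> exists y, x = g y.
Proof.
have sk : submodP (fun x => f x = 0).
  split=> [|a x y fx fy]; first exact: raddf0.
  by rewrite linearP fx fy scaler0 addr0.
have [t tP] := fg_submodule noethR sk (fun x _ => row_span x).
exists (size t), (comb (fun i : 'I_(size t) => t`_i)) => x.
rewrite tP comb_span; split=> -[c]; first by move=> <-; exists c.
by move=> ->; exists c.
Qed.

Definition fg_terms (K : gmod R) : Prop :=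
  forall i, exists s : seq K, forall x, in_span s (pr i x).

Section Complex.
Variables (M : lmodType R) (n0 : nat) (g0 : {linear 'rV[R]_n0 -> M}).
Hypothesis g0_surj : forall y, exists x, g0 x = y.
Variables (n1 : nat) (f0 : {linear 'rV[R]_n1 -> 'rV[R]_n0}).
Hypothesis f0P : forall x, g0 x = 0 <-> exists y, x = f0 y.
Variables (nx : free_map -> nat) (kf : forall s, {linear 'rV[R]_(nx s) -> 'rV[R]_(fm_src s)}).
Hypothesis kfP : forall s x, fm_fun s x = 0 <-> exists y, x = kf s y.

Definition free_next (s : free_map) : free_map := FreeMap (kf s).
Fixpoint free_seq t : free_map :=
  if t is t'.+1 then free_next (free_seq t') else FreeMap f0.

Definition free_term t : lmodType R := 'rV[R]_(fm_tgt (free_seq t)).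
Definition free_diff t : {linear free_term t.+1 -> free_term t} :=
  fm_fun (free_seq t).

Lemma free_diffP t x : free_diff t x = 0 <-> exists y, x = free_diff t.+1 y.
Proof. exact: kfP. Qed.

Definition free_car : lmodType R := gprod free_term.
Definition free_pr i : {linear free_car -> free_car} := gpr free_term Posz i.

Lemma free_dd_lin :
  linear (fun x : free_car => (fun t => free_diff t (x t.+1)) : free_car).
Proof.
by move=> a x y; apply: functional_extensionality_dep => t; rewrite !gprodE linearP.
Qed.
Definition free_dd : {linear free_car -> free_car} := mklin free_dd_lin.

Lemma free_prE i (x : free_car) t : free_pr i x t = if i == t%:Z then x t else 0.
Proof. by []. Qed.
Lemma free_ddE (x : free_car) t : free_dd x t = free_diff t (x t.+1).
Proof. by []. Qed.

Lemma free_dd_pr i x : free_dd (free_pr i x) = free_pr (i - 1) (free_dd x).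
Proof.
apply: functional_extensionality_dep => t; rewrite free_ddE !free_prE free_ddE.
have -> : (i - 1 == t%:Z) = (i == t.+1%:Z) by lia.
by case: eqP; rewrite ?raddf0.
Qed.

Lemma free_dd_dd x : free_dd (free_dd x) = 0.
Proof.
apply: functional_extensionality_dep => t; rewrite !free_ddE.
by apply/free_diffP; eexists.
Qed.

Definition free_gmod : gmod R := graded_product free_dd_pr free_dd_dd.

Lemma free_gprE i (x : free_gmod) : pr i x = free_pr i x. Proof. by []. Qed.

Lemma free_coord_lin t : linear (fun x : free_car => x t).
Proof. by []. Qed.
Definition free_coord t : {linear free_car -> free_term t} := mklin (free_coord_lin t).

Notation free_single t v := (@single R nat free_term t v).

Lemma free_single_pr t (x : free_car) : free_pr t%:Z x = free_single t (x t).
Proof. by apply: (gpr_single (deg := Posz)) => ? ? []. Qed.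

Lemma free_semifree : semifree free_gmod.
Proof.
split=> [|i A B g f fP].
  exists 0 => i i0 x; apply: functional_extensionality_dep => t.
  by rewrite -[LHS]/(free_pr i x t) free_prE ifN //; lia.
case: i fP => [t|t] fP; last first.
  exists (\0); split=> // x; rewrite raddf0; apply/esym.
  have -> : @pr R free_gmod (Negz t) x = 0; last exact: raddf0.
  by apply: functional_extensionality_dep => s; rewrite -[LHS]/(free_pr (Negz t) x s).
pose N := fm_tgt (free_seq t).
have /choice[h hP] : forall k : 'I_N, exists a, g a = f (free_single t (delta_mx 0 k)).
  move=> k; have [a aE] := fP (free_single t (delta_mx 0 k)); exists a.
  by rewrite aE free_gprE free_single_pr single_eq.
exists (comb h \o free_coord t); split=> x /=.
  by congr (comb h _); rewrite -[LHS]/(free_pr t%:Z x t) free_prE eqxx.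
rewrite free_gprE free_single_pr.
have lfs : linear (fun v => f (free_single t v)).
  by move=> a u v; rewrite single_lin linearP.
rewrite -[RHS]/(mklin lfs (x t)) [x t in RHS]row_sum_delta !linear_sum.
apply: eq_bigr => k _.
by rewrite !linearZ_LR hP.
Qed.

Definition free_aug : {linear free_gmod -> M} := g0 \o free_coord 0.

Lemma free_resolves : resolves free_aug.
Proof.
split; first exact: free_semifree.
  split=> [i x|x]; last first.
    by apply/esym/f0P; exists ((x : free_car) 1%N).
  rewrite stg_prE free_gprE -[RHS]/(g0 (free_pr i x 0%N)) free_prE.
  by case: eqP; rewrite ?raddf0.
split=> [x dx [y xE]|y _].
  have x0 : exists y0 : free_term 1, (x : free_car) 0%N = free_diff 0 y0.
    by apply/f0P; exact: xE.
  have xS t : exists z : free_term t.+2, (x : free_car) t.+1 = free_diff t.+1 z.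
    by apply/free_diffP; have := congr1 (fun u : free_car => u t) dx.
  have [y0 y0E] := x0; have [z zE] : exists z : forall t, free_term t.+2,
      forall t, (x : free_car) t.+1 = free_diff t.+1 (z t).
    exists (fun t => sval (cid (xS t))) => t; exact: svalP (cid (xS t)).
  exists (fun t => match t with 0 => 0 | 1 => y0 | t.+2 => z t end).
  by apply: functional_extensionality_dep => -[|t]; rewrite -[RHS]/(free_diff _ _).
have [v <-] := g0_surj y; exists (free_single 0%N v), 0; split.
  apply: functional_extensionality_dep => t.
  by rewrite -[LHS]/(free_diff _ _) single_neq ?raddf0.
by rewrite -[free_aug _]/(g0 (free_single 0%N v 0%N)) single_eq subrr.
Qed.

Lemma free_fg_terms : fg_terms free_gmod.
Proof.
move=> [t|t]; last first.
  exists [::] => x; apply/in_span_nil; apply: functional_extensionality_dep => u.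
  by rewrite -[LHS]/(free_pr (Negz t) x u).
exists [seq free_single t v | v <- [seq delta_mx 0 i : free_term t | i <- enum 'I_(fm_tgt (free_seq t))]].
move=> x; rewrite free_gprE free_single_pr.
exact: (in_span_map (mklin (@single_lin R _ free_term t)) (row_span _)).
Qed.

End Complex.

(** Each kernel is covered by the next free module; the terms are finitely
    generated, which is what makes Nakayama's lemma available for [Ext]. *)
Lemma free_resolution (M : lmodType R) : fin_gen M ->
  exists (K : gmod R) (e : {linear K -> M}), resolves e /\ fg_terms K.
Proof.
move=> [s sP]; pose g0 := comb (fun i : 'I_(size s) => s`_i).
have g0_surj y : exists x, g0 x = y by apply/comb_span.
have [n1 [f0 f0P]] := kernel_cover g0.
have next (u : free_map) : { p : nat & { g : {linear 'rV[R]_p -> 'rV[R]_(fm_src u)} |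
    forall x, fm_fun u x = 0 <-> exists y, x = g y } }.
  by have /cid[p /cid gP] := kernel_cover (fm_fun u); exists p.
pose nx u := projT1 (next u); pose kf u := sval (projT2 (next u)).
have kfP u x : fm_fun u x = 0 <-> exists y, x = kf u y by apply: (svalP (projT2 (next u))).
exists (free_gmod f0 kfP), (free_aug g0 f0 kfP); split.
  exact: free_resolves.
exact: free_fg_terms.
Qed.
End Free.

(** * From complexes indexed by degrees to their products *)

Section Total.
Variable R : comNzRingType.

Section Tot.
Variable X : complex R.

Definition tot_car : lmodType R := gprod (cobj X).
Definition tot_pr i : {linear tot_car -> tot_car} := gpr (cobj X) (fun j => j) i.

Lemma tot_dd_lin :
  linear (fun x : tot_car => (fun j => diff X (j + 1) j (x (j + 1))) : tot_car).
Proof.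
by move=> a x y; apply: functional_extensionality_dep => t; rewrite !gprodE linearP.
Qed.
Definition tot_dd : {linear tot_car -> tot_car} := mklin tot_dd_lin.

Lemma tot_prE i (x : tot_car) j : tot_pr i x j = if i == j then x j else 0.
Proof. by []. Qed.
Lemma tot_ddE (x : tot_car) j : tot_dd x j = diff X (j + 1) j (x (j + 1)).
Proof. by []. Qed.

Lemma tot_dd_pr i x : tot_dd (tot_pr i x) = tot_pr (i - 1) (tot_dd x).
Proof.
apply: functional_extensionality_dep => t; rewrite tot_ddE !tot_prE tot_ddE.
have -> : (i - 1 == t) = (i == t + 1) by lia.
by case: eqP; rewrite ?raddf0.
Qed.

Lemma tot_dd_dd x : tot_dd (tot_dd x) = 0.
Proof. by apply: functional_extensionality_dep => t; rewrite !tot_ddE diff_diff. Qed.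

Definition tot : gmod R := graded_product tot_dd_pr tot_dd_dd.

Lemma tot_gprE i (x : tot) : pr i x = tot_pr i x. Proof. by []. Qed.
Lemma tot_gddE (x : tot) : dd x = tot_dd x. Proof. by []. Qed.

Lemma single_pr i (x : tot) : pr i x = single ((x : tot_car) i).
Proof. exact: (gpr_single (deg := fun j => j)). Qed.

Lemma pr_single i (v : X i) : pr i (single v : tot) = single v.
Proof. by rewrite single_pr single_eq. Qed.

Lemma dd_single i (v : X i) : dd (single v : tot) = single (diff X i (i - 1) v).
Proof.
rewrite -pr_single dd_pr single_pr; congr single.
rewrite tot_gddE tot_ddE subrK single_eq //.
Qed.

Lemma tot_cycle (x : tot) n : dd x = 0 -> diff X n (n - 1) (x n) = 0.
Proof.
by move/(congr1 (fun u : tot => u (n - 1))); rewrite tot_gddE tot_ddE subrK.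
Qed.
End Tot.

(** Corestrict both maps to the image of [g]. *)
Lemma projective_lift (P A B : lmodType R) (g : {linear A -> B}) (f : {linear P -> B}) :
  projective P -> (forall x, exists a, g a = f x) ->
  exists h : {linear P -> A}, forall x, g (h x) = f x.
Proof.
move=> pP gf; pose B' := submodule (image_pred g).
have gi a : g a \in image_pred g by rewrite inE; exists a.
have fi x : f x \in image_pred g by rewrite inE; apply: gf.
have lg : linear (fun a => Sub (g a) (gi a) : B').
  by move=> r a b; apply: val_inj; rewrite /= linearP.
have lf : linear (fun a => Sub (f a) (fi a) : B').
  by move=> r a b; apply: val_inj; rewrite /= linearP.
have [|h hE] := pP A B' (mklin lg) (mklin lf).
  move=> b; have := valP b; rewrite inE => -[a aE].
  by exists a; apply: val_inj.
by exists h => x; have := congr1 val (hE x).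
Qed.

Lemma tot_semifree (X : complex R) :
  (exists b : int, forall i, i < b -> zero_module (X i)) ->
  (forall i, projective (X i)) -> semifree (tot X).
Proof.
move=> [b Xb] pX; split=> [|i A B g f fP].
  exists b => i ib x; rewrite single_pr (Xb i ib (x i)).
  by apply: functional_extensionality_dep => s; have [<-|ne] := eqVneq i s;
     rewrite ?single_eq ?single_neq.
have lfs : linear (fun v => f (@single R int (cobj X) i v)).
  by move=> a u v; rewrite single_lin linearP.
have [v|h hE] := projective_lift (g := g) (f := mklin lfs) (pX i).
  by have [a aE] := fP (single v); exists a; rewrite aE pr_single.
have lh : linear (fun x : tot X => h ((x : tot_car X) i)).
  by move=> a u v; rewrite gprodE linearP.
exists (mklin lh); split=> x; rewrite !(mklinE lh) single_pr ?single_eq //.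
Qed.

Definition cycle_of (X : complex R) n (x : X n) (dx : diff X n (n - 1) x = 0) :
  cycles X n.
Proof. by exists x; rewrite inE /= dx. Defined.

Section QuasiIso.
Variables (X Y : complex R) (q : chain_map X Y).

Lemma homology_eq0 (Z : complex R) n (z : cycles Z n) :
  \pi_(homology Z n) z = 0 <-> exists y, diff Z (n + 1) n y = val z.
Proof.
have h := qpi_eq0 (boundaries (X := Z) (n := n)) z.
by split=> [/h/asboolP|/asboolP/h].
Qed.

Lemma totm_lin : linear (fun x : tot X => (fun i => q i (x i)) : tot Y).
Proof.
by move=> a x y; apply: functional_extensionality_dep => i; rewrite !gprodE linearP.
Qed.
Definition totm : {linear tot X -> tot Y} := mklin totm_lin.

Lemma totm_chmap : chmap totm.
Proof.
split=> [i x|x]; apply: functional_extensionality_dep => j.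
  rewrite !tot_gprE -[RHS]/(q j (tot_pr X i x j)) !tot_prE.
  by case: eqP; rewrite ?raddf0.
by rewrite !tot_gddE -[RHS]/(q j (tot_dd X x j)) !tot_ddE cmap_diff.
Qed.

(** The choices in the different degrees are made independently, which is
    possible because the total complex is a product. *)
Lemma totm_qiso : quasi_iso q -> qiso totm.
Proof.
move=> qq; split=> [x dx [y xE]|y dy].
  have H n : exists x', diff X (n + 1) n x' = (x : tot_car X) n.
    have /= := homology_eq0 (cycle_of (tot_cycle n dx)); case=> + _; apply.
    apply: (bij_inj (qq n)); rewrite -[0](raddf0 (qpi (boundaries (X := X) (n := n)))).
    rewrite !homology_map_pi; apply/eqP; rewrite quotient_piE /=.
    apply/asboolP; exists ((y : tot_car Y) (n + 1)).
    have := congr1 (fun u : tot Y => u n) xE; rewrite tot_gddE tot_ddE => <-.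
    by rewrite /= raddf0 subr0.
  have H' j : exists w : X j, diff X j (j - 1) w = (x : tot_car X) (j - 1).
    by have := H (j - 1); rewrite subrK.
  have [x' x'E] : exists x' : forall j, X j,
      forall j, diff X j (j - 1) (x' j) = (x : tot_car X) (j - 1).
    by exists (fun n => sval (cid (H' n))) => n; exact: svalP (cid (H' n)).
  exists x'; apply: functional_extensionality_dep => n.
  by rewrite tot_gddE tot_ddE; have := x'E (n + 1); rewrite addrK.
have H n : exists (x : X n) (z : Y (n + 1)), diff X n (n - 1) x = 0 /\
    (y : tot_car Y) n - q n x = diff Y (n + 1) n z.
  have [h hK gK] := qq n.
  pose z := cycle_of (tot_cycle n dy).
  have [x xE] := qpi_surj (h (\pi_(homology Y n) z)).
  have := gK (\pi_(homology Y n) z); rewrite -xE mklinE homology_map_pi.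
  move/eqP; rewrite eq_sym quotient_piE => /asboolP[w wE].
  exists (val x), w; split; last by rewrite wE.
  by have := valP x; rewrite inE => /eqP.
have [x xE] : exists x : forall n, X n, forall n, diff X n (n - 1) (x n) = 0 /\
    exists z : Y (n + 1), (y : tot_car Y) n - q n (x n) = diff Y (n + 1) n z.
  exists (fun n => sval (cid (H n))) => n.
  by have [z [? ?]] := svalP (cid (H n)); split=> //; exists z.
have H2 j : exists z : Y j, (y : tot_car Y) (j - 1) - q (j - 1) (x (j - 1)) = diff Y j (j - 1) z.
  by have [_] := xE (j - 1); rewrite subrK.
have [z zE] : exists z : forall j, Y j, forall j,
    (y : tot_car Y) (j - 1) - q (j - 1) (x (j - 1)) = diff Y j (j - 1) (z j).
  by exists (fun n => sval (cid (H2 n))) => n; exact: svalP (cid (H2 n)).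
exists x, z; split; apply: functional_extensionality_dep => n.
  rewrite tot_gddE tot_ddE; have := (xE (n + 1)).1; rewrite addrK //.
rewrite tot_gddE tot_ddE; have := zE (n + 1); rewrite addrK => <-.
by [].
Qed.
End QuasiIso.

(** ** Maps of degree [n] between total complexes *)

Section HomTotal.
Variables X Y : complex R.
Implicit Types (T S : {linear tot X -> tot Y}).

(** Maps of degree [n] between products may a priori mix infinitely many
    components; by homogeneity they do not, and the two encodings of a
    homogeneous map agree.  The signs match [hom_diff]. *)
Lemma homdeg_coord n T i (x : tot X) : homdeg n T ->
  (T x : tot_car Y) (i + n) = (T (single ((x : tot_car X) i)) : tot_car Y) (i + n).
Proof.
move=> [_ dT]; rewrite -single_pr -dT tot_gprE tot_prE eqxx //.
Qed.

Definition to_hom_fun T : hom_ambient X Y := fun i j x => (T (single x) : tot_car Y) j.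

Lemma to_hom_subproof n T : homdeg n T -> to_hom_fun T \in @hom_pred R X Y n.
Proof.
move=> [_ dT]; apply/asboolP; split=> [i j a x y|i j x ij].
  by rewrite /to_hom_fun single_lin linearP.
by rewrite /to_hom_fun -pr_single -dT tot_gprE tot_prE eq_sym (negPf ij).
Qed.

Definition to_hom n T (hT : homdeg n T) : hom_obj X Y n :=
  Sub (to_hom_fun T) (to_hom_subproof hT).

Lemma to_hom_eq n (f g : hom_obj X Y n) :
  (forall i j x, val f i j x = val g i j x) -> f = g.
Proof.
move=> fg; apply: val_inj; apply: functional_extensionality_dep => i.
by apply: functional_extensionality_dep => j; apply: funext => x.
Qed.

Lemma from_hom_lin n (f : hom_obj X Y n) :
  linear (fun x : tot X => (fun j => val f (j - n) j ((x : tot_car X) (j - n))) : tot Y).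
Proof.
move=> a x y; apply: functional_extensionality_dep => j; rewrite !gprodE.
exact: hom_linear.
Qed.
Definition from_hom n (f : hom_obj X Y n) : {linear tot X -> tot Y} :=
  mklin (from_hom_lin f).

Lemma from_homE n (f : hom_obj X Y n) (x : tot X) j :
  (from_hom f x : tot_car Y) j = val f (j - n) j ((x : tot_car X) (j - n)).
Proof. by []. Qed.

Lemma hom_obj0 n (f : hom_obj X Y n) i j : val f i j 0 = 0.
Proof. exact: (raddf0 (linear_fun (@hom_linear R X Y n f i j))). Qed.

Lemma from_hom_deg n (f : hom_obj X Y n) : homdeg n (from_hom f).
Proof.
split=> [a x y|i x]; first exact: linearP.
apply: functional_extensionality_dep => j.
rewrite !tot_gprE tot_prE !from_homE tot_prE.
have -> : (i == j - n) = (i + n == j) by lia.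
by case: eqP; rewrite ?hom_obj0.
Qed.

Lemma from_hom_single n (f : hom_obj X Y n) i j (x : X i) :
  (from_hom f (single x) : tot_car Y) j = val f i j x.
Proof.
rewrite from_homE; have [ij|ne] := eqVneq i (j - n).
  by rewrite -ij single_eq.
rewrite single_neq // hom_obj0 hom_shape //.
by apply: contra ne => /eqP->; rewrite addrK.
Qed.

Lemma to_homK n T (hT : homdeg n T) : from_hom (to_hom hT) = T :> (_ -> _).
Proof.
apply: funext => x; apply: functional_extensionality_dep => j.
rewrite from_homE /= /to_hom_fun.
by have := homdeg_coord (j - n) x hT; rewrite subrK.
Qed.

Lemma hom_diffE n (f : hom_obj X Y (n + 1)) (x : tot X) :
  from_hom (hom_diff n f) x =
  dd (from_hom f x) + sg R n *: from_hom f (dd x).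
Proof.
apply: functional_extensionality_dep => j.
rewrite -[RHS]/((dd (from_hom f x) : tot_car Y) j +
  sg R n *: (from_hom f (dd x) : tot_car Y) j).
rewrite !tot_gddE tot_ddE !from_homE tot_ddE /= /hom_diff_fun addrK eqxx.
rewrite -[sign R (n + 1)]/(sg R (n + 1)) sgD1 scaleNr opprK.
have -> : j + 1 - (n + 1) = j - n by lia.
have -> : j - (n + 1) = j - n - 1 by lia.
by rewrite subrK.
Qed.

Lemma cyc_from_hom n (f : hom_obj X Y n) :
  cyc n (from_hom f) <-> hom_diff (n - 1) f = 0.
Proof.
have key (x : tot X) : from_hom (hom_diff (n - 1) f) x =
    dd (from_hom f x) - sg R n *: from_hom f (dd x).
  have [k nE] : exists k, n = k + 1 by exists (n - 1); rewrite subrK.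
  by subst n; rewrite addrK hom_diffE sgD1 scaleNr opprK.
split=> [[_ cf]|f0].
  apply: to_hom_eq => i j x; rewrite -from_hom_single key cf subrr.
  by [].
split=> [|x]; first exact: from_hom_deg.
apply/eqP; rewrite -subr_eq0 -key f0; apply/eqP.
by apply: functional_extensionality_dep => j.
Qed.

Lemma bnd_from_hom n (f : hom_obj X Y n) :
  bnd n (from_hom f) <-> exists g : hom_obj X Y (n + 1), hom_diff n g = f.
Proof.
split=> [[S hS SE]|[g <-]]; last first.
  by exists (from_hom g); [exact: from_hom_deg|exact: hom_diffE].
have [S' ?] := homdeg_lin hS; subst S; exists (to_hom hS).
apply: to_hom_eq => i j x; rewrite -!from_hom_single hom_diffE to_homK.
by rewrite SE.
Qed.

Notation H n := (homology (hom_complex X Y) n).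

Lemma hom_cycle n (T : tot X -> tot Y) : cyc n T ->
  exists z : cycles (hom_complex X Y) n, from_hom (val z : hom_obj X Y n) = T :> (_ -> _).
Proof.
move=> cT; have [T' ?] := cyc_lin cT; subst T; have hT := cT.1.
have dz : diff (hom_complex X Y) n (n - 1) (to_hom hT) = 0.
  by apply/cyc_from_hom; rewrite to_homK.
by exists (cycle_of dz); rewrite /= to_homK.
Qed.

Lemma cycle_hom n (z : cycles (hom_complex X Y) n) :
  cyc n (from_hom (val z : hom_obj X Y n)).
Proof.
by apply/cyc_from_hom; exact: (eqP (valP z)).
Qed.

Lemma hom_homology_eq0 n (z : cycles (hom_complex X Y) n) :
  \pi_(H n) z = 0 <-> bnd n (from_hom (val z : hom_obj X Y n)).
Proof. exact: (iff_trans (homology_eq0 z) (iff_sym (bnd_from_hom _))). Qed.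

Lemma null_homology n : zero_module (H n) <-> null (tot X) (tot Y) n.
Proof.
split=> [H0 T cT|nT h].
  have [z zE] := hom_cycle cT; rewrite -zE; apply/hom_homology_eq0; exact: H0.
have [z <-] := qpi_surj h; apply/hom_homology_eq0/nT; exact: cycle_hom.
Qed.
End HomTotal.
End Total.

Section Translate.
Variable R : comNzRingType.
Implicit Types (K X Y : gmod R).

Lemma single0 (X : complex R) i : single (0 : X i) = 0.
Proof. exact: (raddf0 (mklin (@single_lin R int (cobj X) i))). Qed.

Lemma singleB (X : complex R) i (u v : X i) : single (u - v) = single u - single v.
Proof. exact: (raddfB (mklin (@single_lin R int (cobj X) i))). Qed.

(** Any two classes are dependent with a coefficient outside of [m]; over the
    residue field this means that the cohomology is at most one-dimensional.
    Unlike an isomorphism with [k], this passes between quasi-isomorphic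
    complexes and along connecting maps with no choice of isomorphism. *)
Definition thin (m : {pred R^o}) K Y n : Prop :=
  forall T1 T2 : K -> Y, cyc n T1 -> cyc n T2 ->
  exists a1 a2 : R, (a1 \notin m) || (a2 \notin m) /\ bnd n (a1 *: T1 + a2 *: T2).

Lemma null_retract K Y Y' n (u : {linear Y -> Y'}) (v : {linear Y' -> Y}) :
  chmap u -> chmap v -> (forall y, u (v y) = y) -> null K Y n -> null K Y' n.
Proof.
move=> hu hv uv nY T cT; have := comp_bnd hu (nY _ (comp_cyc hv cT)).
by congr bnd; apply: funext => x /=; rewrite uv.
Qed.

Section Stalk.
Variable M : lmodType R.

Definition stalk_unpack : {linear tot (stalk M) -> stg M} :=
  mklin (fun a (x y : tot (stalk M)) =>
    erefl : _ = a *: (x : tot_car (stalk M)) 0 + (y : tot_car (stalk M)) 0).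

Definition stalk_pack_fun (x : M) : tot (stalk M) := @single R int (cobj (stalk M)) 0 x.
Lemma stalk_pack_lin : linear stalk_pack_fun.
Proof. by move=> a x y; exact: (@single_lin R int (cobj (stalk M)) 0 a x y). Qed.
Definition stalk_pack : {linear stg M -> tot (stalk M)} := mklin stalk_pack_lin.

Lemma stalk_packK x : stalk_unpack (stalk_pack x) = x.
Proof. exact: (@single_eq R int (cobj (stalk M)) 0 x). Qed.

Lemma stalk_term0 (i : int) (v : stalk M i) : i != 0 -> v = 0.
Proof.
rewrite -[stalk M i]/(stalk_obj M i) in v * => /negPf i0.
move: v; rewrite /stalk_obj i0 => v; exact: thinmx0.
Qed.

Lemma stalk_unpack_chmap : chmap stalk_unpack.
Proof.
split=> [i x|x]; rewrite ?stg_prE ?stg_ddE; last first.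
  by rewrite -[RHS]/(tot_dd (stalk M) x 0) tot_ddE.
rewrite -[RHS]/(tot_pr (stalk M) i x 0) tot_prE.
by case: eqP.
Qed.

Lemma stalk_unpackK x : stalk_pack (stalk_unpack x) = x.
Proof.
apply: functional_extensionality_dep => i.
have [<-|ne] := eqVneq 0 i; first exact: single_eq.
rewrite -[LHS]/(@single R int (cobj (stalk M)) 0 _ i) single_neq //.
by apply/esym/stalk_term0; rewrite eq_sym.
Qed.

Lemma stalk_pack_chmap : chmap stalk_pack.
Proof.
split=> [i x|x]; rewrite -[in LHS](stalk_packK x).
  by rewrite stalk_unpackK -{1}(stalk_unpackK (pr i _)) -stalk_unpack_chmap.1 stalk_packK.
by rewrite stalk_unpackK -{1}(stalk_unpackK (dd _)) -stalk_unpack_chmap.2 stalk_packK.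
Qed.

Lemma resolution_resolves (F : proj_resolution (stalk M)) :
  exists e : {linear tot F -> M}, resolves e.
Proof.
exists (stalk_unpack \o totm (res_map F)); split.
- exact: (tot_semifree (res_bounded_below F) (@res_projective _ _ F)).
- have [h1 h2] := totm_chmap (res_map F); have [g1 g2] := stalk_unpack_chmap.
  by split=> [i x|x]; [rewrite g1 h1|rewrite g2 h2].
have [q1 q2] := totm_qiso (@res_quasi_iso _ _ F).
split=> [x dx [y]|y dy].
  rewrite stg_ddE => xE; apply: q1 => //; exists 0; rewrite raddf0.
  by rewrite -[LHS]stalk_unpackK -[stalk_unpack _]/((stalk_unpack \o totm (res_map F)) x) xE raddf0.
have [|x [z [dx xE]]] := q2 (stalk_pack y).
  by rewrite stalk_pack_chmap.2 dy raddf0.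
exists x, (stalk_unpack z); split=> //.
rewrite stalk_unpack_chmap.2 -xE [stalk_unpack (_ - _)]raddfB; congr (_ - _).
exact/esym/stalk_packK.
Qed.
End Stalk.

Lemma Ext_zero_null (M N : complex R) i : Ext_zero M N i ->
  exists F : proj_resolution M, null (tot F) (tot N) (- i).
Proof. by move=> [F F0]; exists F; apply/null_homology. Qed.

Lemma residue_dependent (m : submodClosed R^o) (x y : residue_field m) :
  (1 : R) \notin m ->
  exists a1 a2 : R, (a1 \notin m) || (a2 \notin m) /\ a1 *: x + a2 *: y = 0.
Proof.
move=> m1; have [a <-] := qpi_surj x; have [b <-] := qpi_surj y.
have [am|am] := boolP (a \in m).
  exists 1, 0; rewrite m1; split=> //; rewrite scale0r addr0 scale1r.
  exact/qpi_eq0.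
exists b, (- a); split.
  apply/orP; right; apply/negP => Na; move/negP: am; apply.
  by have := mem_mulm (-1) Na; rewrite mulrNN mul1r.
rewrite -!linearZ_LR -raddfD /= scaleNr -[b *: a]/(b * a) -[a *: b]/(a * b).
by rewrite [b * a]mulrC subrr raddf0.
Qed.

Lemma Ext_iso_thin (m : submodClosed R^o) (M N : complex R) i :
  (1 : R) \notin m -> Ext_iso M N i (residue_field m) ->
  exists F : proj_resolution M,
    thin m (tot F) (tot N) (- i) /\ ~ null (tot F) (tot N) (- i).
Proof.
move=> m1 [F [f [g fK gK]]]; exists F; split; last first.
  move/null_homology => H0; move/negP: m1; apply; apply/(qpi_eq0 m 1).
  by rewrite -[LHS]gK (H0 (g _)) raddf0.
move=> T1 T2 cT1 cT2.
have [z1 z1E] := hom_cycle cT1; have [z2 z2E] := hom_cycle cT2.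
set pi := qpi (boundaries (X := hom_complex F N) (n := - i)).
have [a1 [a2 [a12 aE]]] := residue_dependent (f (pi z1)) (f (pi z2)) m1.
exists a1, a2; split=> //.
have := proj1 (hom_homology_eq0 (a1 *: z1 + a2 *: z2)).
rewrite -z1E -z2E; move=> H; have {}H := H _; suff : pi (a1 *: z1 + a2 *: z2) = 0.
  by move/H; congr bnd; apply: funext => x.
by apply: (can_inj fK); rewrite linearP linearZ_LR [in LHS]linearP linearZ_LR aE raddf0.
Qed.

Lemma tot_homology0 (D : complex R) n : zero_module (homology D n) <->
  forall y : tot D, pr n y = y -> dd y = 0 -> exists z, y = dd z.
Proof.
split=> [H0 y yn dy|H0 h].
  have [|z zE] := proj1 (homology_eq0 (cycle_of (tot_cycle n dy))); first exact: H0.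
  by exists (single z); rewrite dd_single addrK zE /= -single_pr yn.
have [z <-] := qpi_surj h; apply/homology_eq0.
have dz : diff D n (n - 1) (val z) = 0 := eqP (valP z).
have [||w wE] := H0 (single (val z)); first exact: pr_single.
  by rewrite dd_single dz single0.
exists ((w : tot_car D) (n + 1)).
by have := congr1 (fun u : tot_car D => u n) wE; rewrite single_eq tot_gddE tot_ddE.
Qed.

Definition fg_homology Y n : Prop :=
  exists s : seq Y, (forall y, y \in s -> pr n y = y /\ dd y = 0) /\
    forall y : Y, pr n y = y -> dd y = 0 -> exists b z, in_span s b /\ y - b = dd z.

Lemma tot_homology_fg (D : complex R) n : fin_gen (homology D n) -> fg_homology (tot D) n.
Proof.
move=> [s sP].
have lsv : linear (fun z : cycles D n => single (val z)).
  by move=> a x y; rewrite -single_lin.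
have [zs zsE] : exists zs : seq (cycles D n),
    s = [seq qpi (boundaries (X := D) (n := n)) z | z <- zs].
  exists [seq repr h | h <- s]; rewrite -map_comp -[LHS]map_id.
  by apply: eq_map => h /=; rewrite mklinE reprK.
exists [seq mklin lsv z | z <- zs]; split=> [y /mapP[z _ ->]|y yn dy].
  split; first exact: pr_single.
  by rewrite mklinE dd_single (eqP (valP z)) single0.
have := sP (qpi _ (cycle_of (tot_cycle n dy))); rewrite zsE.
case/in_span_map_inv => z' z's /qpi_eq/asboolP[w wE].
exists (mklin lsv z'), (- single w); split; first exact: in_span_map.
rewrite raddfN /= dd_single addrK wE mklinE.
rewrite -[val (_ - _)]/(val z' - (y : tot_car D) n) singleB opprB.
by rewrite -single_pr yn.
Qed.
End Translate.

(** * Vanishing of Ext by noetherian induction on ideals *)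
Section Devissage.
Variables (R : comNzRingType) (m : submodClosed R^o).
Hypothesis locR : local_ring m.
Let noethR := local_noeth locR.

Lemma quo_fin_gen (J : R^o -> Prop) (sJ : submodP J) : fin_gen (quo sJ).
Proof.
exists [:: qp sJ 1] => y; have [r <-] := qp_surj y; apply/in_span_cons.
exists r, 0; rewrite addr0 -linearZ_LR; split; first exact/in_span_nil.
by rewrite -[r *: _]/(r * 1) mulr1.
Qed.

Lemma quo_resolution (J : R^o -> Prop) (sJ : submodP J) :
  exists (K : gmod R) (e : {linear K -> quo sJ}), resolves e /\ fg_terms K.
Proof. exact: (free_resolution noethR (quo_fin_gen sJ)). Qed.

(** The step of the inductions: [R / J] is an extension of [R / (J + x R)] by
    [R / (J : x)], and the cone of a lift of multiplication by [x] resolves the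
    quotient. *)
Lemma colon_cone (J : R^o -> Prop) (x : R) (sJ : submodP J)
    (sc : submodP (colon x J)) (sa : submodP (adj x J))
    (F K : gmod R) (eF : {linear F -> quo sc}) (e : {linear K -> quo sJ}) :
  resolves eF -> resolves e ->
  exists (a : {linear F -> K}) (ha : chmap a) (ea : {linear cone ha -> quo sa})
      (g : {linear quo sJ -> quo sa}),
    [/\ resolves ea, forall k, ea (k, 0) = g (e k) & forall r, g (qp sJ r) = qp sa r].
Proof.
move=> rF rK; have [f [g [fg fE gE]]] := colon_exact sJ sc sa.
have [a ca] := covers_ex rF rK f.
have [ea [rea eaE]] := cone_resolves fg rF rK ca ca.1.
by exists a, ca.1, ea, g.
Qed.

Lemma regular_cone (V : lmodType R) (B : V -> Prop) (x : R) (sB : submodP B)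
    (sa : submodP (adj x B)) (K : gmod R) (e : {linear K -> quo sB}) :
  (forall v, B (x *: v) -> B v) -> resolves e ->
  exists ea : {linear cone (covers_scl e x).1 -> quo sa}, resolves ea.
Proof.
move=> regx rK; have [g [fg _]] := regular_exact sB sa regx.
by have [ea [rea _]] := cone_resolves fg rK rK (covers_scl e x) (covers_scl e x).1;
   exists ea.
Qed.

Variables (I0 : R^o -> Prop) (Y : gmod R).
Hypothesis I0_m3 : cube_in m I0.
Variables (K0 : gmod R) (e0 : {linear K0 -> residue_field m}).
Hypothesis res0 : resolves e0.

Lemma resolves_zero_exact (K : gmod R) (M : lmodType R) (e : {linear K -> M}) :
  resolves e -> (forall x : M, x = 0) -> exact K.
Proof.
move=> [_ _ [i _]] M0 x dx; apply: i => //; exists 0; rewrite raddf0; exact: M0.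
Qed.

(** The identity of an exact semifree complex is null-homotopic. *)
Lemma null_exact_source (K : gmod R) n : semifree K -> exact K -> null K Y n.
Proof.
move=> sK eK T cT.
have b0 : bnd 0 (fun x : K => x).
  by apply: (null_of_exact sK eK); apply/(chmap_cyc idfun).
exact: (cyc_comp_bnd cT b0).
Qed.

Lemma residue_iso (J : R^o -> Prop) (sJ : submodP J) : (forall r, J r <-> r \in m) ->
  exists (f : {linear residue_field m -> quo sJ}) (g : {linear quo sJ -> residue_field m}),
  [/\ (forall y, f (g y) = y), (forall r, f (qpi m r) = qp sJ r) &
      (forall r, g (qp sJ r) = qpi m r)].
Proof.
move=> Jm; have [|f fE] := @quotient_lift R _ _ m (qp sJ).
  by move=> r rm; apply/qp_eq0/Jm.
have [|g gE] := @quo_lift R _ J sJ _ (qpi m).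
  by move=> r /Jm rm; apply/qpi_eq0.
exists f, g; split=> // y; have [r <-] := qp_surj y.
by rewrite gE fE.
Qed.

(** One of [x] and [x * x] is killed by [x] modulo [J] without lying in [J]. *)
Lemma colon_strict (J : R^o -> Prop) (x : R) : (forall r, I0 r -> J r) ->
  x \in m -> ~ J x -> exists2 r, colon x J r & ~ J r.
Proof.
move=> IJ xm nx; have [Jx|nJx] := pselect (J (x * x)); first by exists x.
by exists (x * x) => //; apply: IJ; rewrite -[x *: _]/(x * (x * x)) mulrA; apply: I0_m3.
Qed.

Lemma ideal_cases (J : R^o -> Prop) : submodP J -> (forall r, I0 r -> J r) ->
  [\/ J 1, (forall r, J r <-> r \in m) |
      (forall r, J r -> r \in m) /\ exists2 x : R, x \in m & ~ J x].
Proof.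
move=> sJ IJ; have [J1|nJ1] := pselect (J 1); first by constructor 1.
have Jm := ideal_sub_max locR sJ nJ1.
have [mJ|nmJ] := pselect (forall r, r \in m -> J r).
  by constructor 2 => r; split=> [/Jm|/mJ].
constructor 3; split=> //; apply: contrapT => nx; apply: nmJ => r rm.
by apply: contrapT => nr; apply: nx; exists r.
Qed.

(** As [R / J] has finite length when [J] contains the cube of [m], it is built
    from copies of the residue field.  The noetherian induction takes [x] in [m]
    outside of [J]: both [(J : x)] and [J + x R] are larger than [J]. *)
Lemma devissage n : null K0 Y n ->
  forall J, submodP J -> (forall r, I0 r -> J r) ->
  forall (sJ : submodP J) (K : gmod R) (e : {linear K -> quo sJ}),
  resolves e -> null K Y n.
Proof.
move=> n0; apply: (ideal_ind noethR) => J _ IH IJ sJ K e rK.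
case: (ideal_cases sJ IJ) => [J1|Jm|[Jm [x xm nx]]].
- apply: null_exact_source; first by case: rK.
  apply: (resolves_zero_exact rK) => y; have [r <-] := qp_surj y; apply/qp_eq0.
  by have := submodPZ sJ r J1; rewrite -[r *: _]/(r * 1) mulr1.
- have [f [g [fg _ _]]] := residue_iso sJ Jm.
  exact: (null_iso (f := f) (g := g) res0 rK).
have sc := colon_sub x sJ; have sa := adj_sub x sJ.
have [F [eF [rF _]]] := quo_resolution sc.
have [a [ha [ea [g [rea _ _]]]]] := colon_cone sa rF rK.
apply: (@null_cone_mid R F K Y a ha).
  apply: (IH _ sc _ _ _ sc F eF rF) => [r Jr||r Ir].
  - exact: (submodPZ sJ).
  - exact: colon_strict.
  - by apply: (submodPZ sJ); apply: IJ.
apply: (IH _ sa _ _ _ sa (cone ha) ea rea) => [r Jr||r Ir].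
- exact: adj_mem.
- by exists x => //; exact: adj_self.
- by apply: adj_mem; apply: IJ.
Qed.

(** Classes on the residue field inject into those on [R / J].  By induction this
    holds for [J + x R], and the kernel of the restriction from [R / (J + x R)] to
    [R / J] comes from [Ext] of [R / (J : x)] in a degree where it vanishes. *)
Lemma projection_inj n : null K0 Y (n + 1) ->
  forall J, submodP J -> (forall r, I0 r -> J r) -> ~ J 1 ->
  forall (sJ : submodP J) (K : gmod R) (e : {linear K -> quo sJ}), resolves e ->
  forall (p : {linear quo sJ -> residue_field m}) (b : {linear K -> K0}),
  (forall r, p (qp sJ r) = qpi m r) -> covers e e0 p b ->
  forall T : K0 -> Y, cyc n T -> bnd n (T \o b) -> bnd n T.
Proof.
move=> n1; apply: (ideal_ind noethR) => J _ IH IJ J1 sJ K e rK p b pE cb T cT bT.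
case: (ideal_cases sJ IJ) => [//|Jm|[Jm [x xm nx]]].
  have [f [g [fg fE gE]]] := residue_iso sJ Jm.
  have [c cc] := covers_ex res0 rK f.
  have cbc : covers e0 e0 idfun (b \o c).
    have [_ h0 _] := res0; have [h hE] := covers_comp h0 cc cb; split=> //.
    move: hE; congr bnd; apply: funext => z /=; congr (_ - _).
    by have [r <-] := qpi_surj (e0 z); rewrite fE pE.
  have h1 := cyc_homotopic cT (covers_uniq res0 res0 (covers_id e0) cbc).
  have h2 := bnd_comp cc.1 bT.
  have := submodPD (bnd_sub _ _ n) h1 h2; congr bnd; apply: funext => z /=.
  exact: subrK.
have sc := colon_sub x sJ; have sa := adj_sub x sJ.
have [F [eF [rF _]]] := quo_resolution sc.
have [a [ha [ea [g [rea eaE gE]]]]] := colon_cone sa rF rK.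
have Ja r : J r -> adj x J r by exact: adj_mem.
have a1 : ~ adj x J 1.
  move=> [u [j [/Jm jm xE]]]; have := one_notin locR.
  rewrite xE -[x *: u]/(x * u) mulrC.
  by move/negP; apply; apply: rpredD => //; apply: mem_mulm.
have [|q qE] := @quo_lift R _ _ sa _ (qpi m).
  by move=> r ar; apply/qpi_eq0; apply: (ideal_sub_max locR sa a1).
have [c cc] := covers_ex rea res0 q.
apply: (IH _ sa _ _ _ a1 sa (cone ha) ea rea q c qE cc T cT) => [//||r /IJ/Ja//|].
  by exists x => //; exact: adj_self.
apply: null_cone_inj; last first.
- have h : covers e ea g (cone_inl ha).
    split; first exact: cone_inl_chmap.
    have := submodP0 (bnd_sub K (stg (quo sa)) 0); congr bnd.
    by apply: funext => k; rewrite -[cone_inl ha k]/(k, 0) eaE subrr.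
  have [_ hK _] := rK.
  have ci : covers e e0 p (c \o cone_inl ha).
    have [h1 h2] := covers_comp hK h cc; split=> //; move: h2; congr bnd.
    apply: funext => k /=; congr (_ - _).
    by have [r <-] := qp_surj (e k); rewrite gE qE pE.
  have h1 := cyc_homotopic cT (covers_uniq rK res0 ci cb).
  have := submodPD (bnd_sub _ _ n) h1 bT; congr bnd; apply: funext => k /=.
  exact: subrK.
- exact: cyc_comp cc.1 cT.
apply: (devissage n1 (J := colon x J) sc _ (sJ := sc) rF) => r Ir.
by apply: (submodPZ sJ); apply: IJ.
Qed.
End Devissage.

(** * Killing a regular sequence *)
Section Koszul.
Variables (R : comNzRingType) (m : submodClosed R^o).
Hypothesis locR : local_ring m.
Let noethR := local_noeth locR.

(** The previous finiteness result in [V / B]. *)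
Lemma fg_submodule_mod (V : lmodType R) (B S : V -> Prop) (s : seq V) :
  submodP B -> submodP S -> (forall x, S x -> exists2 y, in_span s y & B (x - y)) ->
  exists t : seq V, (forall x, x \in t -> S x) /\
    forall x, S x -> exists2 y, in_span t y & B (x - y).
Proof.
move=> sB sS Ss; have sT := submodP_im (qp sB) sS.
have [|t tP] := fg_submodule noethR (s := [seq qp sB y | y <- s]) sT.
  by move=> _ [x /Ss[y sy /(qp_eq sB)->] <-]; exact: in_span_map.
have [us [usS usE]] := lift_seq (f := qp sB) (fun x xt => proj2 (tP x) (in_span_gen xt)).
exists us; split=> // x Sx.
have /tP : exists2 x', S x' & qp sB x' = qp sB x by exists x.
by rewrite -usE => /in_span_map_inv[y uy /esym/qp_eq Bxy]; exists y.
Qed.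

Section Cocycles.
Variables (K Y : gmod R) (n : int).

Definition cocycles : lmodType R := submodule (psub (cyc_sub K Y n)).

Definition cocycle (T : K -> Y) (cT : cyc n T) : cocycles.
Proof. by exists T; apply/psubE. Defined.

Definition cobound (z : cocycles) : Prop := bnd n (val z).

Lemma cocycleP (z : cocycles) : cyc n (val z).
Proof. by have := valP z; move/psubE. Qed.

Lemma cobound_sub : submodP cobound.
Proof.
split; first exact: (submodP0 (bnd_sub K Y n)).
by move=> a x y Bx By; exact: (proj2 (bnd_sub K Y n) a _ _ Bx By).
Qed.
End Cocycles.

Definition fg_cohomology (K Y : gmod R) : Prop := forall n,
  exists s : seq (K -> Y), (forall T, T \in s -> cyc n T) /\
    forall T, cyc n T -> exists2 b, in_span s b & bnd n (T - b).

(** The middle term of an exact sequence with finitely generated ends is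
    finitely generated. *)
Lemma fg_cohomology_cone (F K Y : gmod R) (a : {linear F -> K}) (ha : chmap a) :
  fg_cohomology F Y -> fg_cohomology K Y -> fg_cohomology (cone ha) Y.
Proof.
move=> fF fK n; have [s [sc sP]] := fK n; have [s' [sc' sP']] := fF (n + 1).
pose res (U : cone ha -> Y) : K -> Y := fun k => U (k, 0).
have lres : linear res by [].
pose top (t : F -> Y) : cone ha -> Y := fun p => t p.2.
have ltop : linear top by [].
pose S T := exists2 U, cyc n U & res U = T.
have sS : submodP S by exact: (submodP_im (mklin lres) (cyc_sub (cone ha) Y n)).
have ScS T : S T -> cyc n T.
  by move=> [U cU <-]; exact: (cyc_comp (cone_inl_chmap ha) cU).
have [t [tS tP]] := fg_submodule_mod (bnd_sub K Y n) sS (fun T ST => sP T (ScS T ST)).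
have [us [usc usE]] := lift_seq (f := res) tS.
exists (us ++ [seq top T | T <- s']); split=> [U|U cU].
  by rewrite mem_cat => /orP[/usc//|/mapP[T Ts ->]]; apply/cone_top_cyc/sc'.
have [b tb bb] := tP (res U) (ex_intro2 _ _ U cU erefl).
move: tb; rewrite -usE => /(in_span_map_inv (f := mklin lres))[u usu ub].
have cu : cyc n u by apply: (in_span_min (cyc_sub _ _ n) usc usu).
have [|T cT bT] := cone_split (submodPB (cyc_sub _ _ n) cU cu).
  by move: bb; rewrite -ub.
have [b' sb' bb'] := sP' T cT.
exists (u + top b').
  by apply/in_span_cat; exists u, (top b'); split=> //; exact: (in_span_map (mklin ltop) sb').
have /(cone_top_bnd ha) [_ h] : cyc (n + 1) (T - b').
  apply: (submodPB (cyc_sub _ _ _) cT).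
  exact: (in_span_min (cyc_sub _ _ _) sc' sb').
have {h} h2 : bnd n (fun p : cone ha => (T - b') p.2).
  apply: h; exists (fun _ => 0); first exact: submodP0 (cyc_sub _ _ _).
  by move: bb'; congr bnd; apply: funext => x; rewrite subr0.
have := submodPD (bnd_sub _ _ n) bT h2; congr bnd; apply: funext => p.
rewrite -[LHS]/(U p - u p - T p.2 + (T p.2 - b' p.2)) addrA subrK.
by rewrite -[RHS]/(U p - (u p + b' p.2)) opprD addrA.
Qed.

(** If the cohomology of the cone of [x : K -> K] vanishes, multiplication by [x]
    is onto on that of [K], which vanishes by Nakayama's lemma. *)
Lemma nakayama_cone (K Y : gmod R) (x : R) (hx : chmap (scl K x)) n : x \in m ->
  fg_cohomology K Y -> null (cone hx) Y (n - 1) -> null K Y n.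
Proof.
move=> xm fgK nC; have [s [sc sP]] := fgK n.
suff sb : forall T, in_span s T -> bnd n T.
  move=> T /sP[b /sb bb bT]; rewrite -(subrK b T).
  exact: (submodPD (bnd_sub _ _ n)).
apply: (nakayama locR (bnd_sub K Y n)) => T Ts.
have cT := sc T Ts.
have := @cone_top_bnd R K K Y _ hx (n - 1) T; rewrite subrK => /(_ cT)[+ _].
case=> [|u cu bu]; first by apply: nC; apply/cone_top_cyc; rewrite subrK.
have [b [c bE] bb] := sP u cu.
exists ((fun k => T k - u (scl K x k)) + x *: (u - b)), (x *: b); split.
- apply: (submodPD (bnd_sub _ _ n) bu); exact: (submodPZ (bnd_sub _ _ n)).
- exists (fun i => x * c i); split=> [i|]; first by rewrite mulrC; apply: mem_mulm.
  by rewrite bE scaler_sumr; apply: eq_bigr => i _; rewrite scalerA.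
have [u' ?] := cyc_lin cu; subst u.
apply: funext => k; rewrite -[RHS]/(T k - u' (x *: k) + x *: (u' k - b k) + x *: b k).
by rewrite linearZ_LR scalerBr addrA subrK subrK.
Qed.

Variable Y : gmod R.

(** Let [f] be regular on [R / J], resolved by [K].  If the cohomology of
    [R / (J + f R)] with values in [Y] lives in one degree [M], that of [R / J]
    lives in the degree [M + size f] only, by [nakayama_cone] for one element of
    [f] after the other.  The long exact sequence of each cone then reduces to
    [0 -> H --x--> H -> H' -> 0]: so [f] is regular on the module [H] of classes
    on [K], and the classes on the last resolution [L] form [H / f H].  The map
    [t] is this last identification, on cocycles. *)
Lemma koszul (M : int) (f : seq R) : (forall x, x \in f -> x \in m) ->
  forall (J : R^o -> Prop) (sJ : submodP J) (K : gmod R) (e : {linear K -> quo sJ}) N,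
  N = M + (size f)%:Z ->
  resolves e -> mreg f J -> fg_cohomology K Y ->
  (forall (sL : submodP (adjs f J)) (L : gmod R) (e' : {linear L -> quo sL}),
     resolves e' -> forall n, n != M -> null L Y n) ->
  [/\ forall n, n != N -> null K Y n,
      mreg f (@cobound K Y N) &
      exists (L : gmod R) (sL : submodP (adjs f J)) (e' : {linear L -> quo sL})
        (t : {linear cocycles K Y N -> cocycles L Y M}),
      [/\ resolves e', forall w, exists v, cobound (w - t v) &
          forall v, cobound (t v) <-> adjs f (@cobound K Y N) v]].
Proof.
elim: f => [|x f IH] fm J sJ K e N.
  rewrite addr0 => -> rK _ _ nL; split=> //; first exact: nL rK.
  exists K, sJ, e, idfun; split=> // w; exists w.
  by rewrite subrr; exact: submodP0 (@cobound_sub _ _ _).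
rewrite /= => NE rK [regx regf] fgK nL.
pose N' := M + (size f)%:Z; have {NE} NE : N = N' + 1 by rewrite NE /N'; lia.
subst N; have sa := adj_sub x sJ; have xm : x \in m by apply: fm; rewrite mem_head.
have [ea rea] := regular_cone sa regx rK.
set ha := (covers_scl e x).1 in ea rea.
have [|nC mC [L [sL [e' [t [re' ts tE]]]]]] :=
  IH (fun y yf => fm y (mem_behead (s := x :: f) yf)) _ sa _ ea N' erefl rea regf
     (fg_cohomology_cone ha fgK fgK).
  by move=> sL; apply: nL.
have nK n : n != N' + 1 -> null K Y n.
  move=> nN; apply: (nakayama_cone (hx := ha)) => //; apply: nC.
  by apply: contra nN => /eqP<-; rewrite subrK.
have nN' : null K Y N' by apply: nK; lia.
have nCN : null (cone ha) Y (N' + 1) by apply: nC; lia.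
pose t1f (z : cocycles K Y (N' + 1)) : cocycles (cone ha) Y N' :=
  cocycle (proj1 (cone_top_cyc ha N' (val z)) (cocycleP z)).
have lt1 : linear t1f by move=> a z w; apply: val_inj.
pose t1 := mklin lt1.
have t1E z : cobound (t1 z) <-> adj x (@cobound K Y (N' + 1)) z.
  split=> [/(cone_top_bnd ha (cocycleP z))[u cu bu]|[u [b [bb ->]]]].
    exists (cocycle cu), (z - x *: cocycle cu); rewrite [_ + (z - _)]addrC subrK.
    split=> //; move: bu; congr bnd; apply: funext => k.
    have [u' ?] := cyc_lin cu; subst u.
    by rewrite sclE linearZ_LR.
  apply/(cone_top_bnd ha (cocycleP _)); exists (val u); first exact: cocycleP.
  move: bb; congr bnd; apply: funext => k.
  rewrite -[RHS]/(x *: val u k + val b k - val u (x *: k)).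
  have [u' uE] := cyc_lin (cocycleP u); rewrite uE linearZ_LR.
  by rewrite [_ + val b k]addrC addrK.
have t1s w : exists v, cobound (w - t1 v).
  have [T cT bT] := cone_split (cocycleP w)
    (nN' _ (cyc_comp (cone_inl_chmap ha) (cocycleP w))).
  by exists (cocycle cT).
have t1B : (fun z => cobound (t1 z)) = adj x (@cobound K Y (N' + 1)).
  by apply: funext => z; apply/propext/t1E.
split=> //.
  split=> [v bv|]; last by rewrite -t1B; apply: mreg_transport => //; exact: cobound_sub.
  have [|U cU UE] := @cone_extend R K K Y _ ha (N' + 1) (val v) (cocycleP v).
    move: bv; congr bnd; apply: funext => k.
    have [v' vE] := cyc_lin (cocycleP v).
    by rewrite -[LHS]/(x *: val v k) -[RHS]/(val v (x *: k)) vE linearZ_LR.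
  have := bnd_comp (cone_inl_chmap ha) (nCN U cU); congr bnd.
  by apply: funext => k; exact: UE.
exists L, sL, e', (t \o t1); split=> // [w|v].
  have [v1 bv1] := ts w; have [v bv] := t1s v1; exists v => /=.
  have bt : cobound (t (v1 - t1 v)) by apply/tE/adjs_mem.
  rewrite -(subrK (t v1) w) -addrA -raddfB.
  exact: (submodPD (@cobound_sub _ _ _)).
rewrite /= tE -t1B.
rewrite (adjs_transport (t := t1) f (B := @cobound (cone ha) Y N')) //.
exact: cobound_sub.
Qed.
End Koszul.

(** * The ring as a complex, and faithfulness *)
Section Prelim.
Variable R : comNzRingType.

Definition zero_sub (V : lmodType R) : V -> Prop := fun v => v = 0.

Lemma zero_subP (V : lmodType R) : submodP (@zero_sub V).
Proof. by split=> // a x y -> ->; rewrite /zero_sub scaler0 addr0. Qed.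

Lemma adjs_span (f : seq R^o) (J : R^o -> Prop) (r : R^o) :
  adjs f J r <-> exists j s, [/\ J j, in_span f s & r = j + s].
Proof.
elim: f J r => [|x f IH] J r /=.
  split=> [Jr|[j [s [Jj /in_span_nil-> ->]]]]; last by rewrite addr0.
  by exists r, 0; rewrite addr0; split=> //; apply/in_span_nil.
rewrite IH; split=> [[_ [s [[u [b [Jb ->]]] fs ->]]]|[j [s [Jj]]]].
  exists b, (x *: u + s); split=> //; last by rewrite addrAC addrC.
  by apply/in_span_cons; exists u, s; rewrite -[x *: u]/(x * u) mulrC.
move=> /in_span_cons[u [s' [fs' ->]] ->]; exists (j + u *: x), s'.
rewrite addrA; split=> //; exists u, j; split=> //.
by rewrite addrC -[x *: (u : R^o)]/(x * u) mulrC.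
Qed.

Lemma adjs0_span (f : seq R^o) (r : R^o) : adjs f (@zero_sub R^o) r <-> in_span f r.
Proof.
rewrite adjs_span; split=> [[j [s [-> fs ->]]]|fr]; first by rewrite add0r.
by exists 0, r; rewrite add0r.
Qed.

Lemma regular_mreg (f : seq R^o) : regular_sequence f -> mreg f (@zero_sub R^o).
Proof.
move=> [_ reg]; suff H (J : R^o -> Prop) (g : seq R^o) :
    (forall i, (i < size g)%N -> forall x : R^o,
       adjs (take i g) J (g`_i * x) -> adjs (take i g) J x) -> mreg g J.
  by apply: H => i fi x /adjs0_span/(reg i fi)/adjs0_span.
elim: g J => //= x g IH J H; split.
  by move=> v; have := H 0%N (ltn0Sn _) v.
by apply: IH => i gi v; exact: (H i.+1 gi v).
Qed.

Lemma stg_semifree : semifree (stg (R^o : lmodType R)).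
Proof.
split=> [|i A B g f fP].
  by exists 0 => i i0 x; rewrite stg_prE lt_eqF.
have [i0|ni] := eqVneq i 0; last first.
  exists (\0); split=> // x; rewrite stg_prE (negPf ni) !raddf0 //.
have [a aE] := fP 1.
exists (scale_at a); split=> x; rewrite !scale_atE stg_prE i0 eqxx //.
rewrite linearZ_LR aE stg_prE i0 eqxx -linearZ_LR.
by rewrite -[x *: _]/(x * 1) mulr1.
Qed.

Lemma stg_resolves : resolves (qp (zero_subP R^o) : {linear stg R^o -> _}).
Proof.
split; [exact: stg_semifree|exact: stg_chmap|split].
  by move=> x _ [y]; rewrite stg_ddE => /qp_eq0->; exists 0.
by move=> y _; have [v <-] := qp_surj y; exists v, 0; rewrite subrr.
Qed.

Lemma resolves_iso (F : gmod R) (M M' : lmodType R) (e : {linear F -> M})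
    (g : {linear M -> M'}) (h : {linear M' -> M}) :
  (forall x, h (g x) = x) -> (forall y, g (h y) = y) ->
  resolves e -> resolves (g \o e : {linear F -> M'}).
Proof.
move=> hg gh [sF [ep ed] [i s]]; split=> //.
  split=> [j x|x]; last by rewrite stg_ddE /= -ed stg_ddE raddf0.
  by rewrite /= -ep; exact: (stg_chmap g).1.
split=> [x dx [y]|y _].
  rewrite stg_ddE /= => gx; apply: i => //; exists 0.
  by rewrite -[LHS]hg gx !raddf0.
have [x [z [dx]]] := s (h y) (stg_ddE _); rewrite stg_ddE => /eqP.
rewrite subr_eq0 => /eqP hy; exists x, 0; split=> //.
by rewrite /= -hy gh subrr.
Qed.

(** Maps of degree [n] out of [R], in degree [0], are the elements of degree [n];
    cocycles are cycles and coboundaries are boundaries. *)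
Section Elements.
Variables (Y : gmod R).
Implicit Types n : int.

Definition elt (y : Y) : {linear stg R^o -> Y} := scale_at y.

Lemma stg_fun_elt (T : stg R^o -> Y) : linear T -> T = elt (T (1 : R)).
Proof.
move=> lT; apply: funext => a; rewrite mklinE.
by rewrite -[RHS](linearZ_LR (mklin lT)) -[a *: _]/((a : R) * 1) mulr1.
Qed.

Lemma elt_homdeg n y : homdeg n (elt y) <-> pr n y = y.
Proof.
split=> [[_ h]|h].
  by have := h 0 (1 : R); rewrite add0r stg_prE eqxx !mklinE scale1r.
split=> [|i x]; first exact: linearP.
rewrite stg_prE !mklinE linearZ_LR /=; case: eqP => [->|ni]; first by rewrite add0r h.
rewrite scale0r -h pr_neq ?scaler0 //.
by rewrite -[X in _ != X]add0r (inj_eq (addIr n)); apply/eqP.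
Qed.

Lemma elt_cyc n y : cyc n (elt y) <-> pr n y = y /\ dd y = 0.
Proof.
split=> [[/elt_homdeg yn cy]|[/elt_homdeg yn dy]].
  by split=> //; have := cy (1 : R); rewrite stg_ddE raddf0 scaler0 mklinE scale1r.
split=> // x; rewrite stg_ddE raddf0 scaler0 mklinE linearZ_LR /= dy scaler0 //.
Qed.

Lemma elt_bnd n y : pr n y = y -> bnd n (elt y) <-> exists z, y = dd z.
Proof.
move=> yn; split=> [[S hS SE]|[z zE]].
  exists (S (1 : R)); have := SE (1 : R); rewrite mklinE scale1r => ->.
  have [S' ?] := homdeg_lin hS; subst S.
  by rewrite stg_ddE raddf0 scaler0 addr0.
exists (elt (pr (n + 1) z)); last first.
  move=> x; rewrite stg_ddE raddf0 scaler0 addr0 !mklinE linearZ_LR /= dd_pr addrK.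
  by rewrite -zE yn.
by have /= h := proj2 (elt_homdeg (n + 1) (pr (n + 1) z)) (prK _ _).
Qed.
End Elements.

Lemma stg_fg_cohomology (Y : gmod R) :
  (forall n, fg_homology Y n) ->
  fg_cohomology (stg R^o) Y.
Proof.
move=> fY n; have [s [sc sP]] := fY n.
have lelt : linear (fun y : Y => (elt y : stg R^o -> Y)).
  move=> a x y; apply: funext => r; rewrite -[RHS]/(a *: elt x r + elt y r) !mklinE.
  by rewrite scalerDr !scalerA mulrC.
exists [seq (elt y : stg R^o -> Y) | y <- s]; split=> [T /mapP[y /sc yc ->]|T cT].
  exact/elt_cyc.
have TE := stg_fun_elt cT.1.1; have /elt_cyc[yn dy] : cyc n (elt (T (1 : R))) by rewrite -TE.
have [b [z [sb bE]]] := sP _ yn dy.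
exists (elt b : stg R^o -> Y); first exact: (in_span_map (mklin lelt) sb).
have bn : pr n b = b.
  apply: (in_span_min (S := fun y => pr n y = y) _ _ sb) => [|y /sc[]//].
  by split=> [|a u v un vn]; rewrite ?raddf0 // linearP un vn.
rewrite TE -[_ - _]/((mklin lelt (T (1 : R))) - mklin lelt b) -raddfB.
by apply/elt_bnd; [rewrite raddfB /= yn bn|exists z].
Qed.
End Prelim.

Section Faithful.
Variables (R : comNzRingType) (m : submodClosed R^o).
Hypothesis locR : local_ring m.
Variables (J : R^o -> Prop) (sJ : submodP J) (Y : gmod R).
Hypothesis J_m3 : cube_in m J.
Variables (K0 : gmod R) (e0 : {linear K0 -> residue_field m}).
Hypothesis res0 : resolves e0.

(** If [Y] has cohomology on the residue field [k] in the single degree [n], then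
    [R / J] acts faithfully on the classes on [R / J].  Otherwise some [b] outside
    of [J] with [m b <= J] kills them.  Multiplication by [b] factors as
    [R / J -> k -> R / J], where the first map is injective on classes by
    [projection_inj] and the second one is surjective on classes, because the
    cokernel [R / (J + b R)] has no class in the next degree.  Hence the classes
    on [k] would vanish. *)
Lemma ext_faithful n (L : gmod R) (e : {linear L -> quo sJ}) (a : R) :
  (forall i, i != n -> null K0 Y i) -> ~ null K0 Y n -> resolves e ->
  (forall T : L -> Y, cyc n T -> bnd n (a *: T)) -> J a.
Proof.
move=> n0 nn rL aT; apply: contrapT => Ja; apply: nn.
(* Multiply [a] by elements of [m] until the product is in the socle modulo [J];
   this takes at most two factors. *)
have [b [bT mb Jb]] : exists b : R, [/\ forall T : L -> Y, cyc n T -> bnd n (b *: T),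
    forall x : R, x \in m -> J (x * b) & ~ J b].
  have mulT (x y : R) : (forall T : L -> Y, cyc n T -> bnd n (y *: T)) ->
      forall T : L -> Y, cyc n T -> bnd n ((x * y) *: T).
    by move=> yT T cT; rewrite -scalerA; apply: (submodPZ (bnd_sub L Y n)); apply: yT.
  have [h1|/existsNP[x /not_implyP[xm nx]]] := pselect (forall x : R, x \in m -> J (x * a)).
    by exists a.
  have [h2|/existsNP[y /not_implyP[ym ny]]] := pselect (forall y : R, y \in m -> J (y * (x * a))).
    by exists (x * a); split=> //; exact: mulT.
  exists (y * (x * a)); split=> //; first exact: (mulT _ _ (mulT _ _ aT)).
  move=> z zm; rewrite mulrA mulrA mulrC.
  by apply: (submodPZ sJ); exact: J_m3.
have sc := colon_sub b sJ; have sa := adj_sub b sJ.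
have cm r : colon b J r <-> r \in m.
  split=> [|rm]; last by have := mb r rm; rewrite mulrC.
  apply: (ideal_sub_max locR sc) => h; apply: Jb.
  by move: h; rewrite /colon -[_ *: _]/(b * 1) mulr1.
have [f [g [fg fE gE]]] := residue_iso sc cm.
have gf y : g (f y) = y by have [r <-] := qpi_surj y; rewrite fE gE.
have [F [eF [rF _]]] := quo_resolution locR sc.
have rF' := resolves_iso fg gf rF.
have [th [pi [ex thE piE]]] := colon_exact sJ sc sa.
have [al cal] := covers_ex rF rL th.
have [eC [rC _]] := cone_resolves ex rF rL cal cal.1.
have [|p pE] := @quo_lift R _ _ sJ _ (qpi m).
  by move=> r Jr; apply/qpi_eq0/cm; apply: (submodPZ sJ).
have [be cbe] := covers_ex rL rF' p.
(* The composite [al \o be] is multiplication by [b] up to homotopy. *)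
have cab : covers e e (scl _ b) (al \o be).
  have cal' : covers (g \o eF : {linear F -> residue_field m}) e (th \o f) al.
    split; first exact: cal.1.
    by move: cal.2; congr bnd; apply: funext => x /=; rewrite fg.
  have [_ hL _] := rL; have [h1 h2] := covers_comp hL cbe cal'.
  split=> //; move: h2; congr bnd; apply: funext => x /=; congr (_ - _).
  by have [r <-] := qp_surj (e x); rewrite pE fE thE linearZ_LR.
have nF : null F Y n.
  move=> T cT; apply: (@projection_inj R m locR J Y J_m3 F (g \o eF) rF' n _
    J sJ (fun r Jr => Jr) _ sJ L e rL p be pE cbe T cT).
  - apply: (null_iso (f := g) (g := f) rF rF' gf) => //.
    apply: (null_iso (f := f) (g := g) res0 rF fg); apply: n0; lia.
  - by move=> J1; apply: Jb; have := submodPZ sJ b J1; rewrite -[_ *: _]/(b * 1) mulr1.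
  have nC : null (cone cal.1) Y (n - 1).
    apply: (devissage locR J_m3 res0 (n0 (n - 1) _) (J := adj b J) sa _ (sJ := sa) rC); first lia.
    by move=> r Jr; apply: adj_mem.
  have := @cone_top_bnd R F L Y al cal.1 (n - 1) T; rewrite subrK => /(_ cT)[+ _].
  case=> [|u cu bu]; first by apply: nC; apply/cone_top_cyc; rewrite subrK.
  have h1 := bnd_comp cbe.1 bu.
  have h2 := cyc_homotopic cu (covers_uniq rL rL cab (covers_scl e b)).
  have h3 := bT u cu.
  have := submodPD (bnd_sub _ _ n) h1 (submodPD (bnd_sub _ _ n) h2 h3).
  congr bnd; apply: funext => x.
  rewrite -[LHS]/(T (be x) - u (al (be x)) + (u (al (be x)) - u (b *: x) + b *: u x)).
  have [u' ?] := cyc_lin cu; subst u.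
  by rewrite linearZ_LR subrK subrK.
apply: (null_iso (f := g) (g := f) rF res0 gf nF).
Qed.
End Faithful.

(** * Complexes with homology in one degree *)
Section Omega.
Variable R : comNzRingType.

Section H0.
Variable Y : gmod R.

Lemma zcyc_sub : submodP (fun y : Y => pr 0 y = y /\ dd y = 0).
Proof.
split=> [|a u v [un du] [vn dv]]; first by rewrite !raddf0.
by rewrite !linearP /= un vn du dv scaler0 addr0.
Qed.

Definition zcyc : lmodType R := submodule (psub zcyc_sub).
Definition mkz (y : Y) (yc : pr 0 y = y /\ dd y = 0) : zcyc.
Proof. by exists y; apply/psubE. Defined.
Lemma zcycP (z : zcyc) : pr 0 (val z) = val z /\ dd (val z) = 0.
Proof. by have /psubE := valP z. Qed.

Definition zbnd (z : zcyc) : Prop := exists w, val z = dd w.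
Lemma zbnd_sub : submodP zbnd.
Proof.
split=> [|a u v [w uE] [w' vE]]; first by exists 0; exact: (esym (raddf0 dd)).
exists (a *: w + w'); rewrite linearP -uE -vE; exact: erefl.
Qed.

Definition H0 : lmodType R := quo zbnd_sub.

Lemma H0_fin_gen : fg_homology Y 0 -> fin_gen H0.
Proof.
move=> [s [sc sP]].
have [zs [_ zsE]] := lift_seq (T := zcyc) (f := val) (Q := fun _ => True)
  (fun y ys => ex_intro2 _ _ (mkz (sc y ys)) I erefl).
exists [seq qp zbnd_sub z | z <- zs] => h; have [z <-] := qp_surj h.
have [zn dz] := zcycP z; have [b [w [sb bE]]] := sP _ zn dz.
have lval : linear (fun z : zcyc => val z) by [].
move: sb; rewrite -zsE => /(in_span_map_inv (f := mklin lval))[z' zz' zb].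
have -> : qp zbnd_sub z = qp zbnd_sub z'.
  by apply/qp_eq; exists w; rewrite -bE -zb.
exact: in_span_map.
Qed.
End H0.

Lemma thin_iso (m : submodClosed R^o) (K K' : gmod R) (M : lmodType R)
    (e : {linear K -> M}) (e' : {linear K' -> M}) Y n :
  resolves e -> resolves e' -> thin m K Y n -> thin m K' Y n.
Proof.
move=> re re' tK T1 T2 cT1 cT2.
have [b cb] := covers_ex re re' idfun; have [c cc] := covers_ex re' re idfun.
have [_ he' _] := re'.
have cbc : covers e' e' idfun (b \o c) := covers_comp he' cc cb.
have [a1 [a2 [a12 H]]] := tK _ _ (cyc_comp cb.1 cT1) (cyc_comp cb.1 cT2).
exists a1, a2; split=> //.
have cT : cyc n (a1 *: T1 + a2 *: T2).
  by apply: (submodPD (cyc_sub _ _ n)); apply: (submodPZ (cyc_sub _ _ n)).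
have h1 := cyc_homotopic cT (covers_uniq re' re' (covers_id e') cbc).
have := submodPD (bnd_sub _ _ n) h1 (bnd_comp cc.1 H); congr bnd.
apply: funext => x; exact: subrK.
Qed.

Lemma thin_qiso (m : submodClosed R^o) (K X Y : gmod R) (q : {linear X -> Y}) n :
  semifree K -> chmap q -> qiso q -> thin m K X n <-> thin m K Y n.
Proof.
move=> sK hq qq; split=> tK T1 T2 cT1 cT2.
  have [U1 [cU1 b1]] := lift_cyc hq sK qq cT1; have [U2 [cU2 b2]] := lift_cyc hq sK qq cT2.
  have [a1 [a2 [a12 H]]] := tK _ _ cU1 cU2; exists a1, a2; split=> //.
  have h1 := submodPZ (bnd_sub _ _ n) a1 b1; have h2 := submodPZ (bnd_sub _ _ n) a2 b2.
  have := submodPD (bnd_sub _ _ n) (submodPD (bnd_sub _ _ n) h1 h2) (comp_bnd hq H).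
  congr bnd; apply: funext => x.
  rewrite -[LHS]/(a1 *: (T1 x - q (U1 x)) + a2 *: (T2 x - q (U2 x)) + q (a1 *: U1 x + a2 *: U2 x)).
  by rewrite linearP linearZ_LR !scalerBr addrACA !subrK.
have [a1 [a2 [a12 H]]] := tK _ _ (comp_cyc hq cT1) (comp_cyc hq cT2).
exists a1, a2; split=> //; apply: (lift_bnd hq sK qq).
  by apply: (submodPD (cyc_sub _ _ n)); apply: (submodPZ (cyc_sub _ _ n)).
move: H; congr bnd; apply: funext => x.
by rewrite -[RHS]/(q (a1 *: T1 x + a2 *: T2 x)) linearP linearZ_LR.
Qed.

Lemma null_qiso (K X Y : gmod R) (q : {linear X -> Y}) n :
  semifree K -> chmap q -> qiso q -> null K X n <-> null K Y n.
Proof.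
move=> sK hq qq; split=> nK T cT.
  have [U [cU bU]] := lift_cyc hq sK qq cT.
  have := submodPD (bnd_sub _ _ n) bU (comp_bnd hq (nK U cU)).
  by congr bnd; apply: funext => x; exact: subrK.
exact: (lift_bnd hq sK qq cT (nK _ (comp_cyc hq cT))).
Qed.

(** A bounded below complex [P] of projectives, quasi-isomorphic to a complex [Y]
    with homology in degree [0] only, resolves that homology even if [P] has
    terms in negative degrees: these terms split off. *)
Section Augment.
Variables (P Y : gmod R) (q : {linear P -> Y}).
Hypotheses (sP : semifree P) (hq : chmap q) (qq : qiso q).
Hypothesis exY : forall n, n != 0 -> forall y : Y, pr n y = y -> dd y = 0 ->
  exists z, y = dd z.

Lemma augment_exact n (x : P) : n != 0 -> pr n x = x -> dd x = 0 -> exists z, x = dd z.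
Proof.
move=> n0 xn dx; apply: qq.1 => //; apply: (exY n0).
  by rewrite hq.1 xn.
by rewrite hq.2 dx raddf0.
Qed.

(** A projection [r] of [P_0] onto its cycles, built degree by degree from below:
    if the cycles of degree [j - 1] are a direct summand, they are projective, and
    the differential of degree [j] onto them splits. *)
Lemma cycle_projection : exists r : {linear P -> P},
  [/\ forall x, r (pr 0 x) = r x, forall x, pr 0 (r x) = r x,
      forall x, dd (r x) = 0 & forall x, pr 0 x = x -> dd x = 0 -> r x = x].
Proof.
have [[b Pb] pP] := sP.
pose b' := Order.min b 0.
have Pb' i : i < b' -> forall x : P, pr i x = 0.
  by rewrite lt_min => /andP[ib _]; exact: Pb.
have b'0 : b' <= 0 by rewrite ge_min lexx orbT.
have H (t : nat) : b' - 1 + t%:Z <= 0 -> exists r : {linear P -> P},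
    [/\ forall x, r (pr (b' - 1 + t%:Z) x) = r x,
        forall x, pr (b' - 1 + t%:Z) (r x) = r x, forall x, dd (r x) = 0 &
        forall x, pr (b' - 1 + t%:Z) x = x -> dd x = 0 -> r x = x].
  elim: t => [|t IH] t0.
    exists (\0); split=> [||x|x xn _] //; try by move=> x; rewrite ?raddf0.
      by rewrite raddf0.
    by rewrite -xn Pb' // addr0; lia.
  have [|r [r1 r2 r3 r4]] := IH; first by lia.
  set i := b' - 1 + t%:Z in r1 r2 r4 *; set j := b' - 1 + _.
  have ij : i = j - 1 by rewrite /i /j; lia.
  have i0 : i != 0 by rewrite /i; lia.
  have [x|h [h1 h2]] := pP i P P dd r.
    have [z zE] := augment_exact i0 (r2 (pr i x)) (r3 _); by exists z; rewrite -zE.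
  have ls : linear (fun x => pr j x - pr j (h (dd x))).
    by move=> a x y; rewrite !linearP /= scalerDr addrACA.
  exists (mklin ls); split=> x; rewrite !(mklinE ls).
  - by rewrite prK dd_pr -ij h1.
  - by rewrite raddfB /= !prK.
  - rewrite raddfB /= !dd_pr -ij h2 r1 -r1 r4 ?prK ?subrr //.
    by rewrite dd_pr dd_dd raddf0.
  - by move=> xn dx; rewrite dx !raddf0 ?subr0 ?addr0 xn.
have [] := H `|(1 - b')%R|%N; first by lia.
have -> : b' - 1 + `|(1 - b')%R|%N%:Z = 0 by lia.
by move=> r Hr; exists r.
Qed.

Lemma augment : exists e : {linear P -> H0 Y}, resolves e.
Proof.
have [r [r1 r2 r3 r4]] := cycle_projection.
have zr x : pr 0 (q (r x)) = q (r x) /\ dd (q (r x)) = 0.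
  by rewrite hq.1 hq.2 r2 r3 raddf0.
have le : linear (fun x => qp (zbnd_sub Y) (mkz (zr x))).
  move=> a x y; rewrite -linearP; congr (qp _ _); apply: val_inj.
  by rewrite /= !linearP.
exists (mklin le); split=> //.
  split=> [i x|x]; rewrite ?stg_prE ?stg_ddE !(mklinE le).
    have [->|ni] := eqVneq i 0; first by congr (qp _ _); apply: val_inj; rewrite /= r1.
    apply/esym/qp_eq0; exists 0 => /=; rewrite raddf0 -r1 pr_neq ?raddf0 //.
    by rewrite eq_sym.
  apply/esym/qp_eq0 => /=; exists (q (pr 1 x)) => /=.
  rewrite hq.2 -r1 pr_dd add0r r4 //; last exact: dd_dd.
  by rewrite dd_pr subrr prK.
split=> [x dx [y]|h _].
  rewrite stg_ddE (mklinE le) => /qp_eq0[w /= wE].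
  apply: qq.1 => //.
  have xE : r x = pr 0 x by rewrite -r1 r4 ?prK // dd_pr dx raddf0.
  have H i : exists u, q (pr i x) = dd u.
    have [->|ni] := eqVneq i 0; first by exists w; rewrite -xE.
    apply: (exY ni); first by rewrite hq.1 prK.
    by rewrite hq.2 dd_pr dx !raddf0.
  have [u uE] := choice H.
  have [y' y'E] := pr_asm (fun i => u (i - 1)).
  by exists y'; apply: pr_ext => i; rewrite pr_dd y'E addrK -pr_dd -uE !hq.1 prK.
have [z <-] := qp_surj h; have [zn dz] := zcycP z.
have [x [w [dx xE]]] := qq.2 _ dz.
exists (pr 0 x), 0; split; first by rewrite dd_pr dx raddf0.
apply/eqP; rewrite stg_ddE subr_eq0 (mklinE le); apply/eqP/qp_eq.
exists (pr 1 w); rewrite -[LHS]/(val z - q (r (pr 0 x))) r4 ?prK //; last first.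
  by rewrite dd_pr dx raddf0.
by rewrite -zn -hq.1 -raddfB xE dd_pr subrr.
Qed.
End Augment.
End Omega.

(** * The canonical module and its reduction *)
Section OmegaFacts.
Variables (R : comNzRingType) (m : submodClosed R^o).
Hypothesis locR : local_ring m.
Variables (f : seq R^o) (Y : gmod R).
Hypotheses (regf : regular_sequence f) (m3 : cube_in m (in_span f)).
Variables (K0 : gmod R) (e0 : {linear K0 -> residue_field m}).
Hypothesis res0 : resolves e0.
Hypothesis fgY : forall n, fg_homology Y n.

Lemma regular_in_max (x : R^o) : x \in f -> x \in m.
Proof.
move=> xf; case: regf => f1 _.
by apply: (ideal_sub_max locR (in_span_sub f) f1); apply: in_span_gen.
Qed.

Lemma adjs0E : adjs f (@zero_sub R R^o) = in_span f.
Proof. by apply: funext => r; apply/propext/adjs0_span. Qed.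

(** The complex [Y] has homology in degree [0] only, [f] is regular on it, and
    [R / f R] acts faithfully on the quotient by [f].  Indeed [koszul], started at
    [R] itself, computes the homology of [Y] from the classes on [R / f R], which
    by [devissage] live in the single degree [M]; as some homology is in degree
    [0], this fixes [M].  Faithfulness is [ext_faithful]. *)
Lemma omega_facts (M : int) :
  (forall n, n != M -> null K0 Y n) -> ~ null K0 Y M ->
  (exists y : Y, [/\ pr 0 y = y, dd y = 0 & ~ exists z, y = dd z]) ->
  [/\ M = - (size f)%:Z,
      forall n, n != 0 -> forall y : Y, pr n y = y -> dd y = 0 -> exists z, y = dd z,
      mreg f (@zbnd R Y) &
      forall a : R, (forall z : zcyc Y, adjs f (@zbnd R Y) (a *: z)) -> in_span f (a : R^o)].
Proof.
move=> n0 nn [y0 [y0n dy0 y0b]].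
have J3 : cube_in m (adjs f (@zero_sub R R^o)) by rewrite adjs0E.
have [|n mr [L [sL [eL [t [rL ts tE]]]]]] := koszul locR (Y := Y) (M := M)
  regular_in_max (erefl (M + (size f)%:Z)) (stg_resolves R)
  (regular_mreg regf) (stg_fg_cohomology fgY).
  move=> sL L eL rL n nM; exact: (devissage locR J3 res0 (n0 n nM) sL _ rL).
have vanish k : k != M + (size f)%:Z -> forall y : Y, pr k y = y -> dd y = 0 -> exists z, y = dd z.
  move=> kM y yk dy; apply/(elt_bnd yk); apply: n => //; exact/elt_cyc.
have MN : M + (size f)%:Z = 0.
  by apply/eqP; apply: contrapT => /negP; rewrite eq_sym => /vanish h; apply: y0b; apply: h.
have ME : M = - (size f)%:Z by lia.
have eltz (z : zcyc Y) : cyc (M + (size f)%:Z) (elt (val z)).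
  by rewrite MN; apply/elt_cyc; exact: zcycP.
have lu : linear (fun z : zcyc Y => cocycle (eltz z)).
  move=> a z w; apply: val_inj; apply: funext => r.
  rewrite -[LHS]/(r *: (a *: val z + val w)) -[RHS]/(a *: (r *: val z) + r *: val w).
  by rewrite scalerDr !scalerA mulrC.
pose u : {linear zcyc Y -> cocycles (stg R^o) Y (M + (size f)%:Z)} := mklin lu.
have uE : (fun z => cobound (u z)) = @zbnd R Y.
  apply: funext => z; apply/propext.
  rewrite -[cobound _]/(bnd (M + (size f)%:Z) (elt (val z))) MN.
  exact: elt_bnd (zcycP z).1.
have us w : exists v, cobound (w - u v).
  have cw := cocycleP w; have wE := stg_fun_elt cw.1.1.
  have [wn dw] : pr 0 (val w (1 : R)) = val w (1 : R) /\ dd (val w (1 : R)) = 0.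
    by apply/elt_cyc; rewrite -wE -MN.
  exists (mkz (conj wn dw)).
  have -> : w - u (mkz (conj wn dw)) = 0; last exact: submodP0 (cobound_sub _ _ _).
  by apply/eqP; rewrite subr_eq0; apply/eqP/val_inj; rewrite /= -wE.
split=> //.
- by rewrite -MN.
- by rewrite -uE; apply: mreg_transport => //; exact: cobound_sub.
move=> a az; rewrite -adjs0E.
apply: (ext_faithful locR J3 res0 n0 nn rL).
move=> T cT; have [v bv] := ts (cocycle cT); have [z bz] := us v.
have h1 : cobound (t (a *: v)).
  apply/tE; have -> : a *: v = a *: (v - u z) + u (a *: z).
    by rewrite scalerBr [u (a *: z)]linearZ_LR subrK.
  have sA := adjs_sub f (@cobound_sub R (stg R^o) Y (M + (size f)%:Z)).
  apply: (submodPD sA); first by apply: (submodPZ sA); apply: adjs_mem.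
  have E := adjs_transport f (cobound_sub (stg R^o) Y (M + (size f)%:Z)) us.
  by have := az z; rewrite -uE E.
have sB := cobound_sub L Y M.
have := submodPD sB (submodPZ sB a bv) h1.
rewrite linearZ_LR -scalerDr subrK //.
Qed.
End OmegaFacts.

Section SecondVariable.
Variable R : comNzRingType.
Implicit Types (K : gmod R) (N : lmodType R).

Lemma stg_cyc K N n (z : {linear K -> N}) :
  @cyc R K (stg N) n z <-> (forall x, z (pr (- n) x) = z x) /\ forall x, z (dd x) = 0.
Proof.
split=> [[[_ h] d]|[h d]]; split.
- by move=> x; rewrite -h addNr.
- by move=> x; have := d x; rewrite stg_ddE => /esym/(congr1 ( *:%R (sg R n))); rewrite sg_sg scaler0.
- split=> [|i x]; first exact: linearP.
  rewrite stg_prE; case: eqP => [ni|/eqP ni].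
    by have -> : i = - n by lia.
  by rewrite -h pr_neq ?raddf0 //; move: ni; lia.
- by move=> x; rewrite stg_ddE d scaler0.
Qed.

Lemma stg_bnd K N n (z : {linear K -> N}) :
  @bnd R K (stg N) n z <->
  exists w : {linear K -> N}, (forall x, w (pr (- n - 1) x) = w x) /\ forall x, z x = w (dd x).
Proof.
split=> [[S hS SE]|[w [wp wE]]].
  have [S' ?] := homdeg_lin hS; subst S.
  exists (sg R n \*: S' : {linear K -> N}); split=> x /=.
    by rewrite -hS.2 -opprD addNr stg_prE.
  by rewrite SE stg_ddE add0r.
exists (fun x => sg R n *: w x).
  split=> [a x y|i x]; first by rewrite linearP scalerDr !scalerA mulrC.
  rewrite stg_prE -(wp (pr i x)); case: eqP => [ni|/eqP ni].
    have -> : i = - n - 1 by lia.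
    by rewrite prK wp.
  by rewrite pr_neq ?raddf0 ?scaler0 //; move: ni; lia.
by move=> x; rewrite stg_ddE add0r sg_sg wE.
Qed.

Section Step.
Variables (K : gmod R) (N N1 N' : lmodType R) (i : {linear N -> N1}) (p : {linear N1 -> N'}).
Hypotheses (sK : semifree K) (ex : short_exact i p).

(** The connecting map of [0 -> N -> N1 -> N' -> 0]: lift the cocycle [z] to a
    map [zt] into [N1]; the failure of [zt] to be a cocycle is a cocycle in [N]. *)
Lemma connecting n (z : {linear K -> N'}) : @cyc R K (stg N') n z ->
  exists (w : {linear K -> N}) (zt : {linear K -> N1}),
  [/\ @cyc R K (stg N) (n - 1) w, forall k, zt (pr (- n) k) = zt k,
    forall k, p (zt k) = z k & forall k, zt (dd k) = i (w k)].
Proof.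
move=> /stg_cyc[zp zd]; have [f0 gf gy gz] := ex; have [_ pK] := sK.
have [k|zt [zt1 zt2]] := pK (- n) N1 N' p z; first by have [a aE] := gz (z (pr (- n) k)); exists a.
have [k|w [w1 w2]] := pK (- n + 1) N N1 i (zt \o dd).
  have [|a aE] := gy (zt (dd (pr (- n + 1) k))); last by exists a.
  by rewrite zt2 zp zd.
have wE k : zt (dd k) = i (w k).
  by rewrite w2 /= dd_pr addrK zt1.
exists w, zt; split=> // [|k]; last by rewrite zt2 zp.
apply/stg_cyc; split=> k; first by rewrite opprB addrC w1.
by apply: f0; rewrite -wE dd_dd raddf0.
Qed.

Lemma connecting_bnd n (z : {linear K -> N'}) (w : {linear K -> N}) (zt : {linear K -> N1}) :
  (forall k, zt (pr (- n) k) = zt k) -> (forall k, p (zt k) = z k) ->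
  (forall k, zt (dd k) = i (w k)) ->
  null K (stg N1) n -> @bnd R K (stg N) (n - 1) w -> @bnd R K (stg N') n z.
Proof.
move=> ztp ztz ztd nN /stg_bnd[v [vp vE]].
have lu : linear (fun k => zt k - i (v k)).
  by move=> a k l; rewrite !linearP /= scalerDr addrACA.
have cu : @cyc R K (stg N1) n (mklin lu).
  apply/stg_cyc; split=> k; rewrite !(mklinE lu).
    by rewrite ztp -[v k]vp; congr (_ - i (v (pr _ _))); lia.
  by rewrite ztd -vE subrr.
have /stg_bnd[y [yp yE]] := nN _ cu.
apply/stg_bnd; exists (p \o y); split=> k /=; first by rewrite yp.
by rewrite -yE (mklinE lu) raddfB /= ztz; have [_ gf _ _] := ex; rewrite gf subr0.
Qed.

Lemma null_step n : null K (stg N1) n -> null K (stg N) (n - 1) -> null K (stg N') n.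
Proof.
move=> n1 n2 z cz; have [z' ?] := cyc_lin cz; subst z.
have [w [zt [cw h1 h2 h3]]] := connecting cz.
exact: (connecting_bnd h1 h2 h3 n1 (n2 _ cw)).
Qed.

Lemma thin_step (m : submodClosed R^o) n :
  null K (stg N1) n -> thin m K (stg N) (n - 1) -> thin m K (stg N') n.
Proof.
move=> n1 n2 z1 z2 c1 c2; have [z1' ?] := cyc_lin c1; subst z1.
have [z2' ?] := cyc_lin c2; subst z2.
have [w1 [zt1 [cw1 a1 b1 d1]]] := connecting c1.
have [w2 [zt2 [cw2 a2 b2 d2]]] := connecting c2.
have [r1 [r2 [r12 H]]] := n2 _ _ cw1 cw2; exists r1, r2; split=> //.
pose comb (U V : lmodType R) (s1 s2 : {linear U -> V}) : {linear U -> V} :=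
  (r1 \*: s1) \+ (r2 \*: s2).
apply: (@connecting_bnd n (comb _ _ z1' z2') (comb _ _ w1 w2) (comb _ _ zt1 zt2)) => // k.
- by rewrite /= a1 a2.
- by rewrite /= linearP linearZ_LR b1 b2.
- by rewrite /= d1 d2 linearP linearZ_LR.
Qed.
End Step.

Section Iterate.
Variables (K : gmod R) (V : lmodType R).
Hypothesis sK : semifree K.

(** Dividing by a regular element of the second argument moves the cohomology by
    one degree, as long as it vanishes in the degree below.  So all of [f] moves
    the degree [size f] of the canonical module to the degree [0], and spends
    [size f] of the [size f + 1] vanishing degrees of [null_iter]. *)
Lemma thin_iter (m : submodClosed R^o) (f : seq R) :
  forall (B : V -> Prop) (sB : submodP B), mreg f B ->
  (forall i : nat, (i < size f)%N -> null K (stg (quo sB)) (- i%:Z)) ->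
  thin m K (stg (quo sB)) (- (size f)%:Z) ->
  forall sA : submodP (adjs f B), thin m K (stg (quo sA)) 0.
Proof.
elim: f => [|x f IH] B sB /=.
  by move=> _ _ + sA; rewrite (Prop_irrelevance sA sB) oppr0.
move=> [regx regf] nf tf sA; have sx := adj_sub x sB.
have [g [ex _]] := regular_exact sB sx regx.
apply: (IH _ sx regf) => [i fi|].
  apply: (null_step sK ex); first exact: (nf i (ltnW fi)).
  by have := nf i.+1 fi; congr null; lia.
apply: (thin_step sK ex); first exact: nf.
by move: tf; congr thin; lia.
Qed.

Lemma null_iter (f : seq R) :
  forall (B : V -> Prop) (sB : submodP B), mreg f B ->
  (forall i : nat, (0 < i <= (size f).+1)%N -> null K (stg (quo sB)) (- i%:Z)) ->
  forall sA : submodP (adjs f B), null K (stg (quo sA)) (- 1).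
Proof.
elim: f => [|x f IH] B sB /=.
  by move=> _ h sA; rewrite (Prop_irrelevance sA sB); exact: (h 1%N).
move=> [regx regf] nf sA; have sx := adj_sub x sB.
have [g [ex _]] := regular_exact sB sx regx.
apply: (IH _ sx regf) => i /andP[i0 fi].
apply: (null_step sK ex); first by apply: nf; rewrite i0 ltnW.
have := nf i.+1; rewrite /= ltnS fi => /(_ isT); congr null; lia.
Qed.
End Iterate.

(** [Hom(k, N)] is the socle of [N]: a socle element is the value at the class
    of [1] of a cocycle. *)
Lemma socle_thin (m : submodClosed R^o) (K0 : gmod R) (e0 : {linear K0 -> residue_field m}) N :
  resolves e0 -> thin m K0 (stg N) 0 ->
  forall s1 s2 : N, (forall x : R, x \in m -> x *: s1 = 0) ->
    (forall x : R, x \in m -> x *: s2 = 0) ->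
  exists a1 a2 : R, (a1 \notin m) || (a2 \notin m) /\ a1 *: s1 + a2 *: s2 = 0.
Proof.
move=> [_ [ep ed] [_ sj]] tN.
have H (s : N) : (forall x : R, x \in m -> x *: s = 0) ->
    exists z : {linear K0 -> N}, @cyc R K0 (stg N) 0 z /\
      forall k, e0 k = qpi m 1 -> z k = s.
  move=> ms.
  have [|g gE] := @quotient_lift R _ _ m (scale_at s); first by move=> x /ms.
  exists (g \o e0); split=> [|k kE]; last by rewrite /= kE gE scale_atE scale1r.
  apply/(chmap_cyc (Y := stg N)); split=> [i x|x] /=.
    by rewrite (stg_chmap g).1; congr (g _); rewrite -ep.
  have -> : e0 (dd x) = 0 by rewrite -ed.
  by rewrite raddf0.
move=> s1 s2 /H[z1 [c1 E1]] /H[z2 [c2 E2]].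
have [a1 [a2 [a12 [S hS SE]]]] := tN _ _ c1 c2; exists a1, a2; split=> //.
have [k [w [dk]]] := sj (qpi m 1) (stg_ddE _); rewrite stg_ddE => /eqP.
rewrite subr_eq0 => /eqP/esym kE.
have := SE k; rewrite -[LHS]/(a1 *: z1 k + a2 *: z2 k) (E1 k kE) (E2 k kE) => ->.
have [S' ?] := homdeg_lin hS; subst S.
by rewrite dk raddf0 scaler0 addr0 stg_ddE.
Qed.

(** If [Ext^1(M, A) = 0], maps to [A] extend from the kernel of a cover of [M]
    by a free module.  The cover is compared with the first two terms of the
    resolution [P]: [l] lifts the augmentation of [P] to the free module, [mu]
    lifts the cover to cycles of [P], and [h \o l \o dd] is a cocycle. *)
Lemma hom_extension (P : gmod R) (M A : lmodType R) (e : {linear P -> M}) r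
    (c : {linear 'rV[R]_r -> M}) :
  resolves e -> null P (stg A) (- 1) -> (forall y, exists v, c v = y) ->
  forall h : 'rV[R]_r -> A,
  (forall a u v, c u = 0 -> c v = 0 -> h (a *: u + v) = a *: h u + h v) ->
  exists g : {linear 'rV[R]_r -> A}, forall v, c v = 0 -> h v = g v.
Proof.
move=> [[_ pP] [ep ed] [ei es]] n1 cs h hl.
have h0 : h 0 = 0.
  have := hl (-1) 0 0 (raddf0 c) (raddf0 c); rewrite scaler0 addr0 scaleN1r addNr //.
have eP x : e (pr 0 x) = e x by rewrite -ep.
have eD x : e (dd x) = 0 by rewrite -ed.
have [x|l [l1 l2]] := pP 0 _ _ c e; first by have [v vE] := cs (e (pr 0 x)); exists v.
have lz : linear (fun x => h (l (dd x))).
  move=> a x y; rewrite !linearP hl //; by rewrite l2 eP eD.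
have : @cyc R P (stg A) (- 1) (mklin lz).
  apply/stg_cyc; split=> x; rewrite !(mklinE lz).
    by rewrite opprK -[dd (pr 1 x)]/(dd (pr 1 x)) dd_pr subrr l1.
  by rewrite dd_dd raddf0 h0.
move/n1/stg_bnd => [s [_ sE]].
have H i : exists x : P, dd x = 0 /\ e x = c (delta_mx 0 i).
  have [x [z [dx]]] := es (c (delta_mx 0 i)) (stg_ddE _); rewrite stg_ddE => /eqP.
  by rewrite subr_eq0 => /eqP ->; exists x.
have [b bP] := choice H.
pose mu := comb b.
have emu v : e (mu v) = c v.
  rewrite [v in RHS]row_sum_delta !linear_sum; apply: eq_bigr => i _.
  by rewrite !linearZ_LR (bP i).2.
have dmu v : dd (mu v) = 0.
  by rewrite linear_sum big1 // => i _; rewrite linearZ_LR /= (bP i).1 scaler0.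
have k0 v : c (l (mu v) - v) = 0 by rewrite raddfB /= l2 eP emu subrr.
have lg : linear (fun v => s (mu v) - h (l (mu v) - v)).
  move=> a u v; have -> : l (mu (a *: u + v)) - (a *: u + v) =
      a *: (l (mu u) - u) + (l (mu v) - v).
    by rewrite !linearP /= scalerDr addrACA.
  by rewrite hl // !linearP /= scalerDr addrACA.
exists (mklin lg) => v cv; rewrite (mklinE lg).
have [|x xE] := ei (mu v) (dmu v); first by exists 0; rewrite emu cv.
have lmu0 : c (l (mu v)) = 0 by rewrite l2 eP emu.
have -> : l (mu v) - v = (- 1) *: v + l (mu v) by rewrite scaleN1r addrC.
by rewrite hl // scaleN1r opprD opprK xE -sE (mklinE lz) addrCA subrr addr0.
Qed.
End SecondVariable.

(** * Faithful modules with simple socle over a ring with [m^3 = 0] *)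
Section Artinian.
Variables (R : comNzRingType) (m : submodClosed R^o).
Hypothesis locR : local_ring m.
(* The ring of this part is [R / I].  The hypotheses on [E] are those satisfied by
   the reduction of the canonical module: it is a faithful module over [R / I]
   whose socle is at most one-dimensional. *)
Variables (I : R^o -> Prop) (sI : submodP I).
Hypothesis I_m3 : cube_in m I.
Variable E : lmodType R.
Hypothesis IE : forall (a : R) (y : E), I a -> a *: y = 0.
Hypothesis faithful : forall a : R, (forall y : E, a *: y = 0) -> I a.
Hypothesis thinE : forall s1 s2 : E, (forall x : R, x \in m -> x *: s1 = 0) ->
  (forall x : R, x \in m -> x *: s2 = 0) ->
  exists a1 a2 : R, (a1 \notin m) || (a2 \notin m) /\ a1 *: s1 + a2 *: s2 = 0.

Definition socle (s : E) : Prop := forall x : R, x \in m -> x *: s = 0.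

Lemma unit_scale_eq0 (V : lmodType R) (a : R) (s : V) : a \notin m -> a *: s = 0 -> s = 0.
Proof.
move=> /(unitP locR)[b ba] as0.
by rewrite -[s]scale1r -ba -scalerA as0 scaler0.
Qed.

Lemma scale_eq0_max (V : lmodType R) (a : R) (s : V) : s <> 0 -> a *: s = 0 -> a \in m.
Proof. by move=> s0 as0; apply/negPn/negP => /unit_scale_eq0/(_ as0). Qed.

Lemma socle_generated (s t : E) : socle s -> socle t -> s <> 0 -> exists c : R, t = c *: s.
Proof.
move=> ss st s0; have [a1 [a2 [a12 aE]]] := thinE ss st.
have [a2m|a2m] := boolP (a2 \in m).
  move: a12 aE; rewrite a2m orbF => a1m; rewrite (st _ a2m) addr0.
  by move/(unit_scale_eq0 a1m)/s0.
have [b ba] := unitP locR a2m; exists (- (b * a1)).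
rewrite -[LHS]scale1r -ba -scalerA.
move/eqP: aE; rewrite addrC addr_eq0 => /eqP->.
by rewrite scaleNr scalerN scalerA.
Qed.

(** A nonzero element of [V / B] has a nonzero multiple in the socle, found by
    multiplying by elements of [m] at most twice. *)
Lemma socle_mod (V : lmodType R) (B : V -> Prop) (sB : submodP B) (v : V) :
  (forall (a : R) (y : V), I a -> B (a *: y)) -> ~ B v ->
  exists c : R, ~ B (c *: v) /\ forall x : R, x \in m -> B (x *: (c *: v)).
Proof.
move=> IB nv.
have [h1|/existsNP[x /not_implyP[xm nx]]] := pselect (forall x : R, x \in m -> B (x *: v)).
  by exists 1; rewrite scale1r.
have [h2|/existsNP[y /not_implyP[ym ny]]] := pselect (forall y : R, y \in m -> B (y *: (x *: v))).
  by exists x.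
exists (y * x); rewrite -scalerA; split=> // z zm.
by rewrite !scalerA; apply: IB; exact: I_m3.
Qed.

(** Every endomorphism of [E] is a multiplication.  This is the case [J = I] of
    the surjectivity of [R / J -> Hom(ann_E J, E)], proved by noetherian induction
    on [J]: given [x] outside of [J] with [m x <= J], correct the endomorphism by
    the scalar obtained for [J + x R], so that it kills the elements of [ann_E J]
    killed by [x].  What remains factors through [x E], which lies in the simple
    socle, hence is a multiple of [x]. *)
Lemma endo_scale (psi : {linear E -> E}) : exists a : R, forall y, psi y = a *: y.
Proof.
suff H : forall J : R^o -> Prop, submodP J -> (forall r, I r -> J r) ->
    exists a : R, forall y, (forall r : R, J r -> r *: y = 0) -> psi y = a *: y.
  by have [a aE] := H I sI (fun r Ir => Ir); exists a => y; apply: aE => r /IE.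
apply: (ideal_ind (local_noeth locR)) => J sJ IH IJ.
have [J1|nJ1] := pselect (J 1).
  exists 0 => y Jy; rewrite scale0r -[y]scale1r Jy // raddf0 //.
have [|x [nx mx]] := socle_mod sJ (v := 1 : R^o) _ nJ1.
  by move=> a y Ia; rewrite -[a *: y]/(a * y) mulrC; apply: (submodPZ sJ); apply: IJ.
have {}nx : ~ J x by move: nx; rewrite -[x *: 1]/(x * 1) mulr1.
have {}mx (t : R) : t \in m -> J (t * x).
  by move=> /mx; rewrite -[x *: 1]/(x * 1) mulr1.
have sx := adj_sub x sJ.
have [|||a aE] := IH _ sx.
- exact: adj_mem.
- by exists x => //; exact: adj_self.
- by move=> r Ir; apply/adj_mem/IJ.
have ann y : (forall r : R, J r -> r *: y = 0) -> x *: y = 0 -> psi y = a *: y.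
  move=> Jy xy; apply: aE => r [u [j [Jj ->]]].
  by rewrite scalerDl -[x *: u]/(x * u) mulrC -scalerA xy scaler0 add0r Jy.
have [h|/existsNP[e /not_implyP[Je xe]]] :=
    pselect (forall e : E, (forall r : R, J r -> r *: e = 0) -> x *: e = 0).
  by exists a => y Jy; apply: ann => //; apply: h.
have sxe y : (forall r : R, J r -> r *: y = 0) -> socle (x *: y).
  by move=> Jy t tm; rewrite scalerA Jy //; apply: mx.
have [c cE] : exists c : R, psi e - a *: e = c *: (x *: e).
  apply: (socle_generated (sxe e Je)) => // t tm.
  rewrite scalerBr -linearZ_LR (ann (t *: e)).
  - by rewrite !scalerA mulrC subrr.
  - by move=> r Jr; rewrite scalerA mulrC -scalerA Je // scaler0.
  - by rewrite scalerA mulrC Je //; apply: mx.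
exists (a + c * x) => y Jy.
have [b bE] := socle_generated (sxe e Je) (sxe y Jy) xe.
have psie : psi e = (a + c * x) *: e.
  by rewrite scalerDl -scalerA -cE addrC subrK.
have -> : psi y = psi (y - b *: e) + b *: psi e.
  by rewrite -linearZ_LR -linearD subrK.
rewrite psie ann.
- rewrite [RHS]scalerDl -[(c * x) *: y]scalerA bE scalerDl scalerBr scalerDr !scalerA.
  by rewrite [b * a]mulrC addrA subrK !mulrA [c * b]mulrC.
- by move=> t Jt; rewrite scalerBr Jy // scalerA mulrC -scalerA Je // scaler0 subrr.
by rewrite scalerBr scalerA mulrC -scalerA bE scalerA mulrC -scalerA subrr.
Qed.

Section Generators.
Variables (r : nat) (w : 'I_r -> E).

Hypothesis w_gen : forall y, exists v, comb w v = y.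
Hypothesis w_min : forall v, comb w v = 0 -> forall i, v 0 i \in m.
(* [A] is [R / I], and [w] is a minimal system of generators of [E].  The
   hypothesis [ext] is the vanishing of [Ext^1(E, R / I)] over [R / I]. *)
Variable A : lmodType R.
Variable piA : {linear R^o -> A}.
Hypotheses (piA0 : forall a, piA a = 0 <-> I a) (piA_surj : forall y, exists a, piA a = y).
Hypothesis ext : forall h : 'rV[R]_r -> A,
  (forall a u v, comb w u = 0 -> comb w v = 0 -> h (a *: u + v) = a *: h u + h v) ->
  (forall (a : R) u, I a -> h (a *: u) = 0) ->
  exists g : {linear 'rV[R]_r -> A}, forall v, comb w v = 0 -> h v = g v.

(** A choice of images for the generators that respects their relations is an
    endomorphism. *)
Lemma endo_ex (y : 'I_r -> E) : (forall v, comb w v = 0 -> comb y v = 0) ->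
  exists a : R, forall i, y i = a *: w i.
Proof.
move=> wy; have [s sE] := choice w_gen.
have psiE v : comb y (s (comb w v)) = comb y v.
  by apply/eqP; rewrite -subr_eq0 -raddfB; apply/eqP/wy; rewrite raddfB /= sE subrr.
have lp : linear (fun z => comb y (s z)).
  move=> a u v; rewrite -{1}[u]sE -{1}[v]sE -linearP psiE linearP //.
have [a aE] := endo_scale (mklin lp); exists a => i.
by rewrite -aE mklinE -[w i]comb_delta psiE comb_delta.
Qed.

Variables (sigma : E) (ssig : socle sigma) (sig0 : sigma <> 0).

(** As the relations between minimal generators have coefficients in [m], sending
    one of them to [sigma] and the others to [0] respects the relations. *)
Lemma dual_generator j : exists s : R, (forall i, s *: w i = if i == j then sigma else 0) /\
  forall x : R, x \in m -> I (x * s).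
Proof.
have [|s sE] := endo_ex (y := fun i => if i == j then sigma else 0).
  move=> v /w_min vm; rewrite mklinE big1 // => i _.
  by case: eqP; rewrite ?scaler0 // => _; apply: ssig.
exists s; split=> // x xm; apply: faithful => y; have [v <-] := w_gen y.
rewrite mklinE scaler_sumr big1 // => i _.
rewrite scalerA mulrC -scalerA -[(x * s) *: w i]scalerA -sE.
by case: eqP => _; rewrite ?(ssig xm) ?scaler0.
Qed.

Definition second_layer (y : E) : Prop :=
  forall x1 x2 : R, x1 \in m -> x2 \in m -> x1 *: (x2 *: y) = 0.

(** Let [x y = h(x) sigma] for [x] in [m].  The map [v |-> h(v_i) s_j] from the
    relations of [w] to [R / I] is linear and extends to the free module; let
    [g] be the values of the extension at the basis.  Then sending [w_i'] to
    [g_i' w_j'], minus [y] if [(i', j') = (i, j)], respects the relations, so it is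
    multiplication by some [u_j']. *)
Lemma ext_relation i j (y : E) : second_layer y ->
  exists g u : 'I_r -> R, forall i' j',
    g i' *: w j' - (if (i' == i) && (j' == j) then y else 0) = u j' *: w i'.
Proof.
move=> y2; have [s [sw ms]] := dual_generator j.
have hex (x : R) : exists c : R, x \in m -> x *: y = c *: sigma.
  have [xm|xm] := boolP (x \in m); last by exists 0.
  have [|c cE] := socle_generated (t := x *: y) ssig _ sig0; last by exists c.
  by move=> t tm; apply: y2.
have [h hE] := choice hex.
have [||g gE] := ext (h := fun v => piA (h (v 0 i) * s : R)).
  move=> a u v /w_min/(_ i) um /w_min/(_ i) vm.
  apply/eqP; rewrite -linearP -subr_eq0 -raddfB; apply/eqP/piA0.
  rewrite -[a *: (_ : R^o)]/(a * _) mulrA -mulrDl -mulrBl.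
  apply: ms; apply: (scale_eq0_max sig0).
  have avm : (a *: u + v) 0 i \in m by rewrite !mxE; apply: rpredD => //; apply: mem_mulm.
  rewrite scalerBl scalerDl -scalerA -!hE //.
  by rewrite !mxE scalerDl scalerA subrr.
  move=> a u Ia; have am : (a *: u) 0 i \in m.
    by apply: (w_min (v := a *: u)); rewrite linearZ_LR IE.
  apply/piA0/ms/(scale_eq0_max sig0).
  by rewrite -hE // mxE -scalerA IE.
have [gl glE] := choice (fun i' => piA_surj (g (delta_mx 0 i'))).
have H j' : exists u : R, forall i', gl i' *: w j' - (if (i' == i) && (j' == j) then y else 0) = u *: w i'.
  apply: endo_ex => v v0; have vm := w_min v0; have := gE v v0.
  have -> : g v = piA (\sum_i' v 0 i' * gl i' : R).
    rewrite [v in LHS]row_sum_delta !linear_sum; apply: eq_bigr => i' _.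
    by rewrite linearZ_LR -glE -linearZ_LR.
  move/eqP; rewrite -subr_eq0 -raddfB => /eqP/piA0 Iv.
  have := IE (w j') Iv; rewrite scalerBl -scalerA sw => /eqP; rewrite subr_eq0 => /eqP e1.
  rewrite mklinE; under eq_bigr do rewrite scalerBr scalerA.
  rewrite sumrB -scaler_suml -e1 (bigD1 i) //= big1 ?addr0 => [|i' ii]; last first.
    by rewrite (negPf ii) scaler0.
  rewrite eqxx /=; case: eqP => _; last by rewrite !scaler0 subrr.
  by rewrite -hE // subrr.
have [u uE] := choice H; exists gl, u => i' j'; exact: uE.
Qed.

(** Suppose that there are two minimal generators [w_i] and [w_j].  Applied to
    [i = j], the relation shows that the elements killed by [m^2] are multiples of
    each [w_k].  Applied to [i] and [j], it writes such an element [y] as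
    [p w_j + p' w_i] with [p w_i = 0 = p' w_j].  An element that kills [w_i] kills
    [m E], all of whose elements are killed by [m^2] and hence multiples of [w_i].
    So [m y = 0]: the elements killed by [m^2] are killed by [m].  As [m E] is
    killed by [m^2], all of [E] is killed by [m^2], so [w_j] is a multiple of
    [w_i], against minimality. *)
Lemma one_generator (i j : 'I_r) : i == j.
Proof.
apply: contraT => ij.
have layer1 k y : second_layer y -> exists c : R, y = c *: w k.
  move=> y2; have [g [u /(_ k k)]] := ext_relation k k y2; rewrite eqxx /= => e.
  exists (g k - u k); rewrite scalerBl -e opprB addrC subrK //.
have mE (x : R) (y : E) : x \in m -> second_layer (x *: y).
  by move=> xm x1 x2 x1m x2m; rewrite !scalerA IE //; apply: I_m3.
have soc y : second_layer y -> socle y.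
  move=> y2; have [g [u H]] := ext_relation i j y2.
  have := H i i; rewrite eqxx (negPf ij) /= subr0 => e11.
  have := H j j; rewrite eqxx eq_sym (negPf ij) /= subr0 => e22.
  have := H i j; rewrite !eqxx /= => e12.
  have := H j i; rewrite eq_sym (negPf ij) /= subr0 => e21.
  have kill k (p : R) : p *: w k = 0 -> forall (x : R) (z : E), x \in m -> x *: (p *: z) = 0.
    move=> pk x z xm; have [c cE] := layer1 k _ (mE x z xm).
    by rewrite scalerA mulrC -scalerA cE scalerA mulrC -scalerA pk scaler0.
  have k1 := kill i (g i - u i); rewrite scalerBl e11 subrr in k1.
  have k2 := kill j (g j - u j); rewrite scalerBl e22 subrr in k2.
  have yE : y = (g i - u i) *: w j + (g j - u j) *: w i.
    by rewrite !scalerBl e21 -e12 addrA subrK opprB addrC subrK.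
  by move=> x xm; rewrite yE scalerDr k1 // k2 // addr0.
have E2 y : second_layer y.
  by move=> x1 x2 x1m x2m; apply: (soc _ (mE x2 y x2m)).
have [c cE] := layer1 i (w j) (E2 _).
have e0 : comb w (delta_mx 0 j - c *: delta_mx 0 i) = 0.
  by rewrite linearB linearZ_LR !comb_delta -cE subrr.
have := w_min e0 j.
rewrite !mxE eqxx [j == i]eq_sym (negPf ij) eqxx /= mulr0 subr0.
by rewrite (negPf (one_notin locR)).
Qed.
End Generators.
End Artinian.

(** * Minimal generators and regular sequences *)
Section Cyclic.
Variables (R : comNzRingType) (m : submodClosed R^o).
Hypothesis locR : local_ring m.

Lemma adjs_min (V : lmodType R) (f : seq R) (B S : V -> Prop) : submodP S ->
  (forall v, B v -> S v) -> (forall x v, x \in f -> S (x *: v)) ->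
  forall v, adjs f B v -> S v.
Proof.
move=> sS; elim: f B => [|x f IH] B BS fS v /=; first exact: BS.
apply: IH => [u [u' [b [Bb ->]]]|y u yf]; last by apply: fS; rewrite inE yf orbT.
by apply: (submodPD sS); [apply: fS; rewrite mem_head|apply: BS].
Qed.

(** A relation with a unit coefficient makes one generator superfluous. *)
Lemma minimal_generators (V : lmodType R) : fin_gen V ->
  exists r (w : 'I_r -> V), (forall y, exists v, comb w v = y) /\
    forall v, comb w v = 0 -> forall i, v 0 i \in m.
Proof.
move=> [s sP]; have : forall y, exists v, comb (fun i : 'I_(size s) => s`_i) v = y.
  by move=> y; apply/comb_span.
move: (fun i : 'I_(size s) => s`_i); elim: (size s) => [|r IH] w wg.
  by exists 0%N, w; split=> // v _ [].
have [wm|/existsNP[v /not_implyP[v0 /existsNP[i /negP vi]]]] :=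
    pselect (forall v, comb w v = 0 -> forall i, v 0 i \in m).
  by exists r.+1, w.
have [b bv] := unitP locR vi.
apply: (IH (fun j => w (lift i j))) => y; have [u <-] := wg y.
(* [v] expresses [w i] by the other generators. *)
exists (\row_j (u 0 (lift i j) - u 0 i * b * v 0 (lift i j))).
have {v0} : comb w (u - (u 0 i * b) *: v) = comb w u.
  by rewrite linearB linearZ_LR v0 scaler0 subr0.
rewrite !mklinE => <-; rewrite (bigD1_ord i) //= !mxE -mulrA bv mulr1 subrr scale0r add0r.
by apply: eq_bigr => j _; rewrite !mxE.
Qed.

(** The product [f K], as the smallest submodule with these elements, which
    avoids sums over two indices. *)
Definition product_ideal (f : seq R) (K : R^o -> Prop) (a : R^o) : Prop :=
  forall S : R^o -> Prop, submodP S -> (forall x k, x \in f -> K k -> S (x *: k)) -> S a.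

Lemma product_ideal_sub f K : submodP (product_ideal f K).
Proof.
split=> [S sS _|a u v uK vK S sS H]; first exact: submodP0.
by apply: (submodPD sS); [apply: (submodPZ sS); apply: uK|apply: vK].
Qed.

(** The intersection of [K] with [f R] is [f K] when [f] is regular modulo [K].
    This is the vanishing of [Tor_1(R / K, R / f R)]; the induction adds one
    element of [f] to [K] at a time. *)
Lemma regular_inter (f : seq R^o) (K : R^o -> Prop) a : submodP K ->
  mreg f K -> K a -> in_span f a -> product_ideal f K a.
Proof.
elim: f K a => [|x f IH] K a sK /=.
  by move=> _ _ /in_span_nil-> S sS _; apply: (submodP0 sS).
move=> [regx regf] Ka /in_span_cons[r [b [fb aE]]].
have sx := adj_sub x sK.
have pb : product_ideal f (adj x K) b.
  apply: IH => //; exists (- r : R^o), a; split=> //.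
  by rewrite aE scalerN addrA -[x *: (r : R^o)]/(x * r) mulrC addNr add0r.
have [s [r' [sFK bE]]] : exists s (r' : R^o), product_ideal f K s /\ b = s + x *: r'.
  apply: (pb (fun b => exists s (r' : R^o), product_ideal f K s /\ b = s + x *: r')).
  - have sFK := product_ideal_sub f K.
    split=> [|c _ _ [s [u [sF ->]]] [s' [u' [sF' ->]]]].
      by exists 0, 0; rewrite scaler0 addr0; split=> //; apply: (submodP0 sFK).
    exists (c *: s + s'), (c *: u + u'); split; first by case: sFK => _; apply.
    by rewrite !scalerDr !scalerA [x * c]mulrC addrACA.
  move=> y k yf [u [k' [Kk' ->]]]; exists (y *: k'), (y *: u); split.
    by move=> S sS H; apply: H.
  by rewrite scalerDr addrC !scalerA [x * y]mulrC.
have Ks : K s by apply: sFK => // y k _ Kk; apply: (submodPZ sK).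
have aE2 : a = x *: ((r : R^o) + r') + s.
  by rewrite aE bE scalerDr -[x *: (r : R^o)]/(x * r) mulrC [s + _]addrC addrA.
have Kr : K ((r : R^o) + r').
  by apply: regx; rewrite -(addrK s (x *: _)) -aE2; apply: (submodPB sK).
move=> S sS H; rewrite aE2; apply: (submodPD sS); first by apply: H; rewrite ?mem_head.
by apply: sFK => // y k yf Kk; apply: H => //; rewrite inE yf orbT.
Qed.

(** Here [K = K /\ f R = f K], and Nakayama's lemma applies. *)
Lemma ideal_zero (f : seq R^o) (K : R^o -> Prop) : submodP K ->
  (forall x, x \in f -> x \in m) -> mreg f K ->
  (forall a, K a -> in_span f a) -> forall a, K a -> a = 0.
Proof.
move=> sK fm regf Kf; have [s sP] := local_noeth locR (psub sK).
have {}sP a : K a <-> in_span s a by rewrite -(sP a) psubE.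
move=> a /sP; apply: (nakayama locR (zero_subP R^o)) => x xs.
exists 0, x; rewrite add0r; split=> //.
have Kx : K x by apply/sP/in_span_gen.
apply: (regular_inter sK regf Kx (Kf _ Kx)); first exact: (max_mul_sub m).
by move=> y k yf /sP; apply: max_mul_scale; apply: fm.
Qed.
End Cyclic.

(** * The canonical module is free *)
Section OmegaFree.
Variables (R : comNzRingType) (m : submodClosed R^o).
Hypothesis locR : local_ring m.
Variables (f : seq R^o) (Z : lmodType R) (B : Z -> Prop) (sB : submodP B).
Hypotheses (regf : regular_sequence f) (m3 : cube_in m (in_span f)).
Notation w := (quo sB).
Hypotheses (fgw : fin_gen w) (mregw : @mreg R _ f B)
  (faithw : forall a : R, (forall z : Z, @adjs R _ f B (a *: z)) -> in_span f (a : R^o)).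
Variables (K0 : gmod R) (e0 : {linear K0 -> residue_field m}).
Hypotheses (res0 : resolves e0) (null0 : forall n, n != - (size f)%:Z -> null K0 (stg w) n)
  (thin0 : thin m K0 (stg w) (- (size f)%:Z)).
Variables (P : gmod R) (e : {linear P -> w}).
Hypotheses (resP : resolves e)
  (extP : forall i : nat, (0 < i <= (size f).+1)%N -> null P (stg R^o) (- i%:Z)).

Let fm : forall x, x \in f -> x \in m.
Proof. by move=> x xf; apply: (regular_in_max locR regf). Qed.


Lemma adjs_scale (V : lmodType R) (C : V -> Prop) a v : submodP C ->
  in_span f a -> @adjs R _ f C ((a : R) *: v).
Proof.
move=> sC; have sA := @adjs_sub R _ f _ sC.
apply: (in_span_min (submodP_preim (scale_at v) sA)) => x xf.
rewrite scale_atE; elim: f C sC {sA} xf => // y g IH C sC; rewrite inE => /orP[/eqP->|xg] /=.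
  by apply: adjs_mem; apply: adj_gen.
by apply: IH => //; apply: adj_sub.
Qed.

(** The reduction [E = w / f w] satisfies the hypotheses on faithful modules with
    simple socle: the vanishing of [Ext] of [w] up to degree [size f + 1] gives
    [Ext^1(w, R / f R) = 0].  So [E] is cyclic, and [w] is cyclic by Nakayama's
    lemma. *)
Lemma canonical_cyclic : exists z0 : Z, forall z, exists a : R, B (z - a *: z0).
Proof.
have sA := @adjs_sub R _ f _ sB.
have [p pE] := @quo_proj R Z _ _ sB sA (@adjs_mem _ _ f B).
have psurj y : exists x, p x = y.
  by have [z <-] := qp_surj y; exists (qp sB z); rewrite pE.
have fgE : fin_gen (quo sA : lmodType R).
  have [s sP] := fgw; exists [seq p x | x <- s] => y; have [x <-] := psurj y.
  exact: in_span_map.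
have [r [g [gg gm]]] := minimal_generators locR fgE.
have sI := in_span_sub f.
have IE (a : R) (y : quo sA) : in_span f (a : R^o) -> a *: y = 0.
  by move=> fa; have [z <-] := qp_surj y; rewrite -linearZ_LR; apply/qp_eq0/adjs_scale.
have faithE (a : R) : (forall y : quo sA, a *: y = 0) -> in_span f (a : R^o).
  move=> ay; apply: faithw => z; apply/(qp_eq0 sA); by rewrite linearZ_LR ay.
have sK0 : semifree K0 by case: res0.
have nne (i : nat) : (i < size f)%N -> - i%:Z != - (size f)%:Z.
  by rewrite eqr_opp eqz_nat; move/ltn_eqF => ->.
have thinE := socle_thin res0 (thin_iter (sA := sA) sK0 mregw
  (fun i fi => null0 (nne i fi)) thin0).
pose sJ := @adjs_sub R _ f _ (@zero_subP R R^o).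
have nP : null P (stg (quo sJ)) (- 1).
  have [sP _ _] := resP.
  apply: (null_iter sP (regular_mreg regf) (sB := @zero_subP R R^o)) => i fi.
  have [//|v vE] := @quo_lift R _ _ (@zero_subP R R^o) _ (idfun : {linear R^o -> R^o}).
  apply: (@null_retract R P (stg R^o) (stg (quo (@zero_subP R R^o))) _
    (qp (@zero_subP R R^o)) v _ _ _ (extP fi)).
  - exact: stg_chmap.
  - exact: stg_chmap.
  - by move=> y; have [a <-] := qp_surj y; rewrite vE.
have [wh whE] := choice (fun i => psurj (g i)).
have pcomb v : p (comb wh v) = comb g v.
  by rewrite !mklinE linear_sum; apply: eq_bigr => i _; rewrite linearZ_LR whE.
have sim (V : lmodType R) (t : {linear 'rV[R]_r -> V}) : submodP (fun y => exists v, t v = y).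
  split=> [|a _ _ [u <-] [v <-]]; first by exists 0; rewrite raddf0.
  by exists (a *: u + v); rewrite linearP.
(* By Nakayama's lemma the [wh i] generate the canonical module. *)
have whg y : exists v, comb wh v = y.
  have [s sP] := fgw; apply: (nakayama locR (sim _ (comb wh)) (s := s)) (sP y) => x xs.
  have [v vE] := gg (p x); exists (comb wh v), (x - comb wh v).
  rewrite [comb wh v + _]addrC subrK; split=> //; first by exists v.
  have [z zE] := qp_surj (x - comb wh v); rewrite -zE.
  apply: (@adjs_min R Z f B (fun z => max_mul m s (qp sB z)) _ _ _ z) => [|b Bb|a u af|].
  - exact: submodP_preim (max_mul_sub m s).
  - by rewrite (proj2 (qp_eq0 sB b) Bb); apply: (submodP0 (max_mul_sub m s)).
  - by rewrite linearZ_LR; apply: max_mul_scale; [exact: fm|exact: sP].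
  by apply/(qp_eq0 sA); rewrite -pE zE linearB pcomb vE subrr.
(* The vanishing is that of [Ext^1(w, R / f R)] over [R], while relations of [E]
   rather than of [w] are involved: these differ by [f] times the free module, on
   which the map [h] is zero. *)
have ext (h : 'rV[R]_r -> quo sJ) :
    (forall a u v, comb g u = 0 -> comb g v = 0 -> h (a *: u + v) = a *: h u + h v) ->
    (forall (a : R) u, in_span f (a : R^o) -> h (a *: u) = 0) ->
    exists t : {linear 'rV[R]_r -> quo sJ}, forall v, comb g v = 0 -> h v = t v.
  move=> hl hf; have gwh v : comb wh v = 0 -> comb g v = 0 by rewrite -pcomb => ->; rewrite raddf0.
  have [a u v u0 v0|t tE] := hom_extension resP nP whg (h := h).
    by apply: hl; apply: gwh.
  exists t; pose T v := comb g v = 0 /\ h v = t v.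
  have sT : submodP T.
    split=> [|a u v [gu hu] [gv hv]].
      by split; [exact: raddf0|rewrite tE ?raddf0].
    by split; [rewrite linearP gu gv scaler0 addr0|rewrite hl // linearP hu hv].
  have Tker v : comb wh v = 0 -> T v by move=> v0; split; [exact: gwh|exact: tE].
  move=> v gv; have [z zE] := qp_surj (comb wh v).
  have [||||u [Tu uz]] := @adjs_min R Z f B (fun z => exists u, T u /\ comb wh u = qp sB z) _ _ _ z.
  - split=> [|a x y [u [Tu uE]] [u' [Tu' u'E]]].
      by exists 0; rewrite !raddf0; split=> //; exact: (submodP0 sT).
    exists (a *: u + u'); rewrite !linearP uE u'E; split=> //.
    by case: sT => _; apply.
  - move=> b Bb; exists 0; rewrite raddf0 (proj2 (qp_eq0 sB b) Bb); split=> //.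
    exact: (submodP0 sT).
  - move=> x y xf; have [u uE] := whg (qp sB y); exists (x *: u).
    rewrite !linearZ_LR uE; split=> //; have fx : in_span f (x : R^o) by exact: in_span_gen.
    split; first by rewrite linearZ_LR IE.
    rewrite hf // linearZ_LR; have [a <-] := qp_surj (t u).
    by rewrite -linearZ_LR; apply/esym/qp_eq0; apply: adjs_scale => //; exact: zero_subP.
  - by apply/(qp_eq0 sA); rewrite -pE zE pcomb.
  have Tv : T (v - u) by apply: Tker; rewrite linearB uz zE subrr.
  by have [_] := submodPD sT Tv Tu; rewrite subrK.
have [i _] : exists i : 'I_r, True.
  case: r g gg {gm wh whE pcomb whg ext sim} => [|n] g gg; last by exists ord0.
  case: regf => /(_ _)[]; apply: faithE => y; have [v <-] := gg y.
  by rewrite mklinE big_ord0 scaler0.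
have gi0 : g i <> 0.
  move=> gi; have := gm (delta_mx 0 i); rewrite comb_delta => /(_ gi i).
  by rewrite mxE !eqxx (negPf (one_notin locR)).
have [c [nc mc]] := socle_mod m3 (zero_subP (quo sA)) (IE : forall a y, _ -> zero_sub _) gi0.
have piA0 a : qp sJ a = 0 <-> in_span f a by rewrite qp_eq0; apply: adjs0_span.
have one j : j == i.
  exact: (one_generator locR sI m3 IE faithE thinE gg gm piA0 (@qp_surj _ _ _ sJ) ext
    (sigma := c *: g i) mc nc j i).
have [z0 z0E] := qp_surj (wh i); exists z0 => z; have [v vE] := whg (qp sB z).
exists (v 0 i); apply/qp_eq; rewrite -vE linearZ_LR z0E mklinE (bigD1 i) //= big1 ?addr0 // => j.
by rewrite (one j).
Qed.

(** The annihilator of the cyclic module [w] acts as [0] on [w / f w], so it is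
    contained in [f R] by faithfulness, and [f] is regular modulo it. *)
Lemma canonical_annihilator (z0 : Z) : (forall z, exists a : R, B (z - a *: z0)) ->
  forall a : R, B (a *: z0) -> a = 0.
Proof.
move=> z0P; pose t := scale_at z0.
have sK : submodP (fun a : R^o => B ((a : R) *: z0)) := submodP_preim t sB.
apply: (ideal_zero locR sK fm (mreg_transport (t := t) sB _ mregw)).
  by move=> z; have [a aB] := z0P z; exists a.
move=> a Ba; apply: faithw => z; apply: adjs_mem.
have [b bB] := z0P z; rewrite -(subrK (b *: z0) z) scalerDr.
apply: (submodPD sB); first exact: (submodPZ sB).
by rewrite scalerA mulrC -scalerA; apply: (submodPZ sB).
Qed.

(** So [R] is isomorphic to its canonical module [w]. *)
Lemma null_ring n : n != - (size f)%:Z -> null K0 (stg R^o) n.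
Proof.
move=> nf; have [z0 z0P] := canonical_cyclic; have ann := canonical_annihilator z0P.
pose u : {linear R^o -> w} := qp sB \o scale_at z0.
have uinj (a : R^o) : u a = 0 -> a = 0 by move=> /qp_eq0/ann.
have usurj y : exists a, u a = y.
  have [z <-] := qp_surj y; have [a aB] := z0P z; exists a.
  by apply/esym/qp_eq.
have [v vE] := choice usurj.
have uv a : v (u a) = a.
  by apply/eqP; rewrite -subr_eq0; apply/eqP/uinj; rewrite linearB vE subrr.
have lv : linear v.
  move=> a x y; rewrite -[LHS](subrK (a *: v x + v y)) -[RHS]add0r; congr (_ + _).
  by apply: uinj; rewrite linearB linearP !vE subrr.
apply: (@null_retract R K0 (stg w) (stg R^o) n (mklin lv) u) (null0 nf).
- exact: stg_chmap.
- exact: stg_chmap.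
- exact: uv.
Qed.
End OmegaFree.

Section AllIdeals.
Variables (R : comNzRingType) (m : submodClosed R^o).
Hypothesis locR : local_ring m.
Let noethR := local_noeth locR.
Variables (K0 : gmod R) (e0 : {linear K0 -> residue_field m}).
Hypothesis res0 : resolves e0.

(** A map out of a finitely generated term is determined by its values at
    generators, so the cocycles embed in a free module. *)
Lemma fg_terms_cohomology (K : gmod R) : fg_terms K -> fg_cohomology K (stg R^o).
Proof.
move=> fK n; have [s sP] := fK (- n).
have lev : linear (fun T : K -> stg R^o => \row_(j < size s) (T s`_j : R)).
  by move=> a T U; apply/rowP => j; rewrite !mxE.
pose ev := mklin lev.
have [t tP] := fg_submodule noethR (submodP_im ev (cyc_sub K (stg R^o) n)) (fun x _ => row_span x).
have [us [usc usE]] := lift_seq (f := ev) (fun x xt => proj2 (tP x) (in_span_gen xt)).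
exists us; split=> // T cT.
have : in_span [seq ev U | U <- us] (ev T) by rewrite usE; apply/tP; exists T.
case/in_span_map_inv => b ub bT; exists b => //.
have cb : cyc n b := in_span_min (cyc_sub _ _ n) usc ub.
have cD := submodPB (cyc_sub _ _ n) cT cb.
have [D DE] := cyc_lin cD.
have D0 x : D x = 0.
  move: cD; rewrite DE => /stg_cyc[Dp _]; rewrite -Dp.
  apply: (in_span_min (S := fun x => D x = 0) _ _ (sP x)).
    by split=> [|a y z y0 z0]; rewrite ?raddf0 // linearP y0 z0 scaler0 addr0.
  move=> y /(nthP 0)[j js <-]; have := congr1 (fun r : 'rV_(size s) => r 0 (Ordinal js)) bT.
  by rewrite !mxE /= -DE => bTj; apply/eqP; rewrite -[(T - b) _]/(T s`_j - b s`_j) subr_eq0 bTj.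
have -> : T - b = 0 by rewrite DE; apply: funext => x; exact: D0.
exact: submodP0 (bnd_sub _ _ n).
Qed.

(** Noetherian induction, now over all ideals [J]: if some [x] in [m] outside of
    [J] is a zero divisor modulo [J], both [(J : x)] and [J + x R] are larger than
    [J]; otherwise Nakayama's lemma reduces the claim to [J + x R] in the next
    degree. *)
Lemma ext_vanish_all (M : int) : (forall n, n < M -> null K0 (stg R^o) n) ->
  forall J : R^o -> Prop, submodP J -> forall (sJ : submodP J) (K : gmod R) (e : {linear K -> quo sJ}),
  resolves e -> forall n, n < M -> null K (stg R^o) n.
Proof.
move=> n0; apply: (ideal_ind noethR) => J _ IH sJ.
suff [K1 [e1 [r1 n1]]] : exists (K : gmod R) (e : {linear K -> quo sJ}), resolves e /\
    forall n, n < M -> null K (stg R^o) n.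
  by move=> K e rK n nM; apply: (null_iso (f := idfun) (g := idfun) r1 rK) (n1 n nM).
have [K [e [rK fgK]]] := quo_resolution locR sJ; exists K, e; split=> // n nM.
case: (ideal_cases locR (I0 := @zero_sub R R^o) sJ) => [r ->|J1|Jm|[Jm [x xm nx]]].
- exact: submodP0 sJ.
- apply: null_exact_source; first by case: rK.
  apply: (resolves_zero_exact rK) => y; have [r <-] := qp_surj y; apply/qp_eq0.
  by have := submodPZ sJ r J1; rewrite -[r *: _]/(r * 1) mulr1.
- have [f [g [fg _ _]]] := residue_iso sJ Jm.
  exact: (null_iso (f := f) (g := g) res0 rK fg (n0 n nM)).
have sa := adj_sub x sJ.
have nadj (L : gmod R) (eL : {linear L -> quo sa}) i : resolves eL -> i < M -> null L (stg R^o) i.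
  move=> rL; apply: (IH _ sa _ _ sa L eL rL) => [r Jr|]; first exact: adj_mem.
  by exists x => //; exact: adj_self.
have [[r Jxr nJr]|nzd] := pselect (exists2 r, colon x J r & ~ J r).
  have sc := colon_sub x sJ.
  have [F [eF [rF _]]] := quo_resolution locR sc.
  have [a [ha [ea [g [rea _ _]]]]] := colon_cone sa rF rK.
  apply: (@null_cone_mid R F K _ a ha); last exact: nadj rea nM.
  apply: (IH _ sc _ _ sc F eF rF n nM) => [r' Jr'|]; last by exists r.
  exact: (submodPZ sJ).
have regx v : J (x *: v) -> J v by move=> Jv; apply: contrapT => nv; apply: nzd; exists v.
have [ea rea] := regular_cone sa regx rK; set ha := (covers_scl e x).1 in ea rea.
apply: (nakayama_cone locR (hx := ha) xm (fg_terms_cohomology fgK)).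
by apply: (nadj _ _ _ rea); lia.
Qed.
End AllIdeals.

(** * Injective modules *)

Section Baer.
Variables (R : comNzRingType) (C : lmodType R).

(** A linear map defined on a submodule, as a total function with arbitrary values
    elsewhere; this avoids the type of the submodule. *)
Definition linear_on (V W : lmodType R) (S : V -> Prop) (h : V -> W) : Prop :=
  forall a u v, S u -> S v -> h (a *: u + v) = a *: h u + h v.

Lemma linear_on0 (V W : lmodType R) (S : V -> Prop) (h : V -> W) :
  submodP S -> linear_on S h -> h 0 = 0.
Proof.
move=> sS hl; have S0 := submodP0 sS; have := hl (-1) 0 0 S0 S0.
by rewrite scaler0 addr0 scaleN1r addNr.
Qed.

(** Injectivity of [C] for the inclusions of submodules. *)
Definition extends : Prop :=
  forall (B : lmodType R) (S : B -> Prop) (h : B -> C), submodP S -> linear_on S h ->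
  exists H : {linear B -> C}, forall b, S b -> H b = h b.

Lemma extends_injective : extends -> injective_module C.
Proof.
move=> eC A B g f gi.
have sI : submodP (fun b => exists2 a, True & g a = b) by exact: submodP_im.
have /choice[h hE] : forall b, exists c, forall a, g a = b -> f a = c.
  move=> b; have [[a <-]|n] := pselect (exists a, g a = b).
    by exists (f a) => a' /gi->.
  by exists 0 => a ab; case: n; exists a.
have [|H HE] := eC B _ h sI.
  move=> r _ _ [u _ <-] [v _ <-].
  by rewrite -(hE _ u erefl) -(hE _ v erefl) -linearP; rewrite -(hE _ (r *: u + v)) ?linearP.
by exists H => x; rewrite HE; [rewrite -(hE _ x)|exists x].
Qed.

Definition baer : Prop :=
  forall (J : R^o -> Prop) (h : R^o -> C), submodP J -> linear_on J h ->
  exists y, forall r, J r -> h r = r *: y.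

Section Maximal.
Hypothesis baerC : baer.
Variables (B : lmodType R) (S : B -> Prop) (h : B -> C).
Hypotheses (sS : submodP S) (hl : linear_on S h).

(* Graphs of linear maps extending [h] to a larger submodule.  Zorn's lemma is
   applied to them and to the empty set, which is the union of the empty chain. *)
Let good (G : set (B * C)) : Prop :=
  [/\ submodP G, forall c, G (0, c) -> c = 0 & forall b, S b -> G (b, h b)].

Lemma baer_maximal_graph :
  exists G, good G /\ forall G', good G' -> (G `<=` G')%classic -> (G' `<=` G)%classic.
Proof.
have good0 : good [set p | S p.1 /\ p.2 = h p.1]%classic.
  split=> [|c [_ /= ->]|//]; last exact: linear_on0 hl.
  split=> [|a [b1 c1] [b2 c2] [/= s1 ->] [/= s2 ->]] /=.
    by split; [exact: submodP0|rewrite (linear_on0 sS hl)].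
  by rewrite hl //; split=> //; apply: (submodPD sS) => //; apply: (submodPZ sS).
have [F FP tF|G [[G0|gG] Gmax]] := @Zorn_bigcup _ (fun G => G = set0 \/ good G).
- have [[G1 FG1 gG1]|n] := pselect (exists2 G, F G & good G); last first.
    left; apply/seteqP; split=> // p [G FG Gp]; case: (FP G FG) => [GE|gG].
      by rewrite GE in Gp.
    by case: n; exists G.
  right; split.
  + split=> [|a p q [X FX Xp] [Y FY Yq]]; first by exists G1 => //; case: gG1 => /submodP0.
    suff [Z [FZ Zp Zq]] : exists Z, [/\ F Z, Z p & Z q].
      exists Z => //; case: (FP Z FZ) => [ZE|[sZ _ _]]; first by rewrite ZE in Zp.
      by apply: (submodPD sZ) => //; apply: (submodPZ sZ).
    by case: (tF X Y FX FY) => XY; [exists Y|exists X]; split=> //; apply: XY.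
  + move=> c [X FX Xc]; case: (FP X FX) => [XE|[_ X0 _]]; first by rewrite XE in Xc.
    exact: X0.
  + by move=> b Sb; exists G1 => //; case: gG1 => _ _; apply.
- case: (Gmax _ _ (or_intror good0)); rewrite G0; split=> // /(_ (0, 0)) /=; apply.
  by split; [exact: submodP0|rewrite (linear_on0 sS hl)].
- exists G; split=> // G' gG' GG'; apply: contrapT => n.
  by case: (Gmax _ _ (or_intror gG')).
Qed.

Lemma baer_extends_one : exists H : {linear B -> C}, forall b, S b -> H b = h b.
Proof.
have [G [[sG G0 hG] Gmax]] := baer_maximal_graph.
have uG b c c' : G (b, c) -> G (b, c') -> c = c'.
  move=> g1 g2; apply/eqP; rewrite -subr_eq0; apply/eqP/G0.
  by have := submodPB sG g1 g2; rewrite -[_ - _]/(b - b, c - c') subrr.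
have tot b : exists c, G (b, c).
  pose J (r : R^o) := exists c, G (r *: b, c).
  have sJ : submodP J.
    split=> [|a r s [c Gc] [c' Gc']]; first by exists 0; rewrite scale0r; exact: submodP0 sG.
    exists (a *: c + c'); have := submodPD sG (submodPZ sG a Gc) Gc'.
    by rewrite -[X in G X -> _]/(a *: (r *: b) + s *: b, a *: c + c') scalerDl scalerA.
  have /choice[k kE] : forall r : R^o, exists c, J r -> G (r *: b, c).
    move=> r; have [[c Gc]|n] := pselect (J r); first by exists c.
    by exists 0 => /n.
  have [|y yE] := baerC (h := k) sJ.
    move=> a r s Jr Js; apply: uG (kE _ _) _; first exact: (submodPD sJ (submodPZ sJ a Jr) Js).
    have := submodPD sG (submodPZ sG a (kE _ Jr)) (kE _ Js).
    by rewrite -[X in G X -> _]/(a *: (r *: b) + s *: b, a *: k r + k s) scalerDl scalerA.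
  (* The maximal map extends by [b |-> y], which agrees with it on [J b]. *)
  pose G' (p : B * C) := exists r, G (p.1 - r *: b, p.2 - r *: y).
  have GG' : (G `<=` G')%classic.
    by move=> [u c] Gu; exists 0; rewrite /= !scale0r !subr0.
  exists y; apply: (Gmax G' _ GG'); last first.
    by exists 1; rewrite /= !scale1r !subrr; exact: submodP0 sG.
  split=> [|c [r /=]|u Su]; last by apply: GG'; apply: hG.
    split=> [|a [u c] [u' c'] [r /= Gr] [s /= Gs]]; first exact/GG'/(submodP0 sG).
    exists (a * r + s); have := submodPD sG (submodPZ sG a Gr) Gs.
    rewrite -[X in G X -> _]/(a *: (u - r *: b) + (u' - s *: b), a *: (c - r *: y) + (c' - s *: y)).
    by congr (G (_, _)); rewrite /= scalerBr scalerDl opprD addrACA scalerA.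
  rewrite sub0r => Gr.
  have Gc : G (r *: b, r *: y - c).
    by have := submodPN sG Gr; rewrite -[- _]/(- - (r *: b), - (c - r *: y)) opprK opprB.
  have Jr : J r by exists (r *: y - c).
  have := uG _ _ _ (kE r Jr) Gc; rewrite (yE r Jr) => E; apply/eqP; rewrite -oppr_eq0.
  by apply/eqP; apply: (addrI (r *: y)); rewrite -E addr0.
have /choice[H HE] := tot.
have lH : linear H.
  move=> a u v; apply: uG (HE _) _.
  by have := submodPD sG (submodPZ sG a (HE u)) (HE v).
by exists (mklin lH) => b Sb; apply: uG (HE b) (hG b Sb).
Qed.
End Maximal.

(** Baer's criterion: a maximal partial extension of a map is total, because it
    extends to any further element along the ideal of its multiples that are
    already in the domain. *)
Lemma baer_extends : baer -> extends.
Proof. by move=> bC B S h sS hl; apply: baer_extends_one. Qed.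
End Baer.

(** * Enough injective modules *)

Lemma int_ideal_principal (J : int^o -> Prop) : submodP J ->
  exists2 n : int, J n & forall r, J r -> exists k, r = k * n.
Proof.
move=> sJ; have [[n0 [Jn0 n0n]]|z] := pselect (exists n, J n /\ n != 0); last first.
  exists 0 => [|r Jr]; first exact: submodP0 sJ.
  exists 0; rewrite mul0r; apply: contrapT => /eqP rn; by case: z; exists r.
have ex : exists k, `[< exists n : int, [/\ J n, n != 0 & `|n|%N = k] >].
  by exists `|n0|%N; apply/asboolP; exists n0.
case: (ex_minnP ex) => k /asboolP[n [Jn nn <-]] min; exists n => // r Jr.
exists (r %/ n)%Z; rewrite {1}(divz_eq r n); set s := (r %% n)%Z.
suff -> : s = 0 by rewrite addr0.
apply: contrapT => /eqP sn; have := ltz_pmod r (d := `|n|) _.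
rewrite normr_gt0 => /(_ nn); rewrite modz_abs -/s => sl.
have s0 : 0 <= s by exact: modz_ge0.
have Js : J s.
  have -> : s = - (r %/ n)%Z *: (n : int^o) + r.
    by rewrite [X in _ + X](divz_eq r n) -[_ *: _]/(- (r %/ n)%Z * n) mulNr addKr.
  exact: (submodPD sJ (submodPZ sJ _ Jn) Jr).
have : (`|n| <= `|s|)%N by apply: min; apply/asboolP; exists s.
by rewrite -(gez0_abs s0) // -abszE in sl *; lia.
Qed.

Section Divisible.

Definition integers (q : (zmodule rat : lmodType int)) : Prop := exists k : int, q = k%:~R.

Lemma integers_sub : submodP integers.
Proof.
split=> [|a x y [k ->] [l ->]]; first by exists 0.
by exists (a * k + l); rewrite scalezrE -mulrzr intrD intrM mulrC.
Qed.

Definition QZ : lmodType int := quo integers_sub.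

(** The group [Q / Z] is divisible, and ideals of integers are principal. *)
Lemma QZ_baer : baer QZ.
Proof.
move=> J h sJ hl; have [n Jn nP] := int_ideal_principal sJ.
have [u uE] := qp_surj (h n).
have h0 := linear_on0 sJ hl.
have hZ k : h (k *: (n : int^o)) = k *: h n.
  by have := hl k n 0 Jn (submodP0 sJ); rewrite addr0 h0 addr0.
have [n0|nn] := eqVneq n 0.
  by exists 0 => r /nP[k ->]; rewrite n0 mulr0 h0 scaler0.
exists (qp integers_sub (n%:~R^-1 * u)) => r /nP[k ->].
rewrite [LHS]hZ -uE; have nq : n%:~R != 0 :> rat by rewrite intr_eq0.
have E : k *: u = (k * n) *: (n%:~R^-1 * u : zmodule rat).
  have E (a b c : rat) : b != 0 -> c * a = (b^-1 * c) * (a * b) by move=> b0; field.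
  by rewrite [LHS]scalezrE [RHS]scalezrE -[LHS]mulrzr -[RHS]mulrzr intrM; exact: E.
by rewrite -[RHS](linearZ_LR (qp integers_sub)) -[LHS](linearZ_LR (qp integers_sub)) E.
Qed.

(** The subgroup generated by [x] maps nontrivially to [Q / Z], and the map
    extends by injectivity. *)
Lemma QZ_separates (M : lmodType int) (x : M) : x != 0 ->
  exists t : {linear M -> QZ}, t x != 0.
Proof.
move=> xn; have sA : submodP (fun k : int^o => k *: x = 0).
  split=> [|a k l k0 l0]; first by rewrite scale0r.
  by rewrite scalerDl -scalerA k0 l0 scaler0 addr0.
have [n n0 nP] := int_ideal_principal sA.
(* The class of [1 / n] if [x] has order [n], and that of [1 / 2] if [x] has
   infinite order. *)
have [q [nq q0]] : exists q : QZ, n *: q = 0 /\ q != 0.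
  have [nz|nn] := eqVneq n 0.
    exists (qp integers_sub 2%:R^-1); rewrite nz scale0r; split=> //.
    apply/eqP => /qp_eq0[k kE].
    have : (1 : int)%:~R = (2 * k)%:~R :> rat.
      by rewrite intrM -kE divff.
    by move=> /intr_inj; lia.
  have nr : n%:~R != 0 :> rat by rewrite intr_eq0.
  exists (qp integers_sub n%:~R^-1); split.
    rewrite -linearZ_LR; apply/qp_eq0; exists 1.
    by rewrite /= scalezrE -mulrzr mulVf.
  apply/eqP => /qp_eq0[k kE].
  have : (1 : int)%:~R = (n * k)%:~R :> rat by rewrite intrM -kE divff.
  move=> /intr_inj nk; case/eqP: xn.
  have -> : x = (k * n) *: x by rewrite mulrC -nk scale1r.
  by rewrite -scalerA n0 scaler0.
have kq k l : k *: x = l *: x -> k *: q = l *: q.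
  move=> kl; have [|j jE] := nP (k - l); first by rewrite scalerBl kl subrr.
  by apply/eqP; rewrite -subr_eq0 -scalerBl jE -scalerA nq scaler0.
have /choice[h hE] : forall y : M, exists c : QZ, forall k, y = k *: x -> c = k *: q.
  move=> y; have [[k ->]|n'] := pselect (exists k, y = k *: x).
    by exists (k *: q) => l /kq.
  by exists 0 => k yE; case: n'; exists k.
have sS : submodP (fun y => exists k, y = k *: x).
  split=> [|a _ _ [k ->] [l ->]]; first by exists 0; rewrite scale0r.
  by exists (a * k + l); rewrite scalerDl scalerA.
have [|t tE] := baer_extends QZ_baer (h := h) sS.
  move=> a _ _ [k ->] [l ->]; rewrite (hE (k *: x) k erefl) (hE (l *: x) l erefl).
  by rewrite (hE _ (a * k + l)) ?scalerDl ?scalerA.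
exists t; rewrite tE; last by exists 1; rewrite scale1r.
by rewrite (hE x 1) ?scale1r.
Qed.
End Divisible.

Section Characters.
Variable R : comNzRingType.

Definition additive_fun (T : R -> QZ) : Prop := forall x y, T (x + y) = T x + T y.

Lemma additive_fun_sub :
  @submodP int (product_module (fun _ : R => QZ)) additive_fun.
Proof.
split=> [|a T S hT hS] x y; first by rewrite -[LHS]/0 -[RHS]/(0 + 0) addr0.
rewrite -[LHS]/(a *: T (x + y) + S (x + y)) -[RHS]/((a *: T x + S x) + (a *: T y + S y)).
by rewrite hT hS scalerDr addrACA.
Qed.

(** The character module [Hom_Z(R, Q / Z)].  The alias gives it the scalar action
    of [R], by multiplication in the source, next to the one of the integers. *)
Definition chr : Type := submodule (psub additive_fun_sub).
HB.instance Definition _ := GRing.Zmodule.on chr.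

Definition chr_fun (T : chr) : R -> QZ := val T.

Lemma chr_add (T : chr) x y : chr_fun T (x + y) = chr_fun T x + chr_fun T y.
Proof. by have /psubE hT := valP T; apply: hT. Qed.

Lemma chrP (T S : chr) : (forall x, chr_fun T x = chr_fun S x) -> T = S.
Proof. by move=> TS; apply: val_inj; apply: functional_extensionality_dep. Qed.

Lemma mkchr_subproof (T : R -> QZ) (hT : additive_fun T) :
  (T : product_module (fun _ : R => QZ)) \in psub additive_fun_sub.
Proof. exact/psubE. Qed.
Definition mkchr T (hT : additive_fun T) : chr := Sub (T : product_module (fun _ : R => QZ)) (mkchr_subproof hT).

Lemma mkchrE T (hT : additive_fun T) x : chr_fun (mkchr hT) x = T x. Proof. by []. Qed.

Lemma chr_scale_subproof (a : R) (T : chr) : additive_fun (fun x => chr_fun T (x * a)).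
Proof. by move=> x y; rewrite mulrDl chr_add. Qed.
Definition chr_scale a T : chr := mkchr (chr_scale_subproof a T).

Lemma chr_funD (T S : chr) x : chr_fun (T + S) x = chr_fun T x + chr_fun S x.
Proof. by []. Qed.

Lemma chr_scaleA a b T : chr_scale a (chr_scale b T) = chr_scale (a * b) T.
Proof. by apply: chrP => x; rewrite !mkchrE mulrA. Qed.
Lemma chr_scale1 : left_id 1 chr_scale.
Proof. by move=> T; apply: chrP => x; rewrite mkchrE mulr1. Qed.
Lemma chr_scaleDr : right_distributive chr_scale +%R.
Proof. by move=> a T S; apply: chrP. Qed.
Lemma chr_scaleDl T : {morph chr_scale^~ T : a b / a + b}.
Proof. by move=> a b; apply: chrP => x; rewrite chr_funD !mkchrE mulrDr chr_add. Qed.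
HB.instance Definition _ := GRing.Zmodule_isLmodule.Build R chr
  chr_scaleA chr_scale1 chr_scaleDr chr_scaleDl.

Lemma chr_funZ a (T : chr) x : chr_fun (a *: T) x = chr_fun T (x * a).
Proof. by []. Qed.

Lemma additive_scale (V : lmodType R) (W : lmodType int) (g : V -> W) (S : V -> Prop) :
  S 0 -> (forall u v, S u -> S v -> S (u - v)) ->
  (forall u v, S u -> S v -> g (u + v) = g u + g v) ->
  @linear_on int (zmodule V) W S g.
Proof.
move=> S0 SB gD; have SN u : S u -> S (- u) by rewrite -sub0r; apply: SB.
have SD u v : S u -> S v -> S (u + v) by move=> Su Sv; rewrite -(opprK v); exact: (SB _ _ Su (SN _ Sv)).
have g0 : g 0 = 0 by apply: (addrI (g 0)); rewrite -gD // !addr0.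
have gN u : S u -> g (- u) = - g u.
  by move=> Su; apply/eqP; rewrite -addr_eq0 -gD ?addNr ?g0 //; exact: SN.
have gn (n : nat) u : S u -> S (u *+ n) /\ g (u *+ n) = g u *+ n.
  move=> Su; elim: n => // n [Sn E]; rewrite !mulrS gD // E; split=> //; exact: SD.
have gz (k : int) u : S u -> S (u *~ k) /\ g (u *~ k) = k *: g u.
  move=> Su; case: k => n; first by rewrite -pmulrn -[X in X *: g u]natz scaler_nat; exact: gn.
  have [Sn E] := gn n.+1 u Su; rewrite NegzE mulrNz; split; first exact: SN.
  by rewrite gN // E -[X in (- X) *: g u]natz scaleNr scaler_nat.
move=> a u v Su Sv; have [Sa E] := gz a u Su.
by rewrite -E; exact: gD.
Qed.

(** An [R]-linear map to [chr] amounts to an additive map to [QZ], its value at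
    the unit; so [chr] is injective because [QZ] is. *)
Lemma chr_extends : extends chr.
Proof.
apply: baer_extends => J h sJ hl; have h0 := linear_on0 sJ hl.
have hD u v : J u -> J v -> h (u + v) = h u + h v.
  by move=> Ju Jv; have := hl 1 u v Ju Jv; rewrite !scale1r.
have hZ a u : J u -> h (a *: u) = a *: h u.
  by move=> Ju; have := hl a u 0 Ju (submodP0 sJ); rewrite h0 !addr0.
have [] := @baer_extends int QZ QZ_baer (zmodule R^o) J (fun r => chr_fun (h r) 1).
- split=> [|k u v Ju Jv]; first exact: submodP0 sJ.
  apply: (submodPD sJ) => //; have -> : k *: u = (k%:~R : R) *: (u : R^o).
    by rewrite scalezrE scaler_int.
  exact: (submodPZ sJ _ Ju).
- apply: (@additive_scale R^o QZ (fun r => chr_fun (h r) 1) J).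
  + exact: submodP0 sJ.
  + exact: submodPB sJ.
  + by move=> u v Ju Jv; rewrite hD.
move=> H HE; have hH : additive_fun (H : R -> QZ).
  by move=> x y; rewrite [x + y : R]/(x + y : zmodule R^o) linearD.
exists (mkchr hH) => r Jr; apply: chrP => x; rewrite chr_funZ mkchrE.
have Jx : J (x * r) by exact: (submodPZ sJ x Jr).
by rewrite (HE _ Jx) -[x * r]/(x *: (r : R^o)) hZ // chr_funZ mul1r.
Qed.

Lemma product_extends (I : Type) (V : I -> lmodType R) :
  (forall i, extends (V i)) -> extends (product_module V).
Proof.
move=> eV B S h sS hl.
have ex i : exists H : {linear B -> V i}, forall b, S b -> H b = h b i.
  by apply: (eV i B S (fun b => h b i) sS) => a u v Su Sv; rewrite hl.
pose H i := projT1 (cid (ex i)); have HE i : forall b, S b -> H i b = h b i := projT2 (cid (ex i)).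
have lH : linear (fun b => (fun i => H i b) : product_module V).
  by move=> a u v; apply: functional_extensionality_dep => i; rewrite linearP.
by exists (mklin lH) => b Sb; apply: functional_extensionality_dep => i; exact: HE.
Qed.

(** Embed [M] in the product of copies of [chr] over all maps from [M] to [chr];
    these separate points, because additive maps to [QZ] do. *)
Lemma enough_injectives (M : lmodType R) :
  exists (I : lmodType R) (g : {linear M -> I}), extends I /\ forall x, g x = 0 -> x = 0.
Proof.
exists (product_module (fun _ : {linear M -> (chr : lmodType R)} => (chr : lmodType R))).
have lg : linear (fun x : M => (fun t => t x) :
    product_module (fun _ : {linear M -> (chr : lmodType R)} => (chr : lmodType R))).
  by move=> a u v; apply: functional_extensionality_dep => t; rewrite linearP.
exists (mklin lg); split; first by apply: product_extends => _; exact: chr_extends.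
move=> x x0; apply: contrapT => /eqP xn.
have [t tx] := @QZ_separates (zmodule M) x xn.
have at' (y : M) : additive_fun (fun r : R => t (r *: y : M)).
  by move=> r s; rewrite scalerDl -[_ *: _ + _ *: _]/((r *: y : zmodule M) + (s *: y : zmodule M)) linearD.
have ls : linear (fun y : M => mkchr (at' y)).
  move=> a u v; apply: chrP => r; rewrite chr_funD chr_funZ !mkchrE.
  by rewrite scalerDr scalerA -[_ + _]/(((r * a) *: u : zmodule M) + (r *: v : zmodule M)) linearD.
have /(congr1 (fun F => chr_fun (F (mklin ls)) 1)) := x0.
rewrite -[LHS]/(t ((1 : R) *: x : M)) scale1r => t0.
by case/eqP: tx.
Qed.
End Characters.

(** * Injective dimension *)

Section InjectiveDimension.
Variable R : comNzRingType.
Implicit Types M N I : lmodType R.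

(** In positive cohomological degrees a cocycle vanishes on cycles, which
    are boundaries, so it defines
    a map on boundaries; this map extends by injectivity. *)
Lemma null_injective (K : gmod R) M I (e : {linear K -> M}) n :
  resolves e -> extends I -> n < 0 -> null K (stg I) n.
Proof.
move=> [_ [ep _] [ei _]] eI n0 z cz; have [z' ?] := cyc_lin cz; subst z; rename z' into z.
move/stg_cyc: cz => [zp zd]; apply/stg_bnd.
have sS : submodP (fun y : K => exists2 x, True & dd (pr (- n) x) = y).
  exact: (submodP_im (S := fun _ => True) (dd \o pr (- n))).
have z0 x : dd (pr (- n) x) = 0 -> z x = 0.
  move=> dx; rewrite -zp; have [|y ->] := ei _ dx; last exact: zd.
  by exists 0; rewrite raddf0 -ep stg_prE ifN //; lia.
have /choice[h hE] : forall y : K, exists c, forall x, dd (pr (- n) x) = y -> c = z x.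
  move=> y; have [[x xy]|n'] := pselect (exists x, dd (pr (- n) x) = y); last first.
    by exists 0 => x xy; case: n'; exists x.
  exists (z x) => x' xy'; apply/eqP; rewrite -subr_eq0 -raddfB; apply/eqP/z0.
  by rewrite !raddfB /= xy xy' subrr.
have [|H HE] := eI K _ h sS.
  move=> a _ _ [x _ <-] [y _ <-].
  by rewrite (hE _ x erefl) (hE _ y erefl) (hE _ (a *: x + y)) ?linearP.
have lw : linear (fun x => H (pr (- n - 1) x)) by move=> a u v; rewrite !linearP.
exists (mklin lw); split=> x; rewrite (mklinE lw) ?prK //.
by rewrite -dd_pr HE ?(hE _ x erefl) //; exists x.
Qed.

(** Injective dimension at most [n], with the cosyzygies kept in sight. *)
Fixpoint idim (n : nat) M : Prop :=
  if n is n'.+1 then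
    exists I N (i : {linear M -> I}) (p : {linear I -> N}),
      [/\ extends I, short_exact i p & idim n' N]
  else extends M.

Lemma coker_exact M I (i : {linear M -> I}) : (forall x, i x = 0 -> x = 0) ->
  exists N (p : {linear I -> N}), short_exact i p.
Proof.
move=> i0; have sI : submodP (fun y => exists2 x, True & i x = y) by exact: submodP_im.
exists (quo sI), (qp sI); split=> // [x|y|z].
- by apply/qp_eq0; exists x.
- by move=> /qp_eq0[x _ <-]; exists x.
- exact: qp_surj.
Qed.

(** Baer's criterion tests injectivity on the modules [R / J].  Embedding [M] in
    an injective module and passing to the cokernel lowers by one the degree from
    which [Ext] of these modules vanishes, whence the induction on [c]. *)
Lemma idim_of_null (c : nat) M :
  (forall (J : R^o -> Prop) (sJ : submodP J), exists (K : gmod R) (e : {linear K -> quo sJ}),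
     resolves e /\ forall n, n < - c%:Z -> null K (stg M) n) -> idim c M.
Proof.
elim: c M => [|c IH] M H /=.
  apply: baer_extends => J h sJ hl; have [K [e [re nK]]] := H J sJ.
  have lc : linear (fun v : 'rV[R]_1 => qp sJ (v 0 0)) by move=> a u v; rewrite !mxE linearP.
  have nM : null K (stg M) (- 1) by exact: nK.
  have [| |g gE] := @hom_extension R K (quo sJ) M e 1 (mklin lc) re nM _ (fun v => h (v 0 0)).
  - by move=> y; have [r <-] := qp_surj y; exists (const_mx r); rewrite (mklinE lc) mxE.
  - by move=> a u v /qp_eq0 Ju /qp_eq0 Jv; rewrite !mxE; exact: hl.
  exists (g (const_mx 1)) => r Jr; rewrite -linearZ_LR /=.
  rewrite -gE; first by rewrite !mxE mulr1.
  by apply/qp_eq0; rewrite !mxE mulr1.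
have [I [i [eI i0]]] := enough_injectives M; have [N [p ip]] := coker_exact i0.
exists I, N, i, p; split=> //; apply: IH => J sJ; have [K [e [re nK]]] := H J sJ.
exists K, e; split=> // n nc; have [sK _ _] := re.
apply: (null_step sK ip); first by apply: (null_injective re eI); lia.
by apply: nK; lia.
Qed.

(** The exact sequences of [idim] spliced together: [eps 0] and the maps [D j j.+1]
    form a coresolution of [M], and the other maps vanish.  Maps between any two
    indices are given, as in the definition of complexes, so that the splicing is
    a definition by cases without casts. *)
Definition coresolves (n : nat) M (X : nat -> lmodType R)
    (D : forall i j, {linear X i -> X j}) (eps : forall j, {linear M -> X j}) : Prop :=
  [/\ (forall i j x, j != i.+1 -> D i j x = 0) /\ (forall i j k x, D j k (D i j x) = 0),
      (forall j x, j != 0%N -> eps j x = 0) /\ (forall j k x, D j k (eps j x) = 0),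
      forall x, eps 0%N x = 0 -> x = 0,
      forall j y, D j j.+1 y = 0 -> exists x z, y = eps j x + D j.-1 j z &
      (forall j, extends (X j)) /\ forall j, (n < j)%N -> zero_module (X j)].

Lemma zero_mod_extends : extends ('rV[R]_0 : lmodType R).
Proof. by move=> B S h _ _; exists \0 => b _; rewrite [LHS]thinmx0 [RHS]thinmx0. Qed.

Lemma idim_coresolves n M : idim n M ->
  exists X D eps, @coresolves n M X D eps.
Proof.
elim: n M => [|n IH] M /=.
  move=> eM; pose X (j : nat) : lmodType R := if j is 0 then M else 'rV[R]_0.
  pose eps j : {linear M -> X j} := match j with 0%N => idfun | _.+1 => \0 end.
  exists X, (fun i j => \0), eps; split=> //.
  - by split=> // -[].
  - move=> [|j] y _; first by exists y, 0; rewrite addr0.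
    by exists 0, 0; rewrite [LHS]thinmx0 addr0.
  - split=> [[|j]|[|j]] //; first exact: zero_mod_extends.
    by move=> _ x; exact: thinmx0.
move=> [I [N [i [p [eI [i0 pi py ps] /IH[X' [D' [eps' [[D1 D2] [e1 e2] ei ex [eX X0]]]]]]]]]].
pose X (j : nat) : lmodType R := if j is j'.+1 then X' j' else I.
pose D i j : {linear X i -> X j} := match i, j with
  | 0%N, j'.+1 => eps' j' \o p
  | i'.+1, j'.+1 => D' i' j'
  | _, 0%N => \0 end.
pose eps j : {linear M -> X j} := match j with 0%N => i | _.+1 => \0 end.
exists X, D, eps; split.
- split=> [[|k] [|j] x|[|k] [|j] [|l] x] //=; rewrite ?raddf0 ?e2 ?D2 //.
  + by rewrite eqSS => /e1->.
  + by rewrite eqSS => /D1.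
- by split=> [[|j] x|[|j] [|l] x] //=; rewrite ?pi ?raddf0.
- exact: i0.
- move=> [|[|j]] y /=.
  + by move=> /ei/py[x ->]; exists x, 0; rewrite addr0.
  + move=> /ex[x [z ->]]; have [u <-] := ps x; exists 0, u.
    by rewrite add0r D1 // addr0.
  + move=> /ex[x [z ->]]; exists 0, z.
    by rewrite e1.
- by split=> [[|j]|[|j]] //= nj; apply: X0.
Qed.

End InjectiveDimension.

Section QuasiIso.
Variables (R : comNzRingType) (X Y : complex R) (q : chain_map X Y).

Lemma quasi_isoP :
  (forall n (x : X n), diff X n (n - 1) x = 0 ->
     (exists y, q n x = diff Y (n + 1) n y) -> exists z, x = diff X (n + 1) n z) ->
  (forall n (y : Y n), diff Y n (n - 1) y = 0 ->
     exists x z, diff X n (n - 1) x = 0 /\ y - q n x = diff Y (n + 1) n z) ->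
  quasi_iso q.
Proof.
move=> qi qs n.
have sur (h : homology Y n) : exists g : homology X n, homology_map q g = h.
  rewrite -[h]reprK; move: (repr h : cycles Y n) => y.
  have dy : diff Y n (n - 1) (val y) = 0 by exact/eqP/(valP y).
  have [x [z [dx xE]]] := qs n (val y) dy.
  exists (\pi_(homology X n) (cycle_of dx)); rewrite homology_map_pi.
  apply/esym/eqP; rewrite quotient_piE; apply/asboolP; exists z.
  by rewrite -xE.
have inj : injective (@homology_map R X Y q n).
  move=> h h'; rewrite -[h]reprK -[h']reprK.
  move: (repr h : cycles X n) (repr h' : cycles X n) => x x'.
  rewrite !homology_map_pi => /eqP; rewrite quotient_piE => /asboolP[z zE].
  apply/eqP; rewrite quotient_piE; apply/asboolP.
  have [||w wE] := qi n (val x - val x'); last by exists w; rewrite -wE.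
    by rewrite raddfB /= (eqP (valP x)) (eqP (valP x')) subrr.
  by exists z; rewrite zE raddfB.
have /choice[g gK] := sur.
by exists g => h; [apply: inj; rewrite gK|exact: gK].
Qed.
End QuasiIso.

Section Gorenstein.
Variables (R : comNzRingType) (M : lmodType R) (n : nat).
Variables (X : nat -> lmodType R) (D : forall i j, {linear X i -> X j}).
Variables (eps : forall j, {linear M -> X j}) (XP : coresolves n D eps).

(* A coresolution as a complex: the term [X j] is in degree [- j], and the index
   [0] is reserved for the positive degrees. *)
Let obj (i : nat) : lmodType R := if i is i'.+1 then X i' else 'rV[R]_0.
Let idx (i : int) : nat :=
  match i with Posz 0 => 1 | Posz _.+1 => 0 | Negz k => k.+2 end.
Let dif i j : {linear obj i -> obj j} := match i, j with
  | i'.+1, j'.+1 => D i' j'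
  | 0%N, _ | _, 0%N => \0 end.

Lemma coresolution_shape i j (x : obj (idx i)) : j != i - 1 -> dif (idx i) (idx j) x = 0.
Proof.
have [[D1 _] _ _ _ _] := XP.
case: i x => [[|i]|i] x; case: j => [[|j]|j] // ji; apply: D1.
all: by apply: contra ji; rewrite ?NegzE; lia.
Qed.

Lemma coresolution_diff i j k (x : obj (idx i)) :
  dif (idx j) (idx k) (dif (idx i) (idx j) x) = 0.
Proof.
have [[_ D2] _ _ _ _] := XP.
by case: (idx i) (idx j) (idx k) x => [|a] [|b] [|c] x //=; rewrite ?raddf0 // D2.
Qed.

Definition coresolution : complex R :=
  @Complex R (fun i => obj (idx i)) (fun i j => dif (idx i) (idx j))
    coresolution_shape coresolution_diff.

Definition coaugment_fun i : {linear stalk M i -> coresolution i} :=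
  match i with Posz 0 => eps 0 | Posz _.+1 => \0 | Negz _ => \0 end.

Lemma coaugment_diff i j (x : stalk M i) :
  diff coresolution i j (coaugment_fun i x) = coaugment_fun j (diff (stalk M) i j x).
Proof.
have [_ [_ e2] _ _ _] := XP; rewrite [RHS]raddf0.
case: i x => [[|i]|i] x; rewrite ?raddf0 //.
by case: j => [[|j]|j] //=; rewrite e2.
Qed.

Definition coaugment : chain_map (stalk M) coresolution := ChainMap coaugment_diff.

Lemma stalk_zero i (x : stalk M i) : i != 0 -> x = 0.
Proof. by move: x; rewrite /= /stalk_obj; case: eqP => // _ x _; exact: thinmx0. Qed.

Lemma coresolves_fid : finite_injective_dimension M.
Proof.
have [[D1 _] [e1 _] ei ex [eX X0]] := XP.
exists n, coresolution, coaugment; split.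
- by case=> [[|i]|i]; apply: extends_injective => //=; exact: zero_mod_extends.
- case=> [[|i]|i] h; [by lia|by move=> x; exact: (thinmx0 (x : 'rV[R]_0))|].
  by apply: X0; move: h; rewrite NegzE; lia.
apply: quasi_isoP => [k x dx|].
  have [k0|/eqP kn] := pselect (k = 0); last by move=> _; exists 0; rewrite raddf0; exact: stalk_zero.
  by subst k => -[y yE]; exists 0; rewrite raddf0; apply: ei; exact: yE.
case=> [[|k]|k] y.
- move=> /ex[x [z yE]]; exists x, 0; split=> //.
  have E : (y : X 0) - eps 0 x = 0.
    by apply/eqP; rewrite subr_eq0; apply/eqP; apply: etrans yE _; rewrite D1 ?addr0.
  exact: etrans E (esym (raddf0 (dif 0 1))).
- by move=> _; exists 0, 0; split=> //; exact: etrans (thinmx0 (_ : 'rV[R]_0)) (esym (thinmx0 (_ : 'rV[R]_0))).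
have E1 : idx (Negz k - 1) = k.+3 by rewrite /idx NegzE; case E: (_ - 1); lia.
have E2 : idx (Negz k + 1) = k.+1 by rewrite /idx NegzE; case E: (_ + 1) => [[|i]|i]; lia.
have to_dif a : a = k.+3 -> dif k.+2 a y = 0 -> D k.+1 k.+2 y = 0 by move=> ->.
move=> /(to_dif _ E1)/ex[x [z yE]]; exists 0.
suff [z' zE] : exists z' : obj (idx (Negz k + 1)), y = dif (idx (Negz k + 1)) k.+2 z'.
  by exists z'; split; [exact: raddf0|exact: etrans (subr0 y) zE].
by rewrite E2; exists z; rewrite yE e1 // add0r.
Qed.
End Gorenstein.

(** * Regular sequences and dimension *)

Section Krull.
Variable R : comNzRingType.

Definition prime_ideal (p : R^o -> Prop) : Prop :=
  [/\ submodP p, ~ p 1 & forall a b : R, p (a * b : R) -> p a \/ p b].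

(** The boolean predicate on which the structure of prime ideal is declared. *)
Definition prime_pred (p : R^o -> Prop) (pp : prime_ideal p) : {pred R} :=
  fun x => `[< p x >].

Lemma prime_pred_closed p (pp : prime_ideal p) : idealr_closed (prime_pred pp).
Proof.
have [sp p1 _] := pp; split=> [||a u v].
- exact/asboolP/(submodP0 sp).
- by apply/negP => /asboolP.
- by move=> /asboolP pu /asboolP pv; apply/asboolP; exact: (submodPD sp (submodPZ sp a pu) pv).
Qed.

Lemma prime_pred_prime p (pp : prime_ideal p) : prime_idealr_closed (prime_pred pp).
Proof.
have [_ _ pM] := pp => u v /asboolP/pM[pu|pv]; apply/orP; [left|right]; exact/asboolP.
Qed.

HB.instance Definition _ p (pp : prime_ideal p) :=
  isIdealr.Build R (prime_pred pp) (prime_pred_closed pp).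
HB.instance Definition _ p (pp : prime_ideal p) :=
  isPrimeIdealrClosed.Build R (prime_pred pp) (@prime_pred_prime p pp).

Hypothesis noethR : noetherian R.

(** By noetherian induction: if [I] is not prime, say [a b] lies in [I], one of
    [I + a R] and [I + b R] still misses [S], because the product of elements of
    [S] in both would be in [I] and in [S]. *)
Lemma prime_avoiding (S : R -> Prop) : (forall a b, S a -> S b -> S (a * b)) -> S 1 ->
  forall I : R^o -> Prop, submodP I -> (forall x, I x -> ~ S x) ->
  exists q, [/\ prime_ideal q, forall x, I x -> q x & forall x, q x -> ~ S x].
Proof.
move=> SM S1; apply: (ideal_ind noethR) => I sI IH IS.
have [prI|] := pselect (forall a b : R, I (a * b : R) -> I a \/ I b).
  by exists I; split=> //; split=> // /IS.
move/existsNP => [a /existsNP[b /not_implyP[Iab /not_orP[nIa nIb]]]].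
have [Sa|nSa] := pselect (exists x, adj a I x /\ S x); last first.
  have [|||q [pq aq qS]] := IH _ (adj_sub a sI); first exact: adj_mem.
  - by exists (a : R^o) => //; exact: adj_self.
  - by move=> x ax Sx; apply: nSa; exists x.
  - by exists q; split=> // x Ix; apply/aq/adj_mem.
have [Sb|nSb] := pselect (exists x, adj b I x /\ S x); last first.
  have [|||q [pq aq qS]] := IH _ (adj_sub b sI); first exact: adj_mem.
  - by exists (b : R^o) => //; exact: adj_self.
  - by move=> x ax Sx; apply: nSb; exists x.
  - by exists q; split=> // x Ix; apply/aq/adj_mem.
case: Sa => _ [[u [i [Ii ->]]] Su]; case: Sb => _ [[v [j [Ij ->]]] Sv].
case: (IS _ _ (SM _ _ Su Sv)).
have -> : (a *: u + i) * (b *: v + j) =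
    (u * v) *: (a * b : R^o) + ((b * v + j) *: (i : R^o) + (a * u) *: (j : R^o)).
  rewrite -![_ *: _]/(_ * _) /=; ring.
apply: (submodPD sI); first exact: (submodPZ sI).
by apply: (submodPD sI); apply: (submodPZ sI).
Qed.

(** A prime that contains an element [x] regular modulo [I] is not minimal over
    [I]: [I] misses the products [s x ^ n] with [s] outside of the prime. *)
Lemma prime_below (I p : R^o -> Prop) (x : R) : submodP I -> prime_ideal p ->
  (forall y, I y -> p y) -> p x -> (forall y : R^o, I (x * y : R) -> I y) ->
  exists q, [/\ prime_ideal q, forall y, I y -> q y, forall y, q y -> p y & ~ q x].
Proof.
move=> sI [sp p1 pM] Ip px regx.
pose S (y : R) := exists s n, ~ p s /\ y = s * x ^+ n.
have [|||q [pq Iq qS]] := @prime_avoiding S _ _ I sI.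
- move=> _ _ [s [n [ps ->]]] [t [k [pt ->]]]; exists (s * t), (n + k)%N.
  by split=> [/pM[]//|]; rewrite exprD; ring.
- by exists 1, 0%N; rewrite mulr1.
- move=> y Iy [s [n [ps yE]]]; apply/ps/Ip; move: Iy; rewrite {}yE.
  elim: n => [|n IH]; first by rewrite mulr1.
  by rewrite exprS mulrCA => /regx.
exists q; split=> // [y qy|qx].
- by apply: contrapT => py; apply: (qS y qy); exists y, 0%N; rewrite mulr1.
- by apply: (qS x qx); exists 1, 1%N; rewrite mul1r.
Qed.

Definition chain_of_primes (n : nat) (P : nat -> R^o -> Prop) : Prop :=
  (forall i, prime_ideal (P i)) /\ forall i, (i < n)%N ->
    (forall x, P i x -> P i.+1 x) /\ exists2 x, P i.+1 x & ~ P i x.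

(** The primes are found from the top: below a prime containing [f_1, ..., f_i]
    there is one containing [f_1, ..., f_(i-1)] but not [f_i]. *)
Lemma regular_chain (f : seq R^o) : regular_sequence f ->
  forall i, (i <= size f)%N -> forall p, prime_ideal p ->
  (forall x, in_span (take i f) x -> p x) ->
  exists P, chain_of_primes i P /\ P i = p.
Proof.
move=> [_ regf]; elim=> [|i IH] li p pp fp; first by exists (fun _ => p).
have spi x : in_span (take i f) x -> p x.
  move=> fx; apply: fp; rewrite (take_nth 0 li) -cats1; apply/in_span_cat.
  by exists x, 0; rewrite addr0; split=> //; exact: submodP0 (in_span_sub _).
have [|||q [pq fq qp nq]] := @prime_below _ p f`_i (in_span_sub (take i f)) pp.
- exact: spi.
- by apply: fp; apply: in_span_gen; rewrite (take_nth 0 li) mem_rcons mem_head.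
- exact: regf.
have [P [[pP chP] Pi]] := IH (ltnW li) q pq fq.
exists (fun j => if (j <= i)%N then P j else p); split; last by rewrite ltnn.
split=> [j|j lj]; first by case: ifP.
have -> : (j <= i)%N by [].
case: ltnP => [ji|ij]; first exact: chP.
have -> : j = i by apply/eqP; rewrite eqn_leq ij -ltnS lj.
rewrite Pi; split=> //; exists f`_i => //.
by apply: fp; apply: in_span_gen; rewrite (take_nth 0 li) mem_rcons mem_head.
Qed.

Lemma chain_prime_chain n P : chain_of_primes n P -> prime_chain R n.
Proof.
move=> [pP chP]; exists (fun i => (prime_pred (pP i) : prime_idealr R)) => i li.
have [sP [x Px nPx]] := chP i li; split=> [y|].
  by move=> /asboolP/sP Py; exact/asboolP.
by exists x; [exact/asboolP|apply/negP => /asboolP].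
Qed.

End Krull.

Section KrullLocal.
Variables (R : comNzRingType) (m : submodClosed R^o).
Hypothesis locR : local_ring m.

Lemma max_prime : prime_ideal (fun x : R^o => x \in m).
Proof.
split=> [||a b ab]; first exact: submodP_mem.
  exact/negP/(one_notin locR).
have [am|na] := boolP (a \in m); first by left.
right; have [y ya] := unitP locR na.
by rewrite -[b]mul1r -ya -mulrA; exact: (rpredZ y).
Qed.

Lemma regular_length (f : seq R^o) d : regular_sequence f -> krull_dim R d -> (size f <= d)%N.
Proof.
move=> regf [_ dim]; apply: dim.
have [|P [chP _]] := regular_chain (local_noeth locR) regf (leqnn _) max_prime.
  rewrite take_size => x fx; case: regf => f1 _.
  exact: (ideal_sub_max locR (in_span_sub f) f1).
exact: chain_prime_chain chP.
Qed.
End KrullLocal.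

(** * Gorenstein rings from vanishing of Ext *)

Section Final.
Variables (R : comNzRingType) (m : submodClosed R^o).

Lemma ideal_mulM (I J : set R) a b : I a -> J b -> ideal_mul I J (a * b).
Proof. by move=> Ia Jb; exists 1%N, (fun=> a), (fun=> b); rewrite big_ord1. Qed.

Lemma cube_mem (x1 x2 x3 : R) : x1 \in m -> x2 \in m -> x3 \in m ->
  ideal_exp [set x : R | x \in m]%classic 3 (x1 * x2 * x3).
Proof.
move=> m1 m2 m3; rewrite -mulrA; apply: ideal_mulM => //; apply: ideal_mulM => //.
by rewrite -[x3]mulr1; exact: ideal_mulM.
Qed.

Lemma null_stalk (K : gmod R) (N : lmodType R) n :
  null K (tot (stalk N)) n -> null K (stg N) n.
Proof. exact: null_retract (stalk_unpack_chmap N) (stalk_pack_chmap N) (@stalk_packK R N). Qed.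

Hypothesis locR : local_ring m.

(** Each vanishing hypothesis comes with its own resolution of [D].  All of them
    resolve the module [H0 Y] by [augment], so they can be replaced by a single
    resolution [tot P0]. *)
Lemma dualizing_gorenstein (D : complex R) (f : seq R^o) :
  dualizing m D -> normalized D -> regular_sequence f ->
  cube_in m (in_span f) ->
  (forall i : nat, (0 < i <= (size f).+1)%N -> Ext_zero D (stalk R^o) i%:Z) ->
  gorenstein R.
Proof.
move=> [[fgD _] [d0 [isoD zeroD]]] [negD nzD] regf m3 extD.
set Y := tot D.
have fgm : fin_gen (residue_field m).
  exists [:: qpi m (1 : R^o)] => x; have [r <-] := qpi_surj x; exists (fun=> r).
  by rewrite big_ord1 -linearZ_LR -[r *: _]/(r * 1) mulr1.
have [K0 [e0 [res0 _]]] := free_resolution (local_noeth locR) fgm.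
have trans n : n != - d0 -> null K0 Y n.
  move=> nd; have nd' : - n != d0 by apply: contra nd => /eqP<-; rewrite opprK.
  have [F] := Ext_zero_null (zeroD _ nd'); rewrite opprK.
  have [e re] := resolution_resolves F.
  exact: (null_iso (f := idfun) (g := idfun) re res0 (fun=> erefl)).
have [F [thinF nnF]] := Ext_iso_thin (one_notin locR) isoD.
have [eF rF] := resolution_resolves F.
have thinY := thin_iso rF res0 thinF.
have nnY : ~ null K0 Y (- d0).
  by move=> n; apply/nnF/(null_iso (f := idfun) (g := idfun) res0 rF (fun=> erefl)).
have fgY n := tot_homology_fg (fgD n).
have [|dE exY mregw faithw] := omega_facts locR regf m3 res0 fgY trans nnY.
  apply: contrapT => n; apply: nzD; apply/tot_homology0 => y yn dy.
  by apply: contrapT => ny; apply: n; exists y.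
have aug (F' : proj_resolution D) : exists e : {linear tot F' -> H0 Y}, resolves e.
  apply: (augment _ (totm_chmap (res_map F')) (totm_qiso (@res_quasi_iso _ _ F')) exY).
  exact: (tot_semifree (res_bounded_below F') (@res_projective _ _ F')).
have [P0 _] := extD 1%N isT; have [eP rP] := aug P0.
have extP i : (0 < i <= (size f).+1)%N -> null (tot P0) (stg R^o) (- i%:Z).
  move=> /extD/Ext_zero_null[P1 nP1]; have [e1 r1] := aug P1.
  apply: (null_iso (f := idfun) (g := idfun) r1 rP (fun=> erefl)).
  exact: null_stalk.
have [sK0 _ _] := res0; have [_ cP qP] := rP.
have hq := totm_chmap (res_map P0); have qq := totm_qiso (@res_quasi_iso _ _ P0).
have nullw n : n != - (size f)%:Z -> null K0 (stg (H0 Y)) n.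
  rewrite -dE => nd; apply/(null_qiso n sK0 cP qP)/(null_qiso n sK0 hq qq).
  exact: trans.
have thinw : thin m K0 (stg (H0 Y)) (- (size f)%:Z).
  by rewrite -dE; apply/(thin_qiso m _ sK0 cP qP)/(thin_qiso m _ sK0 hq qq).
have nR := null_ring locR regf m3 (H0_fin_gen (fgY 0)) mregw faithw res0 nullw thinw rP extP.
have [X [E [eps XP]]] : exists X E eps, @coresolves R (size f) R^o X E eps; last first.
  exact: coresolves_fid XP.
apply/idim_coresolves/idim_of_null => J sJ.
have [K [e [re _]]] := quo_resolution locR sJ; exists K, e; split=> // n nf.
apply: (ext_vanish_all locR res0 _ sJ re nf) => // n' nf'.
by apply: nR; rewrite lt_eqF.
Qed.
End Final.

Theorem theorem5p1 (R : comNzRingType) (m : submodClosed R^o) (D : complex R)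
    (f : seq R^o) (d : nat) :
  local_ring m ->
  dualizing m D -> normalized D ->
  regular_sequence f ->
  (forall x : R, ideal_exp [set x : R | x \in m] 3 x -> in_span f x) ->
  krull_dim R d ->
  (forall i : int, 1 <= i -> i <= d%:Z + 1 -> Ext_zero D (stalk R^o) i) ->
  gorenstein R.
Proof.
move=> locR dD nD regf mf dimR extD.
have fd := regular_length locR regf dimR.
apply: (dualizing_gorenstein locR dD nD regf) => [x1 x2 x3 m1 m2 m3|i /andP[i0 ic]].
  by apply: mf; exact: cube_mem.
by apply: extD; lia.
Qed.
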